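(* Let $(X,d)$ be a geodesic metric space with basepoint $o$, let $G$ be a countable group of isometries of $X$, and let $g\in G$ be a WPD contracting isometry. Let $\mu$ be a probability measure on $G$ such that $\mu^{*n}(g^m)>0$ for some $n,m>0$, and let $\{\mu_i\}_{i>0}$ be a sequence of probability measures on $G$ that converges simply to $\mu$ (i.e. $\mu_i(x)\to\mu(x)$ for every $x\in G$) with $H(\mu_i)\to H(\mu)$. Then $h(\mu_i)\to h(\mu)$.
   Context: A $K$-quasigeodesic $\gamma$ is a $K$-contracting axis if the closest-point projection onto $\gamma$ of every geodesic not entering the $K$-neighborhood of $\gamma$ has diameter $<K$; an isometry $g$ is contracting if $\{g^io\}_{i\in\mathbb Z}$ is a $K$-contracting axis for some $K$. A contracting isometry $g\in G$ is WPD if for each $K\ge0$ there exists $N>0$ such that $\{h\in G: d(o,ho)\le K,\ d(g^No,hg^No)\le K\}$ is finite. The time-one entropy is $H(\mu)=-\sum_{x\in G}\mu(x)\log\mu(x)$ and the asymptotic entropy is $h(\mu)=\lim_{n\to\infty}H(\mu^{*n})/n$.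
   Formalization: The formal theorem additionally assumes H(μ) < ∞; without it the claim fails, e.g. for G = Z acting on R by translations, μ of infinite entropy with μ(1) > 0, and μ_i its normalized finite truncations: H(μ_i) → ∞ = H(μ), but h(μ_i) = 0 while h(μ) = ∞. *)

(* Defs.v *)
From HB Require Import structures.
From mathcomp Require Import all_boot all_order all_algebra.
From mathcomp Require Import all_classical all_reals all_analysis.
Set Implicit Arguments. Unset Strict Implicit. Unset Printing Implicit Defensive.
Import Order.TTheory GRing.Theory Num.Theory.
Local Open Scope classical_set_scope.
Local Open Scope ring_scope.

Section Defs.
Variables (R : realType) (X : choiceType).

Definition is_metric (d : X -> X -> R) : Prop :=
  (forall x y, 0 <= d x y) /\ (forall x y, d x y = 0 <-> x = y) /\
  (forall x y, d x y = d y x) /\ (forall x y z, d x z <= d x y + d y z).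

Definition geodesic_seg (d : X -> X -> R) (L : R) (c : R -> X) : Prop :=
  0 <= L /\ forall s t, 0 <= s <= L -> 0 <= t <= L -> d (c s) (c t) = `|s - t|.

Definition geodesic_space (d : X -> X -> R) : Prop :=
  is_metric d /\ forall x y, exists c : R -> X,
    geodesic_seg d (d x y) c /\ c 0 = x /\ c (d x y) = y.

Definition isometry (d : X -> X -> R) (f : X -> X) : Prop :=
  bijective f /\ forall x y, d (f x) (f y) = d x y.

Definition countable_isometry_group (d : X -> X -> R) (G : set (X -> X)) : Prop :=
  countable G /\ (forall f, G f -> isometry d f) /\ G id /\
  (forall f g, G f -> G g -> G (f \o g)) /\
  (forall f, G f -> exists f', G f' /\ f' \o f = id /\ f \o f' = id).

Definition zpow (g gi : X -> X) (n : int) : X -> X :=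
  match n with Posz k => iter k g | Negz k => iter k.+1 gi end.

Local Open Scope ereal_scope.
Definition dist_set (d : X -> X -> R) (A : set X) (x : X) : \bar R :=
  ereal_inf [set (d x a)%:E | a in A].

Definition proj (d : X -> X -> R) (A : set X) (x : X) : set X :=
  [set a | A a /\ (d x a)%:E = dist_set d A x].

Definition diam (d : X -> X -> R) (S : set X) : \bar R :=
  ereal_sup [set (d p.1 p.2)%:E | p in [set p : X * X | S p.1 /\ S p.2]].
Local Close Scope ereal_scope.

Definition quasigeodesic (d : X -> X -> R) (K : R) (gamma : int -> X) : Prop :=
  0 < K /\ forall m n : int,
    (`|m - n|%:~R / K - K <= d (gamma m) (gamma n)) /\
    (d (gamma m) (gamma n) <= K * `|m - n|%:~R + K).

Definition contracting_axis (d : X -> X -> R) (K : R) (gamma : int -> X) : Prop :=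
  quasigeodesic d K gamma /\
  forall (L : R) (c : R -> X), geodesic_seg d L c ->
    (forall t, 0 <= t <= L -> (K%:E <= dist_set d (range gamma) (c t))%E) ->
    (diam d (\bigcup_(t in [set t : R | (0 <= t <= L)%R]) proj d (range gamma) (c t))
       < K%:E)%E.

Definition contracting (d : X -> X -> R) (o : X) (g : X -> X) : Prop :=
  exists gi K, gi \o g = id /\ g \o gi = id /\
    contracting_axis d K (fun i => zpow g gi i o).

Definition WPD (d : X -> X -> R) (G : set (X -> X)) (o : X) (g : X -> X) : Prop :=
  contracting d o g /\
  forall K : R, 0 <= K -> exists N : nat, (0 < N)%N /\
    finite_set [set h | G h /\ d o (h o) <= K /\
                        d (iter N g o) (h (iter N g o)) <= K].

Definition prob_on (G : set (X -> X)) (mu : (X -> X) -> R) : Prop :=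
  (forall f, 0 <= mu f) /\ (forall f, ~ G f -> mu f = 0) /\
  (\esum_(f in G) (mu f)%:E = 1)%E.

Definition conv (G : set (X -> X)) (mu nu : (X -> X) -> R) : (X -> X) -> R :=
  fun x => fine (\esum_(p in [set p : (X -> X) * (X -> X) |
                     G p.1 /\ G p.2 /\ p.1 \o p.2 = x]) (mu p.1 * nu p.2)%:E).

Definition dirac_id (f : X -> X) : R := if pselect (f = id) then 1 else 0.

Fixpoint conv_pow (G : set (X -> X)) (mu : (X -> X) -> R) (n : nat) : (X -> X) -> R :=
  match n with 0 => dirac_id | n'.+1 => conv G (conv_pow G mu n') mu end.

Definition entropy (G : set (X -> X)) (mu : (X -> X) -> R) : \bar R :=
  (\esum_(f in G) (- (mu f * ln (mu f)))%:E)%E.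

Definition asymp_entropy (G : set (X -> X)) (mu : (X -> X) -> R) : \bar R :=
  limn (fun n : nat => (entropy G (conv_pow G mu n) * (n%:R^-1)%:E)%E).

End Defs.

(* Main.v *)
(* Upper semicontinuity of h is soft: H(mu_i^{*n}) -> H(mu^{*n}) for each n by
   Fatou's lemma applied to the entropies and to the defects of subadditivity,
   and h is an infimum.  For lower semicontinuity it suffices to find, for every
   e > 0, a k such that H_n + H_k <= H_{n+k} + e k for all mu_i with i large and
   all n large, i.e. that k steps can be recovered from the endpoint w of a
   path of length n + k at a cost of at most e k nats.

   Let gamma be the axis of g.  An isometry f either maps every point whose
   projection to gamma is far from o to one whose projection is near o (f
   "disperses"), or, by WPD, moves gamma a bounded distance along itself.

   If some f in the semigroup generated by the support of mu disperses, then the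
   words (f u)^i u^L (u f)^(n-i), u a power of g, all have the same length, and
   for any past and any future at most two of them fail to create a detour
   along a translate of gamma.  Inserting them shows that, uniformly in i and in
   the past z, outside an event of small probability the geodesic [o, w o] follows
   a translate of gamma near z o.  At such times z is determined by w and its
   location on [o, w o], up to finitely many choices (WPD).  So one only records
   the steps that are long or that touch a bad time, plus a direction bit; the
   other locations follow by adding step lengths, up to an error linear in k,
   which costs O(log k).  Gibbs' inequality turns the code into the estimate.

   If nothing disperses, the whole walk stays along gamma, the same code with
   gamma in place of [o, w o] describes the walk at cost e k, and h(mu) = 0. *)
Require Import Defs.
From HB Require Import structures.
From mathcomp Require Import all_boot all_order all_algebra.
From mathcomp Require Import all_classical all_reals all_analysis.
From mathcomp Require Import ring lra zify.
Import Order.TTheory GRing.Theory Num.Theory numFieldNormedType.Exports.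
Set Implicit Arguments. Unset Strict Implicit. Unset Printing Implicit Defensive.
Local Open Scope classical_set_scope.
Local Open Scope ring_scope.
Local Notation conv := Defs.conv.

(** * Expectations and Gibbs' inequality *)

Section NonnegativeSums.
Context {R : realType}.
Local Open Scope ereal_scope.

(** Simple convergence controls only finitely many group elements at a time, and [mu] may have no
    finite moment. So each estimate is cut down to a finite list before [i] varies: [F] for the
    steps, [V] for the detours, the Schottky words themselves. Steps outside [F] get no geometric
    estimate at all; they are written out in full, at the price of the tail of the entropy, which is
    uniformly small because [H(mu_i)] converges to [H(mu)].

    The failure probability of detours is made small without any rate. Let [Q] be the infimum of the
    failure bounds that finite lists can achieve. Giving mass [alpha] to each of [n] words replaces
    a share [alpha * n * Q] of the bound by [alpha * (Q + 1)], which would push it below [Q] as soon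
    as [n * Q > Q + 1]; hence [Q = 0].

    No conditional entropy and no injective code is needed: Gibbs' inequality compares the law of
    the pair (first [k] steps, rest of the path) with the law that draws an endpoint, a random code
    and one of the remaining candidates. The weight of the right code is all that has to be
    bounded. *)

Lemma exchange_esum (I J : choiceType) (a : I -> J -> \bar R) :
  (forall i j, 0 <= a i j) ->
  \esum_(i in setT) \esum_(j in setT) a i j =
  \esum_(j in setT) \esum_(i in setT) a i j.
Proof.
move=> a0; rewrite !esum_esum//.
rewrite (@reindex_esum _ _ _ (setT `*`` (fun=> setT)) (setT `*`` (fun=> setT))
  (fun k : J * I => (k.2, k.1)) (fun k : I * J => a k.1 k.2))//.
split; first by move=> [x y].
  by move=> [x y] [x' y'] _ _ [-> ->].
by move=> [x y] _; exists (y, x).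
Qed.

(** Partial sums give one inequality; the same inequality for [c^-1] and the terms [c%:E * a i]
    gives the other. *)
Lemma esumZl (I : choiceType) (P : set I) (c : R) (a : I -> \bar R) : (0 <= c)%R ->
  (forall i, 0 <= a i) ->
  \esum_(i in P) (c%:E * a i) = c%:E * \esum_(i in P) a i.
Proof.
move=> c0 a0.
have le (b : I -> \bar R) (e : R) : (0 <= e)%R -> (forall i, 0 <= b i) ->
    \esum_(i in P) (e%:E * b i) <= e%:E * \esum_(i in P) b i.
  move=> e0 b0; apply: ge_ereal_sup => _ [F [finF FP]] <-.
  rewrite fsbig_finite//= -ge0_sume_distrr; last by move=> i _; exact: b0.
  rewrite lee_wpmul2l//; apply: ereal_sup_ubound; exists F => //.
  by rewrite fsbig_finite.
apply/eqP; rewrite eq_le; apply/andP; split; first exact: le.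
have [ce|cn] := eqVneq c 0%R.
  by rewrite ce mul0e esum_ge0// => i _; rewrite mul0e.
have {}c0 : (0 < c)%R by rewrite lt0r cn.
have ca0 i : 0 <= c%:E * a i by rewrite mule_ge0// lee_fin ltW.
have := le (fun i => c%:E * a i) c^-1%R; rewrite invr_ge0 (ltW c0) => /(_ isT ca0).
under eq_esum do rewrite muleA -EFinM mulVf ?gt_eqF// mul1e.
move=> h; rewrite -(@lee_pmul2l _ c^-1%:E)//; last by rewrite lte_fin invr_gt0.
by rewrite muleA -EFinM mulVf ?gt_eqF// mul1e.
Qed.

(** For [c = +oo]: if all terms vanish, both sides are [0]; otherwise one positive term makes both
    sides [+oo]. *)
Lemma esumZle (I : choiceType) (P : set I) (c : \bar R) (a : I -> \bar R) :
  0 <= c -> (forall i, 0 <= a i) ->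
  \esum_(i in P) (c * a i) = c * \esum_(i in P) a i.
Proof.
case: c => [r r0|_|//] a0; first exact: esumZl.
have [h|/existsNP[i /not_implyP[Pi /eqP ai]]] :=
    pselect (forall i, P i -> a i = 0).
  by rewrite !esum1 ?mule0// => i /h ->; rewrite mule0.
have {}ai : 0 < a i by rewrite lt0e ai a0.
have ge (b : I -> \bar R) : (forall j, 0 <= b j) -> b i <= \esum_(j in P) b j.
  move=> b0; rewrite esum_ge//; exists [set i]; first by split=> // j ->.
  by rewrite fsbig_set1.
rewrite [RHS]gt0_mulye; last exact: lt_le_trans (ge _ a0).
apply/eqP; rewrite -leye_eq -{1}(gt0_mulye ai).
by apply: (ge (fun j => +oo * a j)) => j; rewrite mule_ge0// leey.
Qed.

Lemma esum_eq1 (I : choiceType) (t : I) (a : I -> \bar R) : 0 <= a t ->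
  (forall i, i <> t -> a i = 0) -> \esum_(i in setT) a i = a t.
Proof.
move=> at0 a0; rewrite -[RHS](@esum_set1 R I t a)// [RHS]esum_mkcond.
apply: eq_esum => i _; case: ifPn => //; rewrite notin_setE/= => it.
exact: a0.
Qed.

Lemma esum_ge1 (I : choiceType) (P : set I) (t : I) (a : I -> \bar R) : P t ->
  (forall i, P i -> 0 <= a i) -> a t <= \esum_(i in P) a i.
Proof.
move=> Pt a0; rewrite esum_ge//; exists [set t].
  by split=> // i ->.
by rewrite fsbig_set1.
Qed.

(** Extended-real values avoid questions of summability. The weight [p] need not have mass one: it
    is an entropy density in [entropy_tail] and the remainder of a law in [admissible_step]. *)
Definition E (I : choiceType) (p : I -> R) (f : I -> \bar R) :=
  \esum_(x in setT) ((p x)%:E * f x).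

Section Expectation.
Context {I : choiceType}.
Implicit Types (p : I -> R) (f h : I -> \bar R).

Lemma E_ge0 p f : (forall x, 0 <= p x)%R -> (forall x, 0 <= f x) -> 0 <= E p f.
Proof. by move=> p0 f0; apply: esum_ge0 => x _; rewrite mule_ge0// lee_fin. Qed.

Lemma le_E p f h : (forall x, 0 <= p x)%R ->
  (forall x, (0 < p x)%R -> f x <= h x) -> E p f <= E p h.
Proof.
move=> p0 fh; apply: le_esum => x _.
have := p0 x; rewrite le_eqVlt => /predU1P[<-|px]; first by rewrite !mul0e.
by rewrite lee_wpmul2l ?lee_fin ?(ltW px)//; exact: fh.
Qed.

Lemma eq_E p f h : (forall x, p x != 0%R -> f x = h x) -> E p f = E p h.
Proof.
move=> fh; apply: eq_esum => x _.
by have [->|/fh ->//] := eqVneq (p x) 0%R; rewrite !mul0e.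
Qed.

Lemma ED p f h : (forall x, 0 <= p x)%R -> (forall x, 0 <= f x) ->
  (forall x, 0 <= h x) -> E p (fun x => f x + h x) = E p f + E p h.
Proof.
move=> p0 f0 h0; rewrite /E -esumD; last 2 first.
- by move=> x _; rewrite mule_ge0// lee_fin.
- by move=> x _; rewrite mule_ge0// lee_fin.
by apply: eq_esum => x _; rewrite ge0_muleDr.
Qed.

Lemma EZl p f (c : R) : (0 <= c)%R -> (forall x, 0 <= p x)%R ->
  (forall x, 0 <= f x) -> E p (fun x => c%:E * f x) = c%:E * E p f.
Proof.
move=> c0 p0 f0; rewrite /E -esumZl//.
  by apply: eq_esum => x _; rewrite muleCA.
by move=> x; rewrite mule_ge0// lee_fin.
Qed.

Lemma EZle p f (c : \bar R) : 0 <= c -> (forall x, 0 <= p x)%R ->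
  (forall x, 0 <= f x) -> E p (fun x => c * f x) = c * E p f.
Proof.
move=> c0 p0 f0; rewrite /E -esumZle//.
  by apply: eq_esum => x _; rewrite muleCA.
by move=> x; rewrite mule_ge0// lee_fin.
Qed.

Lemma E_cst p (c : R) : (0 <= c)%R -> (forall x, 0 <= p x)%R ->
  E p (fun=> c%:E) = c%:E * E p (fun=> 1).
Proof.
by move=> c0 p0; rewrite -EZl//; apply: eq_E => x _; rewrite mule1.
Qed.

Lemma E_esum (J : choiceType) p (a : I -> J -> \bar R) : (forall x, 0 <= p x)%R ->
  (forall x j, 0 <= a x j) ->
  E p (fun x => \esum_(j in setT) a x j) = \esum_(j in setT) E p (a^~ j).
Proof.
move=> p0 a0; rewrite /E -exchange_esum; last first.
  by move=> i j; rewrite mule_ge0// lee_fin.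
by apply: eq_esum => x _; rewrite esumZl.
Qed.

Lemma E_ge1 p f t : (forall x, 0 <= p x)%R -> (forall x, 0 <= f x) ->
  (p t)%:E * f t <= E p f.
Proof.
move=> p0 f0; apply: (@esum_ge1 _ setT t (fun x => (p x)%:E * f x)) => // i _.
by rewrite mule_ge0// lee_fin.
Qed.

Lemma E_eq1 p f t : (forall x, 0 <= p x)%R -> 0 <= f t ->
  (forall x, x <> t -> f x = 0) -> E p f = (p t)%:E * f t.
Proof.
move=> p0 ft f0; rewrite /E (@esum_eq1 _ t)//.
  by rewrite mule_ge0// lee_fin.
by move=> i /f0 ->; rewrite mule0.
Qed.

End Expectation.

Definition pmf (I : choiceType) (p : I -> R) :=
  (forall x, 0 <= p x)%R /\ E p (fun=> 1) = 1.

Lemma pmf_ge0 (I : choiceType) (p : I -> R) : pmf p -> forall x, (0 <= p x)%R.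
Proof. by case. Qed.

Lemma pmf_cst (I : choiceType) (p : I -> R) (c : R) : pmf p -> (0 <= c)%R ->
  E p (fun=> c%:E) = c%:E.
Proof. by move=> [p0 p1] c0; rewrite E_cst// p1 mule1. Qed.

Lemma pmf_gt0 (I : choiceType) (p : I -> R) : pmf p -> exists x, (0 < p x)%R.
Proof.
move=> [p0 p1]; apply: contrapT => /forallNP h.
suff : E p (fun=> 1) = 0 by rewrite p1 => /eqP; rewrite eqe oner_eq0.
apply: esum1 => x _; rewrite (_ : p x = 0%R) ?mul0e//.
by apply/eqP; rewrite eq_le p0 andbT leNgt; apply/negP/h.
Qed.

Lemma pmf_cste (I : choiceType) (p : I -> R) (c : \bar R) : pmf p -> 0 <= c ->
  E p (fun=> c) = c.
Proof.
move=> pp; case: c => [r r0| _|//]; first exact: pmf_cst.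
have [x px] := pmf_gt0 pp; apply/eqP; rewrite -leye_eq.
have := @E_ge1 _ p (fun=> +oo) x (pmf_ge0 pp) (fun=> leey _).
by rewrite gt0_muley// lte_fin.
Qed.

Lemma pmf_le1 (I : choiceType) (p : I -> R) x : pmf p -> (p x <= 1)%R.
Proof.
move=> [p0 p1]; have := @E_ge1 _ p (fun=> 1) x p0 (fun=> lee01).
by rewrite p1 mule1 lee_fin.
Qed.

Lemma E_le (I : choiceType) (p : I -> R) f (c : R) : pmf p -> (0 <= c)%R ->
  (forall x, (0 < p x)%R -> f x <= c%:E) -> E p f <= c%:E.
Proof.
move=> pp c0 fc; rewrite -[leRHS](pmf_cst pp c0); apply: le_E => //.
exact: pmf_ge0.
Qed.

Lemma E_pairD (I J : choiceType) (p : I -> R) (p' : J -> R) f h :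
  pmf p -> pmf p' -> (forall x, 0 <= f x) -> (forall y, 0 <= h y) ->
  E p (fun x => E p' (fun y => f x + h y)) = E p f + E p' h.
Proof.
move=> pp pp' f0 h0; have [p0 _] := pp; have [p'0 _] := pp'.
rewrite -[X in _ + X](@pmf_cste _ p)//; last exact: E_ge0.
rewrite -ED//; last by move=> _; exact: E_ge0.
by apply: eq_E => x _; rewrite ED// pmf_cste.
Qed.

Definition ind (P : Prop) : \bar R := if `[< P >] then 1 else 0.

Lemma ind_ge0 P : 0 <= ind P. Proof. by rewrite /ind; case: ifP. Qed.
Lemma ind_le1 P : ind P <= 1. Proof. by rewrite /ind; case: ifP. Qed.
Lemma ind1 (P : Prop) : P -> ind P = 1.
Proof. by move=> h; rewrite /ind ifT//; exact/asboolP. Qed.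
Lemma ind0 (P : Prop) : ~ P -> ind P = 0.
Proof. by move=> h; rewrite /ind ifF//; exact/asboolP. Qed.
Lemma le_ind (P Q : Prop) : (P -> Q) -> ind P <= ind Q.
Proof.
move=> PQ; have [p|p] := pselect P; last by rewrite ind0// ind_ge0.
by rewrite !ind1//; exact: PQ.
Qed.

(** The value [+oo] at [0] makes [nlog] antitone and turns products into sums on all of [0, 1]; as
    [0 * +oo = 0], the terms [p * nlog p] are still those of the entropy. *)
Definition nlog (x : R) : \bar R := if x == 0%R then +oo else (- ln x)%:E.

Lemma nlog_ge0 x : (x <= 1)%R -> 0 <= nlog x.
Proof.
by move=> x1; rewrite /nlog; case: ifPn => // x0; rewrite lee_fin oppr_ge0 ln_le0.
Qed.

Lemma nlogM x y : (0 <= x <= 1)%R -> (0 <= y <= 1)%R -> nlog (x * y) = nlog x + nlog y.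
Proof.
move=> /andP[x0 x1] /andP[y0 y1]; rewrite /nlog mulf_eq0.
have [xe|xn] /= := eqVneq x 0%R; first by case: ifP.
have [ye|yn] /= := eqVneq y 0%R; first by [].
by rewrite -EFinD lnM ?posrE ?lt0r ?xn ?yn// opprD.
Qed.

Lemma le_nlog x y : (0 <= x)%R -> (x <= y)%R -> nlog y <= nlog x.
Proof.
move=> x0 xy; rewrite /nlog; have [xe|xn] := eqVneq x 0%R; first by rewrite leey.
have x0' : (0 < x)%R by rewrite lt0r xn.
rewrite gt_eqF ?(lt_le_trans x0')// lee_fin lerN2 ler_ln// posrE//.
exact: lt_le_trans xy.
Qed.

(* [ln (q / p) <= q / p - 1], multiplied by [p]. *)
Lemma gibbs_pointwise (p q : R) : (0 <= p)%R -> (0 <= q)%R ->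
  p%:E * nlog p + p%:E <= p%:E * nlog q + q%:E.
Proof.
move=> p0 q0; rewrite /nlog; have [->|pn] := eqVneq p 0%R.
  by rewrite !mul0e !add0e lee_fin.
have {}p0 : (0 < p)%R by rewrite lt0r pn.
have [->|qn] := eqVneq q 0%R; first by rewrite gt0_muley// addye// leey.
have {}q0 : (0 < q)%R by rewrite lt0r qn.
rewrite -!EFinM -!EFinD lee_fin.
have : (ln (q / p) <= q / p - 1)%R.
  have := @le_ln1Dx R (q / p - 1)%R; rewrite addrCA subrr addr0; apply.
  by rewrite ltrBrDl subrr divr_gt0.
rewrite ln_div ?posrE// => h.
have : (p * (ln q - ln p) <= p * (q / p - 1))%R by rewrite ler_pM2l.
rewrite mulrBr mulrBr mulrCA divff// mulr1 => {}h.
lra.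
Qed.

(** Sum of [gibbs_pointwise] over the product of [p] and [p']. The masses, [1] and at most [1], stay
    as summands on both sides until the end, because the expectations may be infinite and cannot be
    subtracted. *)
Lemma gibbs2 (I J : choiceType) (p : I -> R) (p' : J -> R) (Q : I -> J -> R) :
  pmf p -> pmf p' -> (forall x y, 0 <= Q x y <= 1)%R ->
  \esum_(x in setT) \esum_(y in setT) (Q x y)%:E <= 1 ->
  E p (fun x => nlog (p x)) + E p' (fun y => nlog (p' y)) <=
  E p (fun x => E p' (fun y => nlog (Q x y))).
Proof.
move=> pp pp' Q01 Q1.
have [p0 p1] := pp; have [p'0 p'1] := pp'.
have n0 x : 0 <= nlog (p x) by rewrite nlog_ge0// pmf_le1.
have n'0 y : 0 <= nlog (p' y) by rewrite nlog_ge0// pmf_le1.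
have nQ0 x y : 0 <= nlog (Q x y) by rewrite nlog_ge0//; case/andP: (Q01 x y).
have Q0 x y : 0 <= (Q x y)%:E by rewrite lee_fin; case/andP: (Q01 x y).
have pq0 x y : 0 <= (p x * p' y)%:E by rewrite lee_fin mulr_ge0.
have e1 : E p (fun x => nlog (p x)) + E p' (fun y => nlog (p' y)) + 1 =
   E p (fun x => E p' (fun y => nlog (p x) + nlog (p' y) + 1)).
  rewrite -E_pairD// -[X in _ + X = _]p1 -ED//; last by move=> x; rewrite E_ge0// => y; exact: adde_ge0.
  by apply: eq_E => x _; rewrite [RHS]ED ?p'1// => y; exact: adde_ge0.
rewrite -(@leeD2rE _ 1)// e1.
apply: (@le_trans _ _ (\esum_(x in setT) \esum_(y in setT)
    ((p x * p' y)%:E * nlog (Q x y) + (Q x y)%:E))).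
  apply: le_esum => x _; rewrite -esumZl//; last first.
    by move=> y; rewrite mule_ge0 ?lee_fin// !adde_ge0.
  apply: le_esum => y _; rewrite muleA -EFinM.
  rewrite ge0_muleDr ?adde_ge0// mule1 -nlogM ?p0 ?p'0 ?pmf_le1//.
  by apply: gibbs_pointwise; [rewrite mulr_ge0|case/andP: (Q01 x y)].
rewrite (_ : \esum_(x in _) _ = E p (fun x => E p' (fun y => nlog (Q x y))) +
   \esum_(x in setT) \esum_(y in setT) (Q x y)%:E); first exact: leeD.
rewrite -esumD; last 2 first.
- by move=> x _; rewrite mule_ge0 ?lee_fin// E_ge0.
- by move=> x _; exact: esum_ge0.
apply: eq_esum => x _; rewrite esumD//; last by move=> y _; rewrite mule_ge0.
congr (_ + _); rewrite -esumZl//; last by move=> y; rewrite mule_ge0// lee_fin.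
by apply: eq_esum => y _; rewrite muleA -EFinM.
Qed.

End NonnegativeSums.

(** * Convolution powers and paths *)

Section Convolution.
Context {R : realType} {X : choiceType} {G : set (X -> X)}.
Hypothesis G1 : G id.
Hypothesis GM : forall f g, G f -> G g -> G (f \o g).
Implicit Types (p q nu : (X -> X) -> R).
Local Open Scope ereal_scope.

(** As the weight vanishes off [G], sums can run over the whole type; membership in [G] is recovered
    by [prob_supp]. *)
Lemma prob_onP p : prob_on G p <-> pmf p /\ (forall f, ~ G f -> p f = 0%R).
Proof.
have e : (forall f, ~ G f -> p f = 0%R) ->
    \esum_(f in G) (p f)%:E = E p (fun=> 1).
  move=> pG; rewrite esum_mkcond; apply: eq_esum => f _; rewrite mule1.
  by case: ifPn => //; rewrite notin_setE => /pG ->.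
split=> [[p0 [pG]]|[[p0 p1] pG]]; first by rewrite e.
by split=> //; split=> //; rewrite e.
Qed.

Lemma prob_pmf p : prob_on G p -> pmf p.
Proof. by case/prob_onP. Qed.

Lemma prob_ge0 p : prob_on G p -> forall f, (0 <= p f)%R.
Proof. by case. Qed.

Lemma prob_supp p f : prob_on G p -> p f != 0%R -> G f.
Proof. by case=> _ [pG _]; apply: contra_neqP => /pG. Qed.

Lemma massE p z : (forall f, 0 <= p f)%R -> (p z)%:E = E p (fun x => ind (x = z)).
Proof.
move=> p0; rewrite (@E_eq1 _ _ p _ z)//; first by rewrite ind1// mule1.
- exact: ind_ge0.
- by move=> x; exact: ind0.
Qed.

(** The sum is bounded by the total mass, so [fine] in [conv] discards nothing. *)
Lemma conv_mass p q z : prob_on G p -> prob_on G q ->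
  (conv G p q z)%:E = E p (fun x => E q (fun y => ind (x \o y = z))).
Proof.
move=> pp pq; have p0 := prob_ge0 pp; have q0 := prob_ge0 pq.
have h0 x y : 0 <= (p x)%:E * ((q y)%:E * @ind R (x \o y = z)).
  by rewrite !mule_ge0 ?lee_fin// ind_ge0.
have -> : E p (fun x => E q (fun y => ind (x \o y = z))) =
    \esum_(k in [set k : (X -> X) * (X -> X) | G k.1 /\ G k.2 /\ k.1 \o k.2 = z])
      (p k.1 * q k.2)%:E.
  transitivity (\esum_(x in setT) \esum_(y in setT)
      ((p x)%:E * ((q y)%:E * @ind R (x \o y = z)))).
    by apply: eq_esum => x _; rewrite esumZl// => y; rewrite mule_ge0 ?lee_fin ?ind_ge0.
  rewrite esum_esum// [RHS]esum_mkcond.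
  rewrite (_ : _ `*`` _ = setT); last by apply/seteqP; split.
  apply: eq_esum => -[x y] _ /=; case: ifPn.
    by rewrite inE/= => -[_ [_ e]]; rewrite ind1// mule1.
  rewrite notin_setE/= => h; have [Gx|/pp.2.1 ->] := pselect (G x); last by rewrite mul0e.
  have [Gy|/pq.2.1 ->] := pselect (G y); last by rewrite mul0e mule0.
  by rewrite ind0 ?mule0// => e; apply: h.
rewrite /conv fineK// ge0_fin_numE; last first.
  by apply: esum_ge0 => k _; rewrite lee_fin mulr_ge0.
apply: (@le_lt_trans _ _ (E p (fun x => E q (fun y => 1)))); last first.
  by rewrite (prob_pmf pq).2 (prob_pmf pp).2 ltry.
have -> : E p (fun=> E q (fun=> 1)) = \esum_(x in setT) \esum_(y in setT)
    ((p x)%:E * ((q y)%:E * 1)).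
  by apply: eq_esum => x _; rewrite esumZl// => y; rewrite mule_ge0 ?lee_fin.
rewrite esum_esum; last by move=> *; rewrite !mule_ge0 ?lee_fin.
rewrite (_ : _ `*`` _ = setT); last by apply/seteqP; split.
rewrite esum_mkcond; apply: le_esum => -[x y] _/=; rewrite mule1 -EFinM.
by case: ifP => // _; rewrite lee_fin mulr_ge0.
Qed.

Lemma convE p q (f : (X -> X) -> \bar R) : prob_on G p -> prob_on G q -> (forall x, 0 <= f x) ->
  E (conv G p q) f = E p (fun x => E q (fun y => f (x \o y))).
Proof.
move=> pp pq f0; have p0 := prob_ge0 pp; have q0 := prob_ge0 pq.
have i0 (z x y : X -> X) : 0 <= f z * @ind R (x \o y = z) by rewrite mule_ge0 ?ind_ge0.
transitivity (\esum_(z in setT) E p (fun x => E q (fun y => f z * ind (x \o y = z)))).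
  apply: eq_esum => z _; rewrite conv_mass//.
  rewrite muleC -EZle//; last by move=> x; apply: E_ge0 => // y; exact: ind_ge0.
  by apply: eq_E => x _; rewrite EZle// => y; exact: ind_ge0.
rewrite -E_esum//; last by move=> x z; apply: E_ge0 => // y; exact: i0.
apply: eq_E => x _; rewrite -E_esum//.
apply: eq_E => y _; rewrite (@esum_eq1 _ _ (x \o y))//.
  by rewrite ind1// mule1.
by move=> z e; rewrite ind0 ?mule0// => e'; apply: e; rewrite e'.
Qed.

Lemma conv_ge0 p q z : prob_on G p -> prob_on G q -> (0 <= conv G p q z)%R.
Proof.
move=> pp pq; rewrite -lee_fin conv_mass//.
by do 2 (apply: E_ge0 => [|?]; first exact: prob_ge0); exact: ind_ge0.
Qed.

Lemma conv_prob p q : prob_on G p -> prob_on G q -> prob_on G (conv G p q).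
Proof.
move=> pp pq; apply/prob_onP; split; first split.
- by move=> z; exact: conv_ge0.
- by rewrite convE// (prob_pmf pq).2 (prob_pmf pp).2.
- move=> z Gz; apply/eqP; rewrite -eqe conv_mass//; apply/eqP.
  rewrite (@eq_E _ _ p _ (fun=> 0)) => [|x px].
    by rewrite /E esum1// => x _; rewrite mule0.
  rewrite (@eq_E _ _ q _ (fun=> 0)) => [|y qy].
    by rewrite /E esum1// => y _; rewrite mule0.
  rewrite ind0// => e; apply: Gz; rewrite -e.
  by apply: GM; [exact: prob_supp px|exact: prob_supp qy].
Qed.

Lemma dirac_ge0 (f : X -> X) : (0 <= dirac_id R f)%R.
Proof. by rewrite /dirac_id; case: pselect. Qed.

Lemma diracE (f : (X -> X) -> \bar R) : 0 <= f id -> E (@dirac_id R X) f = f id.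
Proof.
move=> f0; rewrite /E (@esum_eq1 _ _ (id : X -> X)).
- by rewrite /dirac_id; case: pselect => [?|//]; rewrite mul1e.
- by rewrite mule_ge0// lee_fin dirac_ge0.
- by move=> x h; rewrite /dirac_id; case: pselect => [//|?]; rewrite mul0e.
Qed.

Lemma dirac_prob : prob_on G (@dirac_id R X).
Proof.
apply/prob_onP; split; first by split; [exact: dirac_ge0|rewrite diracE].
by move=> f Gf; rewrite /dirac_id; case: pselect => // e; case: Gf; rewrite e.
Qed.

Lemma conv_pow_prob p n : prob_on G p -> prob_on G (conv_pow G p n).
Proof.
by move=> pp; elim: n => [|n IH]; [exact: dirac_prob|exact: conv_prob].
Qed.

Lemma conv_powD p a b (f : (X -> X) -> \bar R) : prob_on G p ->
  (forall x, 0 <= f x) -> E (conv_pow G p (a + b)) f =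
  E (conv_pow G p a) (fun x => E (conv_pow G p b) (fun y => f (x \o y))).
Proof.
move=> pp; elim: b f => [|b IH] f f0.
  by rewrite addn0; apply: eq_E => x _; rewrite diracE.
rewrite addnS /= convE//; last exact: conv_pow_prob.
rewrite IH; last by move=> x; apply: E_ge0 => // y; exact: prob_ge0.
by apply: eq_E => x _; rewrite convE//; exact: conv_pow_prob.
Qed.

Lemma conv_pow1 p (f : (X -> X) -> \bar R) : prob_on G p ->
  (forall x, 0 <= f x) -> E (conv_pow G p 1) f = E p f.
Proof.
move=> pp f0; rewrite /= convE//; last exact: dirac_prob.
by rewrite diracE//; apply: E_ge0 => // y; exact: prob_ge0.
Qed.

Lemma conv_pow_mass p a b z : prob_on G p -> (conv_pow G p (a + b) z)%:E =
  E (conv_pow G p a) (fun x => E (conv_pow G p b) (fun y => ind (x \o y = z))).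
Proof.
move=> pp; rewrite massE; last exact/prob_ge0/conv_pow_prob.
by rewrite conv_powD// => x; exact: ind_ge0.
Qed.

Lemma conv_pow_gt0 p a b x y : prob_on G p ->
  (0 < conv_pow G p a x)%R -> (0 < conv_pow G p b y)%R ->
  (0 < conv_pow G p (a + b) (x \o y))%R.
Proof.
move=> pp pa pb; rewrite -lte_fin conv_pow_mass//.
apply: lt_le_trans (E_ge1 x _ _) => /=.
- rewrite mule_gt0 ?lte_fin//; apply: lt_le_trans (E_ge1 y _ _) => /=.
  + by rewrite ind1// mule1 lte_fin.
  + exact/prob_ge0/conv_pow_prob.
  + by move=> ?; exact: ind_ge0.
- exact/prob_ge0/conv_pow_prob.
- by move=> ?; apply: E_ge0 => [|?]; [exact/prob_ge0/conv_pow_prob|exact: ind_ge0].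
Qed.

Lemma entropyE p : prob_on G p -> entropy G p = E p (fun x => nlog (p x)).
Proof.
move=> pp; rewrite /entropy esum_mkcond; apply: eq_esum => x _.
rewrite /nlog; have [e|e] := eqVneq (p x) 0%R.
  by rewrite e mul0r oppr0 mul0e; case: ifP.
by rewrite mem_set; [rewrite -EFinM mulrN|exact: prob_supp e].
Qed.

Lemma entropy_ge0 p : prob_on G p -> 0 <= entropy G p.
Proof.
move=> pp; rewrite entropyE//; apply: E_ge0 => [|x]; first exact: prob_ge0.
by rewrite nlog_ge0// pmf_le1//; exact: prob_pmf.
Qed.

End Convolution.

Section Paths.
Context {R : realType} {I : choiceType}.
Implicit Types (p : I -> R) (f h : seq I -> \bar R).
Local Open Scope ereal_scope.

(** Integral over [k] independent steps as an iterated sum, in place of a product measure; the head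
    of the list is the earliest step. *)
Fixpoint EP p (k : nat) f : \bar R :=
  if k is k'.+1 then E p (fun x => EP p k' (fun s => f (x :: s))) else f [::].

Lemma EP_ge0 p k f : pmf p -> (forall s, 0 <= f s) -> 0 <= EP p k f.
Proof.
move=> pp; elim: k f => [|k IH] f f0 //=.
by apply: E_ge0 => [|x]; [exact: pmf_ge0|exact: IH].
Qed.

Lemma le_EP p k f h : pmf p ->
  (forall s, size s = k -> all (fun x => (0 < p x)%R) s -> f s <= h s) ->
  EP p k f <= EP p k h.
Proof.
move=> pp; elim: k f h => [|k IH] f h fh /=; first exact: fh.
apply: le_E => [|x px]; first exact: pmf_ge0.
by apply: IH => s sk ps; apply: fh => /=; rewrite ?sk ?px.
Qed.

Lemma eq_EP p k f h : (forall s, size s = k -> f s = h s) -> EP p k f = EP p k h.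
Proof.
elim: k f h => [|k IH] f h fh /=; first exact: fh.
by apply: eq_E => x px; apply: IH => s sk; rewrite fh//= sk.
Qed.

Lemma EPD p k f h : pmf p -> (forall s, 0 <= f s) -> (forall s, 0 <= h s) ->
  EP p k (fun s => f s + h s) = EP p k f + EP p k h.
Proof.
move=> pp; elim: k f h => [//|k IH] f h f0 h0 /=.
rewrite -ED; [|exact: pmf_ge0|by move=> ?; exact: EP_ge0..].
by apply: eq_E => x _; exact: IH.
Qed.

Lemma EPZl p k f (c : R) : pmf p -> (0 <= c)%R -> (forall s, 0 <= f s) ->
  EP p k (fun s => c%:E * f s) = c%:E * EP p k f.
Proof.
move=> pp c0; elim: k f => [//|k IH] f f0 /=.
rewrite -EZl//; [|exact: pmf_ge0|by move=> ?; exact: EP_ge0].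
by apply: eq_E => x _; exact: IH.
Qed.

Lemma EP_cst p k (c : \bar R) : pmf p -> 0 <= c -> EP p k (fun=> c) = c.
Proof.
move=> pp c0; elim: k => [//|k IH] /=.
by rewrite (@eq_E _ _ _ _ (fun=> c)) => [|x _]; [exact: pmf_cste|].
Qed.

Lemma EP_cat p a b f : EP p (a + b) f = EP p a (fun s => EP p b (fun s' => f (s ++ s'))).
Proof.
by elim: a f => [//|a IH] f /=; apply: eq_E => x _; exact: IH.
Qed.

Lemma EP_nth p k t x0 (f : I -> \bar R) : pmf p -> (forall x, 0 <= f x) -> (t < k)%N ->
  EP p k (fun s => f (nth x0 s t)) = E p f.
Proof.
move=> pp f0; elim: k t => [//|k IH] [|t] /= tk.
  by apply: eq_E => x _; rewrite EP_cst.
rewrite (@eq_E _ _ _ _ (fun=> E p f)) => [|x _]; last exact: IH.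
by rewrite pmf_cste//; apply: E_ge0 => //; exact: pmf_ge0.
Qed.

End Paths.

Section PathProduct.
Context {R : realType} {X : choiceType} {G : set (X -> X)}.
Hypothesis G1 : G id.
Hypothesis GM : forall f g, G f -> G g -> G (f \o g).
Local Open Scope ereal_scope.

(** Increments multiply on the right: [prodc (take t s)] is the position at time [t], and
    [prodc (drop t s)] is the path that remains. *)
Definition prodc (s : seq (X -> X)) : X -> X := foldr (fun x y => x \o y) id s.

Lemma prodc_cat s s' : prodc (s ++ s') = prodc s \o prodc s'.
Proof. by elim: s => [//|x s /= ->]. Qed.

Lemma prodc_rcons s x : prodc (rcons s x) = prodc s \o x.
Proof. by rewrite -cats1 prodc_cat. Qed.

Lemma EP_prodc (p : (X -> X) -> R) k f : prob_on G p -> (forall x, 0 <= f x) ->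
  EP p k (fun s => f (prodc s)) = E (conv_pow G p k) f.
Proof.
move=> pp; elim: k f => [|k IH] f f0 /=; first by rewrite diracE.
rewrite -[conv G _ _]/(conv_pow G p k.+1) -[in RHS](add1n k).
rewrite (conv_powD G1 GM)// (conv_pow1 G1)//; last first.
  by move=> x; apply: E_ge0 => // y; exact/prob_ge0/(conv_pow_prob G1 GM).
by apply: eq_E => x _; exact: IH.
Qed.

End PathProduct.

(** * Continuity of entropy *)

Section Fekete.
Context {R : realType}.

Lemma subadditive_mul (a : nat -> R) m q : a 0%N = 0 ->
  (forall i j, a (i + j)%N <= a i + a j) -> a (q * m)%N <= q%:R * a m.
Proof.
move=> a0 sub; elim: q => [|q IH]; first by rewrite mul0n mul0r a0.
rewrite mulSn (le_trans (sub _ _))// -natr1 mulrDl mul1r addrC.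
by rewrite lerD2r.
Qed.

Lemma fekete (a : nat -> R) : a 0%N = 0 -> (forall n, 0 <= a n) ->
  (forall i j, a (i + j)%N <= a i + a j) ->
  exists h : R, [/\ 0 <= h, forall n, (0 < n)%N -> h <= a n / n%:R &
    (fun n => a n / n%:R) @ \oo --> h].
Proof.
move=> a0 apos sub.
pose S := [set a n / n%:R | n in [set n | (0 < n)%N]].
have S0 : lbound S 0 by move=> _ [n _ <-]; rewrite divr_ge0.
have hS : has_inf S by split; [exists (a 1%N / 1%:R); exists 1%N|exists 0].
have hle n : (0 < n)%N -> inf S <= a n / n%:R.
  by move=> n0; apply: ge_inf; [exists 0|exists n].
exists (inf S); split=> //; first by apply: lb_le_inf; [exact: hS.1|].
apply/cvgrPdist_le => e e0.
have e20 : 0 < e / 2 by rewrite divr_gt0.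
have [_ [m m0 <-] hm] := inf_adherent e20 hS.
near=> n.
have n0 : (0 < n)%N by near: n; exact: nbhs_infty_gt.
have n0' : 0 < n%:R :> R by rewrite ltr0n.
have m0' : 0 < m%:R :> R by rewrite ltr0n.
rewrite distrC ger0_norm ?subr_ge0 ?hle//.
have an : a n <= n%:R / m%:R * a m + m%:R * a 1%N.
  rewrite {1}(divn_eq n m) (le_trans (sub _ _))// lerD//.
    rewrite (le_trans (subadditive_mul _ _ a0 sub))// ler_wpM2r//.
    by rewrite ler_pdivlMr// -natrM ler_nat leq_divM.
  rewrite -[X in a X]muln1 (le_trans (subadditive_mul _ _ a0 sub))//.
  by rewrite ler_wpM2r// ler_nat ltnW// ltn_mod.
have : a n / n%:R <= a m / m%:R + m%:R * a 1%N / n%:R.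
  rewrite ler_pdivrMr// mulrDl -(mulrA (m%:R * _)) mulVf ?gt_eqF// mulr1.
  by rewrite (le_trans an)// lerD2r mulrC mulrA mulrAC.
have : m%:R * a 1%N / n%:R <= e / 2.
  rewrite ler_pdivrMr// -ler_pdivrMl//; near: n; exact: nbhs_infty_ger.
lra.
Unshelve. all: by end_near. Qed.

Lemma increments_le_limit (a : nat -> R) (h c : R) k N : (0 < k)%N -> 0 <= h ->
  (forall n, 0 <= a n) -> (fun n => a n / n%:R) @ \oo --> h ->
  (forall n, (N <= n)%N -> a n + c <= a (n + k)%N) -> c / k%:R <= h.
Proof.
move=> k0 h0 apos ah step.
have k0' : 0 < k%:R :> R by rewrite ltr0n.
have iter j : j%:R * c <= a (N + j * k)%N.
  elim: j => [|j IH]; first by rewrite mul0r.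
  rewrite mulSn addnCA addnC -natr1 mulrDl mul1r (le_trans _ (step _ _))//.
    by rewrite lerD2r.
  exact: leq_addr.
rewrite leNgt; apply/negP => hc.
have [e [e0 h3]] : exists e, 0 < e /\ h + e = c / k%:R - e.
  exists ((c / k%:R - h) / 2); split; first by rewrite divr_gt0// subr_gt0.
  lra.
have c0 : 0 < c.
  by have := le_lt_trans h0 hc; rewrite pmulr_lgt0// invr_gt0.
move/cvgrPdist_lt: ah => /(_ _ e0)[M _ hM].
(* [j] lies beyond the threshold [M] of the limit and is so large that a deficit [e] per unit of
   time outweighs the late start at [N]. *)
pose j := (M + N + Num.truncn (c / k%:R * N%:R / (e * k%:R))).+1.
have hj : (c / k%:R) * N%:R < e * k%:R * j%:R.
  rewrite [X in _ < X]mulrC -ltr_pdivrMr ?mulr_gt0//.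
  apply: lt_le_trans (truncnS_gt _) _; rewrite ler_nat /j ltnS leq_addl//.
have := hM (N + j * k)%N; rewrite /= => /(_ _)/wrap[].
  by rewrite (@leq_trans j)// ?leq_addl//; [rewrite /j; lia|rewrite (@leq_trans (j * k))// ?leq_addl// leq_pmulr].
have jk0 : 0 < (N + j * k)%:R :> R by rewrite ltr0n addn_gt0 muln_gt0 k0 orbT.
rewrite ltr_distlC => /andP[_].
rewrite ltr_pdivrMr// => h1.
have h2 := le_lt_trans (iter j) h1.
move: h2; rewrite natrD natrM => h2.
rewrite h3 in h2.
have h4 : j%:R * c = c / k%:R * (j%:R * k%:R) by field; rewrite gt_eqF.
rewrite h4 in h2.
have N0 : 0 <= N%:R :> R by [].
have : 0 <= e * N%:R by rewrite mulr_ge0// ltW.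
lra.
Qed.

End Fekete.

(** * Lower semicontinuity under pointwise convergence *)

Section LowerLimits.
Context {R : realType}.
Local Open Scope ereal_scope.

(** A finite partial sum already exceeds [c], and finitely many lower bounds eventually hold
    together. Asking only for lower bounds on the terms admits densities that are discontinuous
    where the mass is [0]. *)
Lemma fatou_esum (I : choiceType) (a_ : nat -> I -> R) (a : I -> R) :
  (forall i x, 0 <= a_ i x)%R ->
  (forall x (e : R), (0 < e)%R -> \forall i \near \oo, (a x - e < a_ i x)%R) ->
  forall c : R, c%:E < \esum_(x in setT) (a x)%:E ->
  \forall i \near \oo, c%:E < \esum_(x in setT) (a_ i x)%:E.
Proof.
move=> a0 low c /ereal_sup_gt[_ [F [finF _]] <-].
rewrite fsbig_finite//= sumEFin lte_fin => cF.
set s := finmap.enum_fset (fset_set F) in cF.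
have fin (r : seq I) (e : R) : (0 < e)%R ->
    \forall i \near \oo, (\sum_(x <- r) a x - e < \sum_(x <- r) a_ i x)%R.
  elim: r e => [|x r IH] e e0.
    by near=> i; rewrite !big_nil sub0r oppr_lt0.
  have e2 : (0 < e / 2)%R by rewrite divr_gt0.
  near=> i; rewrite !big_cons.
  have : (a x - e / 2 < a_ i x)%R by near: i; exact: low.
  have : (\sum_(x <- r) a x - e / 2 < \sum_(x <- r) a_ i x)%R by near: i; exact: IH.
  lra.
have := fin s (\sum_(x <- s) a x - c)%R; rewrite subr_gt0 => /(_ cF).
apply: filterS => i; rewrite opprB addrCA subrr addr0 => ci.
rewrite (@lt_le_trans _ _ (\sum_(x <- s) a_ i x)%:E) ?lte_fin//.
apply: ereal_sup_ubound; exists F; first by split.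
by rewrite fsbig_finite//= sumEFin.
Unshelve. all: by end_near. Qed.

Lemma cvgr_low (a_ : nat -> R) (a : R) : a_ @ \oo --> a ->
  forall e : R, (0 < e)%R -> \forall i \near \oo, (a - e < a_ i)%R.
Proof.
move=> /cvgrPdist_lt ca e e0; have := ca _ e0; apply: filterS => i.
by rewrite ltr_distl => /andP[]; lra.
Qed.

(* Scheffe: no mass can be gained at a point because the total mass is fixed. *)
Lemma pmf_cvg (I : choiceType) (p_ : nat -> I -> R) (p : I -> R) :
  (forall i, pmf (p_ i)) -> pmf p ->
  (forall x (e : R), (0 < e)%R -> \forall i \near \oo, (p x - e < p_ i x)%R) ->
  forall x, (fun i => p_ i x) @ \oo --> p x.
Proof.
move=> pp_ pp low x; apply/cvgrPdist_lt => e e0.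
have split (q : I -> R) : pmf q ->
    \esum_(y in setT) (if y == x then 0%R else q y)%:E = (1 - q x)%:E.
  move=> [q0 q1]; have qx := @pmf_le1 _ _ _ x (conj q0 q1).
  have e1 : (q x)%:E + \esum_(y in setT) (if y == x then 0%R else q y)%:E = 1.
    rewrite -q1 -[X in X + _](_ : \esum_(y in setT) (if y == x then q y else 0%R)%:E = _).
      rewrite -esumD; [|by move=> y _; case: ifP; rewrite ?lee_fin..].
      by apply: eq_esum => y _; rewrite mule1; case: ifP; rewrite ?adde0 ?add0e.
    rewrite (@esum_eq1 _ _ x) ?eqxx ?lee_fin// => y /eqP/negbTE ->//.
  rewrite EFinB -e1 addeAC subee// add0e//.
have h := @fatou_esum I (fun i y => if y == x then 0%R else p_ i y)
  (fun y => if y == x then 0%R else p y).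
have /h{}h i y : (0 <= (if y == x then 0 else p_ i y))%R.
  by case: ifP => // _; exact: (pp_ i).1.
have /h{}h y (d : R) : (0 < d)%R ->
    \forall i \near \oo, ((if y == x then 0 else p y) - d < (if y == x then 0 else p_ i y))%R.
  move=> d0; case: ifP => _; last exact: low.
  by near=> i; rewrite sub0r oppr_lt0.
have := h (1 - p x - e)%R; rewrite split// lte_fin ltrBlDr ltrDl => /(_ e0) h1.
near=> i.
have h2 : (1 - p x - e)%:E < \esum_(y in setT) (if y == x then 0%R else p_ i y)%:E.
  by near: i.
have h3 : (p x - e < p_ i x)%R by near: i; exact: low.
move: h2; rewrite split// lte_fin => h2.
by rewrite ltr_distl; apply/andP; split; lra.
Unshelve. all: by end_near. Qed.

End LowerLimits.

(** * Entropy of convolutions in the limit *)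

Section EntropyLimits.
Context {R : realType} {X : choiceType} {G : set (X -> X)}.
Hypothesis G1 : G id.
Hypothesis GM : forall f g, G f -> G g -> G (f \o g).
Local Open Scope ereal_scope.

Lemma conv_ge_pair (p q : (X -> X) -> R) x y : prob_on G p -> prob_on G q ->
  (p x * q y <= conv G p q (x \o y))%R.
Proof.
move=> pp pq; rewrite -lee_fin conv_mass//.
apply: le_trans (E_ge1 x _ _) => /=.
- rewrite EFinM lee_wpmul2l ?lee_fin ?(prob_ge0 pp)//.
  apply: le_trans (E_ge1 y _ _) => /=; first by rewrite ind1// mule1.
  + exact: (prob_ge0 pq).
  + by move=> ?; exact: ind_ge0.
- exact: (prob_ge0 pp).
- by move=> ?; apply: E_ge0 => [|?]; [exact: (prob_ge0 pq)|exact: ind_ge0].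
Qed.

(* Density of H(p) + H(q) - H(p * q).  It is nonnegative, so that Fatou's lemma
   bounds the entropy of a convolution from above as well as from below. *)
Definition excess (p q : (X -> X) -> R) (k : (X -> X) * (X -> X)) : R :=
  if (p k.1 * q k.2 == 0)%R then 0%R else
  (p k.1 * q k.2 * (ln (conv G p q (k.1 \o k.2)) - ln (p k.1 * q k.2)))%R.

Lemma excess_ge0 p q k : prob_on G p -> prob_on G q -> (0 <= excess p q k)%R.
Proof.
move=> pp pq; rewrite /excess; case: ifPn => // h.
have pq0 : (0 < p k.1 * q k.2)%R.
  by rewrite lt0r h mulr_ge0 ?(prob_ge0 pp) ?(prob_ge0 pq).
have le := conv_ge_pair k.1 k.2 pp pq.
rewrite mulr_ge0 ?(ltW pq0)// subr_ge0 ler_ln ?posrE//.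
exact: lt_le_trans le.
Qed.

Lemma entropy_excess (p q : (X -> X) -> R) : prob_on G p -> prob_on G q ->
  entropy G p + entropy G q =
  entropy G (conv G p q) + \esum_(k in setT) (excess p q k)%:E.
Proof.
move=> pp pq; have p0 := prob_ge0 pp; have q0 := prob_ge0 pq.
have Mp := prob_pmf pp; have Mq := prob_pmf pq.
have pc := conv_prob GM pp pq.
have n0 (r : (X -> X) -> R) x : prob_on G r -> 0 <= nlog (r x).
  by move=> pr; rewrite nlog_ge0// pmf_le1//; exact: (prob_pmf pr).
rewrite !entropyE// -E_pairD//; [|by move=> x; exact: n0..].
rewrite convE//; last by move=> x; exact: n0.
have -> : \esum_(k in setT) (excess p q k)%:E =
    \esum_(x in setT) \esum_(y in setT) (excess p q (x, y))%:E.
  rewrite esum_esum; last by move=> x y _ _; rewrite lee_fin excess_ge0.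
  rewrite (_ : _ `*`` _ = setT); last by apply/seteqP; split.
  by apply: eq_esum => -[].
rewrite -esumD; last 2 first.
- move=> x _; rewrite mule_ge0 ?lee_fin//; apply: E_ge0 => // y; exact: n0.
- by move=> x _; apply: esum_ge0 => y _; rewrite lee_fin excess_ge0.
apply: eq_esum => x _; rewrite -esumZl//; last first.
  by move=> y; rewrite mule_ge0 ?lee_fin// adde_ge0// n0.
rewrite -esumZl//; last by move=> y; rewrite mule_ge0 ?lee_fin// n0.
rewrite -esumD; last 2 first.
- by move=> y _; rewrite !mule_ge0 ?lee_fin// n0.
- by move=> y _; rewrite lee_fin excess_ge0.
apply: eq_esum => y _; rewrite !muleA -EFinM -nlogM ?p0 ?q0 ?pmf_le1//.
rewrite /excess/=; case: ifPn => [/eqP ->|h]; first by rewrite !mul0e adde0.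
have pq0 : (0 < p x * q y)%R by rewrite lt0r h mulr_ge0.
have c0 := lt_le_trans pq0 (conv_ge_pair x y pp pq).
by rewrite /nlog (negbTE h) gt_eqF// -!EFinM -EFinD; congr EFin; lra.
Qed.

(** Convergence to a finite limit, for sequences whose first terms may be infinite. *)
Definition ereal_cvgr (u : nat -> \bar R) (h : R) := forall e : R, (0 < e)%R ->
  \forall i \near \oo, (h - e)%:E < u i < (h + e)%:E.

Lemma entropy_low (p_ : nat -> (X -> X) -> R) (p : (X -> X) -> R) :
  (forall i, prob_on G (p_ i)) -> prob_on G p ->
  (forall f, (fun i => p_ i f) @ \oo --> p f) ->
  forall c : R, c%:E < entropy G p -> \forall i \near \oo, c%:E < entropy G (p_ i).
Proof.
move=> pp_ pp cp.
have eE (q : (X -> X) -> R) : prob_on G q -> entropy G q = \esum_(x in setT) (- (q x * ln (q x)))%:E.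
  move=> pq; rewrite entropyE//; apply: eq_esum => x _; rewrite /nlog.
  by case: eqVneq => [->|_]; rewrite ?mul0e ?mul0r ?oppr0// -EFinM mulrN.
have t0 (q : (X -> X) -> R) x : prob_on G q -> (0 <= - (q x * ln (q x)))%R.
  move=> pq; rewrite -mulrN mulr_ge0 ?(prob_ge0 pq)// oppr_ge0 ln_le0//.
  exact/pmf_le1/(prob_pmf pq).
move=> c; rewrite eE// => hc.
have := @fatou_esum R _ (fun i x => - (p_ i x * ln (p_ i x)))%R
  (fun x => - (p x * ln (p x)))%R.
move=> /(_ (fun i x => t0 _ x (pp_ i))) h.
have {}h := h _ c hc.
apply: filterS (h _) => [i|x e e0]; first by rewrite eE.
(* Where [p x = 0] the logarithm is not continuous, but there the limit term is [0] and the terms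
   are nonnegative. *)
have [px|px] := eqVneq (p x) 0%R.
  near=> i; rewrite px mul0r oppr0 sub0r (@lt_le_trans _ _ 0%R) ?oppr_lt0//.
  exact: t0.
apply: cvgr_low => //; apply: cvgN; apply: cvgM => //.
apply: continuous_cvg => //; apply: continuous_ln.
by rewrite lt0r px (prob_ge0 pp).
Unshelve. all: by end_near. Qed.

(** Fatou's lemma bounds each mass from below in the limit, and [pmf_cvg] upgrades this to
    convergence. *)
Lemma conv_cvg (p_ q_ : nat -> (X -> X) -> R) (p q : (X -> X) -> R) :
  (forall i, prob_on G (p_ i)) -> (forall i, prob_on G (q_ i)) ->
  prob_on G p -> prob_on G q ->
  (forall f, (fun i => p_ i f) @ \oo --> p f) ->
  (forall f, (fun i => q_ i f) @ \oo --> q f) ->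
  forall f, (fun i => conv G (p_ i) (q_ i) f) @ \oo --> conv G p q f.
Proof.
move=> pp_ pq_ pp pq cp cq; apply: pmf_cvg.
- by move=> i; exact: (prob_pmf (conv_prob GM (pp_ i) (pq_ i))).
- exact: (prob_pmf (conv_prob GM pp pq)).
move=> z e e0.
have cE (p' q' : (X -> X) -> R) : prob_on G p' -> prob_on G q' -> (conv G p' q' z)%:E =
  \esum_(k in [set: (X -> X) * (X -> X)]) (if `[< k.1 \o k.2 = z >] then p' k.1 * q' k.2 else 0)%:E.
  move=> pp' pq'; rewrite conv_mass//.
  transitivity (\esum_(x in [set: X -> X]) \esum_(y in [set: X -> X])
     (if `[< x \o y = z >] then p' x * q' y else 0)%:E).
    apply: eq_esum => x _; rewrite -esumZl ?(prob_ge0 pp')//; last first.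
      by move=> y; rewrite mule_ge0 ?lee_fin ?(prob_ge0 pq') ?ind_ge0.
    by apply: eq_esum => y _; rewrite /ind; case: ifP; rewrite ?mule0 ?mule1.
  rewrite esum_esum; last first.
    by move=> x y _ _; case: ifP; rewrite lee_fin// mulr_ge0 ?(prob_ge0 pp') ?(prob_ge0 pq').
  rewrite (_ : _ `*`` _ = setT)//; by apply/seteqP; split.
have F0 i (k : (X -> X) * (X -> X)) :
    (0 <= if `[< k.1 \o k.2 = z >] then p_ i k.1 * q_ i k.2 else 0)%R.
  by case: ifP => // _; rewrite mulr_ge0 ?(prob_ge0 (pp_ i)) ?(prob_ge0 (pq_ i)).
have low (k : (X -> X) * (X -> X)) (d : R) : (0 < d)%R -> \forall i \near \oo,
    ((if `[< k.1 \o k.2 = z >] then p k.1 * q k.2 else 0) - d <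
     if `[< k.1 \o k.2 = z >] then p_ i k.1 * q_ i k.2 else 0)%R.
  move=> d0; case: ifP => _; last by near=> i; rewrite sub0r oppr_lt0.
  by apply: cvgr_low => //; apply: cvgM.
have := fatou_esum F0 low (c := (conv G p q z - e)%R).
rewrite -cE// lte_fin ltrBlDr ltrDl => /(_ e0); apply: filterS => i.
by rewrite -cE// lte_fin.
Unshelve. all: by end_near. Qed.

Lemma conv_entropy_cvg (p_ q_ : nat -> (X -> X) -> R) (p q : (X -> X) -> R) (a b c : R) :
  (forall i, prob_on G (p_ i)) -> (forall i, prob_on G (q_ i)) ->
  prob_on G p -> prob_on G q ->
  (forall f, (fun i => p_ i f) @ \oo --> p f) ->
  (forall f, (fun i => q_ i f) @ \oo --> q f) ->
  entropy G p = a%:E -> entropy G q = b%:E -> entropy G (conv G p q) = c%:E ->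
  ereal_cvgr (fun i => entropy G (p_ i)) a ->
  ereal_cvgr (fun i => entropy G (q_ i)) b ->
  ereal_cvgr (fun i => entropy G (conv G (p_ i) (q_ i))) c.
Proof.
move=> pp_ pq_ pp pq cp cq ea eb ec ha hb e e0.
have e4 : (0 < e / 4)%R by rewrite divr_gt0.
have cc := conv_cvg pp_ pq_ pp pq cp cq.
have ex : \esum_(k in setT) (excess p q k)%:E = (a + b - c)%:E.
  have := entropy_excess pp pq; rewrite ea eb ec -EFinD.
  have : 0 <= \esum_(k in setT) (excess p q k)%:E.
    by apply: esum_ge0 => k _; rewrite lee_fin excess_ge0.
  by case: (esum _ _) => [r| |]//= _ [->]; congr EFin; lra.
have h1 : \forall i \near \oo, (c - e)%:E < entropy G (conv G (p_ i) (q_ i)).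
  apply: (@entropy_low (fun i => conv G (p_ i) (q_ i)) (conv G p q)) => //.
  - by move=> i; exact: conv_prob.
  - exact: conv_prob.
  - by rewrite ec lte_fin ltrBlDr ltrDl.
have h2 : \forall i \near \oo, (a + b - c - e / 4)%:E <
    \esum_(k in setT) (excess (p_ i) (q_ i) k)%:E.
  apply: (@fatou_esum R _ (fun i => excess (p_ i) (q_ i)) (excess p q)).
  - by move=> i k; exact: excess_ge0.
  - move=> k d d0; have [h|h] := eqVneq (p k.1 * q k.2)%R 0%R.
      near=> i; rewrite {1}/excess h eqxx sub0r (@lt_le_trans _ _ 0%R) ?oppr_lt0//.
      exact: excess_ge0.
    have pq0 : (0 < p k.1 * q k.2)%R.
      by rewrite lt0r h mulr_ge0 ?(prob_ge0 pp) ?(prob_ge0 pq).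
    have c0 := lt_le_trans pq0 (conv_ge_pair k.1 k.2 pp pq).
    have cpq : (fun i => p_ i k.1 * q_ i k.2)%R @ \oo --> (p k.1 * q k.2)%R by exact: cvgM.
    have lim : (fun i => p_ i k.1 * q_ i k.2 * (ln (conv G (p_ i) (q_ i) (k.1 \o k.2)) - ln (p_ i k.1 * q_ i k.2)))%R
       @ \oo --> (p k.1 * q k.2 * (ln (conv G p q (k.1 \o k.2)) - ln (p k.1 * q k.2)))%R.
      apply: cvgM => //; apply: cvgB.
        by apply: continuous_cvg; [exact: continuous_ln|exact: cc].
      by apply: continuous_cvg; [exact: continuous_ln|].
    have := cvgr_low lim d0.
    have : \forall i \near \oo, (0 < p_ i k.1 * q_ i k.2)%R.
      have := cvgr_low cpq pq0; apply: filterS => i; lra.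
    by apply: filterS2 => i hi; rewrite /excess (negbTE h) gt_eqF.
  - by rewrite ex lte_fin ltrBlDr ltrDl.
near=> i.
have hai : (a - e / 4)%:E < entropy G (p_ i) < (a + e / 4)%:E by near: i; exact: ha.
have hbi : (b - e / 4)%:E < entropy G (q_ i) < (b + e / 4)%:E by near: i; exact: hb.
have h2i : (a + b - c - e / 4)%:E < \esum_(k in setT) (excess (p_ i) (q_ i) k)%:E by near: i.
apply/andP; split; first by near: i.
(* Upper bound: the two entropies exceed their limits by at most [e / 4] each, and the excess falls
   short by at most [e / 4]. *)
have := entropy_excess (pp_ i) (pq_ i).
have := entropy_ge0 (conv_prob GM (pp_ i) (pq_ i)).
move: hai hbi h2i; case: (entropy G (p_ i)) => [x| |] //=; last by rewrite andbF.
case: (entropy G (q_ i)) => [y| |] //=; last by rewrite andbF.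
case: (esum _ _) => [z| |] //=; case: (entropy G (conv _ _ _)) => [w| |] //=.
rewrite !lte_fin => /andP[? ?] /andP[? ?] ? _ [?]; lra.
Unshelve. all: by end_near. Qed.

End EntropyLimits.

(** * Asymptotic entropy as an infimum *)

Section AsymptoticEntropy.
Context {R : realType} {X : choiceType} {G : set (X -> X)}.
Hypothesis G1 : G id.
Hypothesis GM : forall f g, G f -> G g -> G (f \o g).
Implicit Types (p : (X -> X) -> R).
Local Open Scope ereal_scope.

Lemma conv_conv_pow p a b : prob_on G p ->
  conv G (conv_pow G p a) (conv_pow G p b) = conv_pow G p (a + b).
Proof.
move=> pp; apply/funext => z; apply: EFin_inj.
by rewrite (conv_pow_mass G1 GM)// conv_mass//; exact: (conv_pow_prob G1 GM).
Qed.

Lemma entropy_dirac : entropy G (@dirac_id R X) = 0.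
Proof.
rewrite /entropy esum1// => f _; rewrite /dirac_id.
by case: pselect => ?; rewrite ?ln1 ?mul0r ?mulr0 oppr0.
Qed.

Lemma entropy_conv_le (p q : (X -> X) -> R) : prob_on G p -> prob_on G q ->
  entropy G (conv G p q) <= entropy G p + entropy G q.
Proof.
move=> pp pq; rewrite (entropy_excess GM)// leeDl//.
by apply: esum_ge0 => k _; rewrite lee_fin excess_ge0.
Qed.

Definition HN p n : R := fine (entropy G (conv_pow G p n)).

Lemma HNE p n : prob_on G p -> entropy G p < +oo ->
  entropy G (conv_pow G p n) = (HN p n)%:E.
Proof.
move=> pp fp; rewrite /HN fineK// ge0_fin_numE; last first.
  by apply: entropy_ge0; exact: (conv_pow_prob G1 GM).
elim: n => [|n IH]; first by rewrite entropy_dirac ltry.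
apply: le_lt_trans (entropy_conv_le _ _) _ => //.
  exact: (conv_pow_prob G1 GM).
exact: lte_add_pinfty.
Qed.

Lemma HN_ge0 p n : prob_on G p -> (0 <= HN p n)%R.
Proof.
by move=> pp; apply/fine_ge0/entropy_ge0; exact: (conv_pow_prob G1 GM).
Qed.

Lemma HN0 p : HN p 0 = 0%R.
Proof. by rewrite /HN /= entropy_dirac. Qed.

Lemma HND p a b : prob_on G p -> entropy G p < +oo ->
  (HN p (a + b) <= HN p a + HN p b)%R.
Proof.
move=> pp fp; rewrite -lee_fin EFinD -!HNE// -conv_conv_pow//.
by apply: entropy_conv_le; exact: (conv_pow_prob G1 GM).
Qed.

Lemma asymp_entropyP p : prob_on G p -> entropy G p < +oo ->
  exists h : R, [/\ asymp_entropy G p = h%:E, (0 <= h)%R,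
    forall n, (0 < n)%N -> (h <= HN p n / n%:R)%R &
    (fun n => HN p n / n%:R)%R @ \oo --> h].
Proof.
move=> pp fp; have [h [h0 hle hcvg]] := @fekete R (HN p) (HN0 p)
  (fun n => HN_ge0 n pp) (fun a b => HND a b pp fp).
exists h; split=> //; rewrite /asymp_entropy; apply: cvg_lim => //.
apply/fine_cvgP; split.
  by near=> n; rewrite HNE// -EFinM.
by apply: cvg_trans hcvg; apply: near_eq_cvg; near=> n; rewrite /= HNE.
Unshelve. all: by end_near. Qed.

Lemma conv_pow_cvg (p_ : nat -> (X -> X) -> R) p n :
  (forall i, prob_on G (p_ i)) -> prob_on G p ->
  (forall f, (fun i => p_ i f) @ \oo --> p f) ->
  forall f, (fun i => conv_pow G (p_ i) n f) @ \oo --> conv_pow G p n f.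
Proof.
move=> pp_ pp cp; elim: n => [|n IH] f /=; first exact: cvg_cst.
by apply: (conv_cvg GM) => //;
  [move=> i|]; exact: (conv_pow_prob G1 GM).
Qed.

Lemma HN_cvg (p_ : nat -> (X -> X) -> R) p n :
  (forall i, prob_on G (p_ i)) -> prob_on G p ->
  (forall f, (fun i => p_ i f) @ \oo --> p f) -> entropy G p < +oo ->
  (fun i => entropy G (p_ i)) @ \oo --> entropy G p ->
  (\forall i \near \oo, entropy G (p_ i) < +oo) /\
  ereal_cvgr (fun i => entropy G (conv_pow G (p_ i) n)) (HN p n).
Proof.
move=> pp_ pp cp fp; have ep : entropy G p = (fine (entropy G p))%:E.
  by rewrite fineK// ge0_fin_numE// entropy_ge0.
rewrite {1}ep => /fine_cvgP[fin ch].
have e1 : ereal_cvgr (fun i => entropy G (p_ i)) (fine (entropy G p)).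
  move=> e e0; move/cvgrPdist_lt : ch => /(_ _ e0).
  apply: filterS2 fin => i fi; rewrite /= ltr_distl => /andP[h1 h2].
  by rewrite -(fineK fi) !lte_fin; apply/andP; split; lra.
split; first by apply: filterS fin => i; rewrite ge0_fin_numE// entropy_ge0.
elim: n => [|n IH].
  by move=> e e0; near=> i; rewrite /= entropy_dirac HN0 !lte_fin; apply/andP; split; lra.
apply: (@conv_entropy_cvg _ _ _ GM (fun i => conv_pow G (p_ i) n) p_
   (conv_pow G p n) p (HN p n) (fine (entropy G p))) => //.
- by move=> i; exact: (conv_pow_prob G1 GM).
- exact: (conv_pow_prob G1 GM).
- exact: conv_pow_cvg.
- exact: HNE.
- by rewrite -HNE.
Unshelve. all: by end_near. Qed.

Lemma asymp_entropy_cvg (p_ : nat -> (X -> X) -> R) p :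
  (forall i, prob_on G (p_ i)) -> prob_on G p ->
  (forall f, (fun i => p_ i f) @ \oo --> p f) -> entropy G p < +oo ->
  (fun i => entropy G (p_ i)) @ \oo --> entropy G p ->
  (asymp_entropy G p = 0 \/
   forall e : R, (0 < e)%R -> exists k, [/\ (0 < k)%N &
     \forall i \near \oo, exists N, forall n, (N <= n)%N ->
       (HN (p_ i) n + HN (p_ i) k <= HN (p_ i) (n + k) + e * k%:R)%R]) ->
  (fun i => asymp_entropy G (p_ i)) @ \oo --> asymp_entropy G p.
Proof.
move=> pp_ pp cp fp ce alt.
have HNc n := HN_cvg n pp_ pp cp fp ce.
have fin := (HNc 0%N).1.
have [h [-> h0 hle hcvg]] := asymp_entropyP pp fp.
have fin' : \forall i \near \oo, asymp_entropy G (p_ i) \is a fin_num.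
  by apply: filterS fin => i fi; have [h' [-> _ _ _]] := asymp_entropyP (pp_ i) fi.
apply/fine_cvgP; split=> //; apply/cvgrPdist_le => e e0.
have e2 : (0 < e / 2)%R by rewrite divr_gt0.
have up : \forall i \near \oo, (fine (asymp_entropy G (p_ i)) <= h + e)%R.
  move/cvgrPdist_le : (hcvg) => /(_ _ e2)[m _ hm].
  have := hm m.+1 => /=; rewrite leqnSn => /(_ isT).
  rewrite ler_distlC => /andP[_ {}hm].
  have [_ cm] := HNc m.+1.
  have m0 : (0 < m.+1%:R :> R)%R by rewrite ltr0n.
  have e2m : (0 < e / 2 * m.+1%:R)%R by rewrite mulr_gt0.
  have := cm _ e2m; apply: filterS2 fin => i fi.
  rewrite HNE// !lte_fin => /andP[_ hi].
  have [h' [-> _ h'le _]] := asymp_entropyP (pp_ i) fi => /=.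
  apply: le_trans (h'le m.+1 isT) _; rewrite ler_pdivrMr//.
  move: hm; rewrite ler_pdivrMr// => hm; lra.
have low : \forall i \near \oo, (h - e <= fine (asymp_entropy G (p_ i)))%R.
  (* If the limit is [0], nonnegativity is already the lower bound. *)
  case: alt => [h00|alt].
    have {}h00 : h = 0%R.
      by have [h' [+ _ _ c']] := asymp_entropyP pp fp; rewrite h00 => -[h'0];
        rewrite h'0; apply: cvg_unique hcvg c'.
    apply: filterS fin => i fi.
    have [h' [-> h'0 _ _]] := asymp_entropyP (pp_ i) fi => /=; lra.
  have [k [k0 step]] := alt _ e2.
  have [_ ck] := HNc k.
  have k0' : (0 < k%:R :> R)%R by rewrite ltr0n.
  have e2k : (0 < e / 2 * k%:R)%R by rewrite mulr_gt0.
  have := ck _ e2k; apply: filterS3 fin step => i fi [N step].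
  rewrite HNE// !lte_fin => /andP[hi _].
  have [h' [-> h'0 _ c']] := asymp_entropyP (pp_ i) fi => /=.
  (* This gives h(mu_i) >= H_k(mu_i) / k - e / 2; moreover H_k(mu_i) is close to H_k(mu), and
     H_k(mu) / k is at least h(mu). *)
  have := @increments_le_limit R (HN (p_ i)) h' (HN (p_ i) k - e / 2 * k%:R)%R k N k0 h'0
    (fun n => HN_ge0 n (pp_ i)) c'.
  move=> /(_ _)/wrap[]; first by move=> n /step; lra.
  rewrite ler_pdivrMr// => h1.
  have := hle k k0; rewrite ler_pdivlMr// => h2.
  by rewrite -(ler_pM2r k0'); lra.
apply: filterS2 up low => i u l /=.
by rewrite ler_distl; apply/andP; split; lra.
Qed.

End AsymptoticEntropy.

(** * Geometry of a contracting WPD axis *)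

Section Few.
Context {T : eqType}.

(** A bound on the length of an enumeration, not a cardinality: one [Q] can serve a whole family of
    sets, and its logarithm becomes part of the code length. *)
Definition few (Q : nat) (A : T -> Prop) :=
  exists s : seq T, (size s <= Q)%N /\ forall z, A z -> z \in s.

Lemma few_sub Q A B : (forall z, A z -> B z) -> few Q B -> few Q A.
Proof. by move=> AB [s [sQ sB]]; exists s; split=> // z /AB /sB. Qed.

Lemma few_le Q Q' A : (Q <= Q')%N -> few Q A -> few Q' A.
Proof. by move=> QQ' [s [sQ sA]]; exists s; split=> //; exact: leq_trans QQ'. Qed.

Lemma few_or Q Q' A B : few Q A -> few Q' B -> few (Q + Q') (fun z => A z \/ B z).
Proof.
move=> [s [sQ sA]] [s' [sQ' sB]]; exists (s ++ s'); split.
  by rewrite size_cat leq_add.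
by move=> z [/sA|/sB] h; rewrite mem_cat h ?orbT.
Qed.

Lemma few_bigor (I : eqType) (r : seq I) Q (A : I -> T -> Prop) :
  (forall i, i \in r -> few Q (A i)) ->
  few (size r * Q) (fun z => exists2 i, i \in r & A i z).
Proof.
elim: r => [|i r IH] h; first by exists [::]; split=> // z [].
have := few_or (h i (mem_head _ _)) (IH (fun j jr => h j (mem_behead (s := i :: r) jr))).
rewrite -mulSn; apply: few_sub => z [j]; rewrite inE => /predU1P[->|jr] Aj.
  by left.
by right; exists j.
Qed.

Lemma few_pigeonhole Q A (f : nat -> T) : few Q A ->
  (forall n, (n <= Q)%N -> A (f n)) ->
  exists n1 n2, [/\ (n1 < n2)%N, (n2 <= Q)%N & f n1 = f n2].
Proof.
move=> [s [sQ sA]] h; apply: contrapT => H.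
have u : uniq [seq f n | n <- iota 0 Q.+1].
  rewrite map_inj_in_uniq ?iota_uniq// => x y; rewrite !mem_iota !add0n !ltnS /= => hx hy e.
  by case: (ltngtP x y) => // xy; exfalso; apply: H; [exists x, y|exists y, x].
have := uniq_leq_size u (s2 := s); rewrite size_map size_iota => /(_ _)/wrap[].
  by move=> _ /mapP[n + ->]; rewrite mem_iota add0n ltnS /= => /h/sA.
by rewrite leqNgt ltnS sQ.
Qed.

End Few.

Lemma few_image (T T' : eqType) Q (A : T -> Prop) (B : T' -> Prop) (F : T' -> T) :
  few Q B -> (forall z, A z -> exists2 y, B y & z = F y) -> few Q A.
Proof.
move=> [s [sQ sB]] h; exists (map F s); split; first by rewrite size_map.
by move=> z /h[y /sB ys ->]; exact: map_f.
Qed.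

Lemma unit_cell {R : realType} (a s : R) (n : nat) : a <= s <= a + n%:R ->
  exists2 k, k \in iota 0 n.+1 & a + k%:R <= s <= a + k%:R + 1.
Proof.
move=> hs; have h0 : 0 <= s - a by lra.
have := truncn_itv h0; rewrite -natr1 => ht.
exists (Num.truncn (s - a)); last by lra.
by rewrite mem_iota add0n ltnS /= -(ler_nat R); lra.
Qed.

Definition sgi (i : int) : int := if 0 <= i then 1 else -1.

Lemma sgiP i : sgi i = 1 \/ sgi i = -1.
Proof. by rewrite /sgi; case: ifP; [left|right]. Qed.

Lemma sgi_abs i : sgi i * `|i|%N%:Z = i.
Proof. by rewrite /sgi; case: ifP; lia. Qed.

Lemma norm_sgiM i (n : nat) : `|sgi i * n%:Z| = n%:Z.
Proof. by rewrite /sgi; case: ifP; lia. Qed.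

Lemma sgi_between (i : int) (m : nat) : (m <= `|i|%N)%N ->
  (i <= sgi i * m%:Z <= 0) || (0 <= sgi i * m%:Z <= i).
Proof. by rewrite /sgi; case: ifP; lia. Qed.

Lemma sgi_between_far (i0 i : int) (n M c : nat) : (n <= M)%N ->
  (`|i0|%N + M < c)%N -> c%:Z < `|i| ->
  (i0 <= sgi i * (`|i0|%N + n)%N%:Z <= i) || (i <= sgi i * (`|i0|%N + n)%N%:Z <= i0).
Proof. by rewrite /sgi; case: ifP; lia. Qed.

(** Carries a periodic property from one window to the whole axis in [along_of_not_disperses]. *)
Lemma int_decomp (e i : int) (b D : nat) : e = 1 \/ e = -1 -> (0 < D)%N ->
  exists (r : nat) (k : int), (r < D)%N /\ i = e * (b + r)%N%:Z + k * (e * D%:Z).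
Proof.
move=> he D0; pose j := e * i - b%:Z.
have h0 : 0 <= (j %% D)%Z by apply: modz_ge0; lia.
have h1 : (j %% D)%Z < D%:Z by apply: ltz_pmod; lia.
exists `|(j %% D)%Z|%N, (j %/ D)%Z; split; first by lia.
have h2 := divz_eq j D; rewrite PoszD gez0_abs// mulrDr.
have e2 : e * e = 1 by case: he => ->.
have -> : i = e * (e * i) by rewrite mulrA e2 mul1r.
have -> : e * i = j + b%:Z by rewrite /j subrK.
by rewrite {1}h2; ring.
Qed.

(** * Projection to a contracting axis *)

Section ContractingAxis.
Context {R : realType} {X : choiceType}.
Variables (d : X -> X -> R) (o : X) (G : set (X -> X)) (g gi : X -> X) (K : R).
Hypothesis geoX : geodesic_space d.
Hypothesis Giso : forall f, G f -> Defs.isometry d f.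
Hypothesis G1 : G id.
Hypothesis GM : forall f h, G f -> G h -> G (f \o h).
Hypothesis GV : forall f, G f -> exists f', G f' /\ f' \o f = id /\ f \o f' = id.
Hypothesis Gg : G g.
Hypothesis Ggi : G gi.
Hypothesis gK : gi \o g = id.
Hypothesis gK' : g \o gi = id.
Hypothesis axis : contracting_axis d K (fun i => zpow g gi i o).
Hypothesis wpd : forall K : R, 0 <= K -> exists N : nat, (0 < N)%N /\
    finite_set [set h | G h /\ d o (h o) <= K /\
                        d (iter N g o) (h (iter N g o)) <= K].

Let metric : is_metric d := geoX.1.

Lemma dist_ge0 x y : 0 <= d x y. Proof. by case: metric. Qed.
Lemma dist_xx x : d x x = 0. Proof. by case: metric => _ [h _]; exact/h. Qed.
Lemma dist_sym x y : d x y = d y x. Proof. by case: metric => _ [_ [h _]]. Qed.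
Lemma dist_tri y x z : d x z <= d x y + d y z.
Proof. by case: metric => _ [_ [_ h]]. Qed.

Lemma iso_g x y : d (g x) (g y) = d x y.
Proof. by case: (Giso Gg). Qed.

Lemma zpowS i : zpow g gi (1 + i) = g \o zpow g gi i.
Proof.
case: i => [k|[|k]] //=.
rewrite subn1; apply/funext => x /=.
by have /= -> := congr1 (fun f => f (gi (iter k gi x))) gK'.
Qed.

Lemma zpowP i : zpow g gi (i - 1) = gi \o zpow g gi i.
Proof.
have e : i = 1 + (i - 1) by lia.
rewrite [in RHS]e zpowS.
by apply/funext => x /=; have := congr1 (fun f => f (zpow g gi (i - 1) x)) gK.
Qed.

Lemma zpowD i j : zpow g gi (i + j) = zpow g gi i \o zpow g gi j.
Proof.
elim/int_ind: i => [|n IH|n IH]; first by rewrite add0r.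
- by rewrite -addn1 PoszD (addrC n%:Z 1) -addrA !zpowS IH.
- rewrite -addn1 PoszD opprD addrAC zpowP IH.
  by rewrite [in RHS]zpowP.
Qed.

Lemma zpow_iso i x y : d (zpow g gi i x) (zpow g gi i y) = d x y.
Proof.
elim/int_ind: i => [//|n IH|n IH].
- by rewrite -addn1 PoszD (addrC n%:Z 1) zpowS /= iso_g.
- rewrite -addn1 PoszD opprD zpowP /= -IH -[RHS]iso_g.
  have e z : g (gi z) = z by exact: (congr1 (fun f => f z) gK').
  by rewrite -iso_g !e iso_g.
Qed.

Definition gam i := zpow g gi i o.

Lemma zpow_gam i j : zpow g gi i (gam j) = gam (i + j).
Proof. by rewrite /gam zpowD. Qed.

Lemma K_gt0 : 0 < K. Proof. by case: axis => -[]. Qed.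

Lemma gam_ge i j : `|i - j|%:~R <= K * (d (gam i) (gam j) + K).
Proof.
have [[K0 /(_ i j)[h _]] _] := axis.
by move: h; rewrite lerBlDr ler_pdivrMr// mulrC.
Qed.

Lemma gam_le i j : d (gam i) (gam j) <= K * `|i - j|%:~R + K.
Proof. by have [[K0 /(_ i j)[_ h]] _] := axis. Qed.

(** Closest-point projection as a relation between points and indices, because it is not unique; the
    estimates hold for every choice. *)
Definition near x i := forall j, d x (gam i) <= d x (gam j).

Lemma near_ex x : exists i, near x i.
Proof.
have K0 := K_gt0.
have fin n : exists i : int, (forall j : int, `|j| <= n%:Z -> d x (gam i) <= d x (gam j)).
  elim: n => [|n [i IH]].
    by exists 0 => j; rewrite normr_le0 => /eqP ->.
  have step (i' k : int) : exists i'', d x (gam i'') <= d x (gam i') /\ d x (gam i'') <= d x (gam k).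
    by have [h|/ltW h] := leP (d x (gam i')) (d x (gam k)); [exists i'|exists k].
  have [i1 [h1 h2]] := step i n.+1%:Z.
  have [i2 [h3 h4]] := step i1 (- n.+1%:Z).
  exists i2 => j jn; have [e|e] := leP `|j| n%:Z.
    by have := IH j e; lra.
  have [->|->] : j = n.+1%:Z \/ j = - n.+1%:Z by lia.
    lra.
  lra.
(* Beyond index [B] an orbit point is more than [2 * d x o] away from [o = gam 0], hence farther
   from [x] than [o] is. *)
pose B := K * (2 * d x o + K).
have [i hi] := fin (Num.truncn B).+1.
exists i => j; have [/hi//|jB] := leP `|j| (Num.truncn B).+1%:Z.
have h0 := hi 0; rewrite normr0 in h0; have {}h0 := h0 isT.
have h1 := gam_ge j 0; rewrite subr0 in h1.
have h2 : B < `|j|%:~R.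
  apply: lt_trans (truncnS_gt _) _.
  by rewrite -[X in X < _]/((Num.truncn B).+1%:Z%:~R) ltr_int.
have h3 : gam 0 = o by [].
rewrite h3 in h0 h1.
have h4 : 2 * d x o < d (gam j) o.
  have := lt_le_trans h2 h1; rewrite /B ltr_pM2l//; lra.
have := dist_tri x (gam j) o; rewrite (dist_sym (gam j) x); lra.
Qed.

Lemma near_gam i : near (gam i) i.
Proof. by move=> j; rewrite dist_xx dist_ge0. Qed.

Lemma near_shift k x i : near x i -> near (zpow g gi k x) (k + i).
Proof.
move=> h j; rewrite -zpow_gam zpow_iso -[j](addrNK k) (addrC _ k) -zpow_gam zpow_iso.
exact: h.
Qed.

Definition geo_on a b (c : R -> X) :=
  forall s t, a <= s <= b -> a <= t <= b -> d (c s) (c t) = `|s - t|.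

Lemma near_proj x i : near x i -> Defs.proj d (range gam) x (gam i).
Proof.
move=> h; split; first by exists i.
apply/eqP; rewrite eq_le; apply/andP; split.
  by apply: le_ereal_inf_tmp => _ [_ [j _ <-] <-]; rewrite lee_fin.
by apply: ereal_inf_lbound; exists (gam i) => //; exists i.
Qed.

Lemma avoid a b c s t i j : a <= b -> geo_on a b c ->
  (forall t k, a <= t <= b -> K <= d (c t) (gam k)) ->
  a <= s <= b -> a <= t <= b -> near (c s) i -> near (c t) j ->
  d (gam i) (gam j) < K.
Proof.
move=> ab cg far sab tab ni nj.
have [_ /(_ (b - a) (fun u => c (a + u)))] := axis.
move=> /(_ _)/wrap[].
  split; first by rewrite subr_ge0.
  move=> u v hu hv; rewrite cg; [|lra..].
  by congr (`| _ |); lra.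
move=> /(_ _)/wrap[].
  move=> u hu; apply: le_ereal_inf_tmp => _ [_ [k _ <-] <-]; rewrite lee_fin.
  by apply: far; lra.
move=> h; rewrite -lte_fin; apply: le_lt_trans h.
apply: ereal_sup_ubound; exists (gam i, gam j) => //; split => /=.
- exists (s - a); first by rewrite /=; lra.
  by rewrite addrC subrK; exact: near_proj.
- exists (t - a); first by rewrite /=; lra.
  by rewrite addrC subrK; exact: near_proj.
Qed.

(** A geodesic from [x] to [y] either stays at distance [K] from the axis, and contraction applies,
    or comes close to some [gam k], and then [gam k] competes with both nearest points. *)
Lemma near_lipschitz x y i j : near x i -> near y j ->
  d (gam i) (gam j) <= 2 * K + 3 * d x y.
Proof.
move=> ni nj; have K0 := K_gt0; have D0 := dist_ge0 x y.
have [c [[_ cg] [c0 cL]]] := geoX.2 x y.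
have [[t [k [tL tk]]]|far] := pselect (exists t k, 0 <= t <= d x y /\ d (c t) (gam k) < K).
  have h1 : d x (c t) = t by rewrite -c0 cg ?lexx//; rewrite ?sub0r ?normrN ?ger0_norm//; case/andP: tL.
  have h2 : d (c t) y = d x y - t.
    by rewrite -{1}cL cg ?lexx ?D0// distrC ger0_norm// subr_ge0; case/andP: tL.
  have := ni k; have := nj k.
  have := dist_tri (c t) x (gam k); have := dist_tri (c t) y (gam k).
  have := dist_tri x (gam i) (gam j); have := dist_tri y x (gam j).
  rewrite (dist_sym (gam i) x) (dist_sym y (c t)) => *; lra.
suff : d (gam i) (gam j) < K by lra.
apply: (@avoid 0 (d x y) c 0 (d x y)); rewrite ?lexx ?D0 ?c0 ?cL//.
by move=> t k tL; rewrite leNgt; apply/negP => h; apply: far; exists t, k.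
Qed.

(** The geodesic must enter the [K]-neighbourhood of the axis, and before the first entry its
    projection moves by less than [K]. The entry time is an infimum, so the point chosen lies one
    unit before it, within two units of a time inside the neighbourhood. *)
Lemma reach_l a b c i j : a <= b -> geo_on a b c -> near (c a) i -> near (c b) j ->
  K <= d (gam i) (gam j) -> exists t, a <= t <= b /\ d (c t) (gam i) <= 2 * K + 2.
Proof.
move=> ab cg ni nj Kij; have K0 := K_gt0.
pose S := [set t | a <= t <= b /\ exists k, d (c t) (gam k) < K].
have Sn0 : S !=set0.
  apply: contrapT => /nonemptyPn S0.
  have : d (gam i) (gam j) < K.
    apply: (@avoid a b c a b) => //; rewrite ?lexx ?ab// => t k tab.
    rewrite leNgt; apply/negP => h.
    have St : S t by split=> //; exists k.
    by rewrite S0 in St.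
  lra.
have hS : has_inf S by split=> //; exists a => t [] /andP[].
have [t [tab [k tk]]] := inf_adherent ltr01 hS => tS.
have sa : a <= inf S by apply: lb_le_inf => // u [] /andP[].
have [s1|s1] := leP (inf S) (a + 1).
  exists a; rewrite lexx ab; split=> //.
  have := ni k; have := dist_tri (c t) (c a) (gam k).
  rewrite cg ?lexx// ler0_norm; lra.
have tS' : inf S <= t by apply: ge_inf; [exists a => t' [] /andP[]|split=> //; exists k].
have sab : a <= inf S - 1 <= b by lra.
exists (inf S - 1); split=> //.
have [m nm] := near_ex (c (inf S - 1)).
have h1 : d (gam i) (gam m) < K.
  apply: (@avoid a (inf S - 1) c a (inf S - 1)) => //; try lra.
    by move=> u v hu hv; apply: cg; lra.
  move=> u l hu; rewrite leNgt; apply/negP => h.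
  have : inf S <= u by apply: ge_inf; [exists a => t' [] /andP[]|split; [lra|exists l]].
  lra.
have := nm k; have := dist_tri (c t) (c (inf S - 1)) (gam k).
rewrite cg// ler0_norm; last by lra.
have := dist_tri (gam m) (c (inf S - 1)) (gam i); rewrite (dist_sym (gam m) (gam i)).
lra.
Qed.

Lemma geo_rev a b c : geo_on a b c -> geo_on a b (fun t => c (a + b - t)).
Proof.
move=> cg s t hs ht; rewrite cg; [|lra..].
by rewrite -normrN; congr (`| _ |); lra.
Qed.

Lemma reach_r a b c i j : a <= b -> geo_on a b c -> near (c a) i -> near (c b) j ->
  K <= d (gam i) (gam j) -> exists t, a <= t <= b /\ d (c t) (gam j) <= 2 * K + 2.
Proof.
move=> ab cg ni nj Kij.
have [] := @reach_l a b (fun t => c (a + b - t)) j i ab (geo_rev cg).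
- by rewrite addrAC subrr add0r.
- by rewrite addrK.
- by rewrite dist_sym.
by move=> t [tab h]; exists (a + b - t); split=> //; lra.
Qed.

(* Along a geodesic the projection to the axis advances by jumps of at most
   [K * (3 * K + 3)] indices per unit of time; hence this constant. *)
Definition C0 := 3 * K + 2 + K * (K * (3 * K + 3)).

(** The projections at integer times go from [i] to [j] by bounded jumps, so one of them is close to
    [l]. As [gam i] and [gam j] are [2 * K] apart, this projection is [K] away from one of them, and
    that part of the geodesic reaches it. *)
Lemma pass_le L c i j l : 0 <= L -> geo_on 0 L c -> near (c 0) i -> near (c L) j ->
  (i <= l)%R -> (l <= j)%R -> 2 * K <= d (gam i) (gam j) ->
  exists t, 0 <= t <= L /\ d (c t) (gam l) <= C0.
Proof.
move=> L0 cg ni nj il lj Kij; have K0 := K_gt0.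
pose N := (Num.truncn L).+1.
have NL : L < N%:R by exact: truncnS_gt.
pose t (n : nat) : R := Num.min n%:R L.
have t0 : t 0%N = 0 by rewrite /t; apply/min_idPl.
have tN : t N = L by rewrite /t; apply/min_idPr/ltW.
have tL n : 0 <= t n <= L by rewrite /t le_min ler0n L0 ge_min lexx orbT.
have [f hf] := choice (fun n => near_ex (c (t n))).
(* At the two ends the projection must be the given [i] and [j], not the chosen ones. *)
pose io n := if n == 0%N then i else if n == N then j else f n.
have nio n : near (c (t n)) (io n).
  rewrite /io; have [->|n0] := eqVneq n 0%N; first by rewrite t0.
  by have [->|_] := eqVneq n N; [rewrite tN|].
have io0 : io 0%N = i by [].
have ioN : io N = j by rewrite /io eqxx.
have jump n : `|io n.+1 - io n|%:~R <= K * (3 * K + 3).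
  apply: le_trans (gam_ge _ _) _; rewrite ler_pM2l//.
  have := near_lipschitz (nio n.+1) (nio n).
  have : d (c (t n.+1)) (c (t n)) <= 1.
    rewrite cg// /t -natr1; move: (n%:R : R) => x.
    by case: (leP (x + 1) L); case: (leP x L) => h1 h2; rewrite ler_norml; lra.
  lra.
have [n [nN hn]] : exists n, (n <= N)%N /\ `|io n - l|%:~R <= K * (3 * K + 3).
  have ex : exists n, l <= io n by exists N; rewrite ioN.
  case: (ex_minnP ex) => -[|n] hn min.
    exists 0%N; split=> //; rewrite io0 in hn *.
    have -> : i = l by lia.
    by rewrite subrr normr0 !mulr_ge0//; lra.
  exists n.+1; split; first by apply: min; rewrite ioN.
  apply: le_trans (jump n); rewrite ler_int.
  have : ~~ (l <= io n) by apply/negP => /min; rewrite ltnn.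
  lia.
have gl : d (gam (io n)) (gam l) <= K * (K * (3 * K + 3)) + K.
  by apply: le_trans (gam_le _ _) _; rewrite lerD2r ler_pM2l.
have [u [uL hu]] : exists u, 0 <= u <= L /\ d (c u) (gam (io n)) <= 2 * K + 2.
  have [h|h] := leP K (d (gam i) (gam (io n))).
    have /andP[h1 h2] := tL n.
    have [] := @reach_r 0 (t n) c i (io n) h1 _ ni (nio n) h.
      by move=> s s' hs hs'; apply: cg; lra.
    by move=> u [hu hu']; exists u; split=> //; lra.
  have /andP[h1 h2] := tL n.
  have [] := @reach_l (t n) L c (io n) j h2 _ (nio n) nj.
  - by move=> s s' hs hs'; apply: cg; lra.
  - have := dist_tri (gam (io n)) (gam i) (gam j); lra.
  by move=> u [hu hu']; exists u; split=> //; lra.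
exists u; split=> //; have := dist_tri (gam (io n)) (c u) (gam l); rewrite /C0; lra.
Qed.

(** Geodesics are not unique; quantifying over all of them makes the property invariant under
    isometries and usable for a geodesic fixed in advance. *)
Definition passes x y z := forall L c, geodesic_seg d L c -> c 0 = x -> c L = y ->
  exists t, 0 <= t <= L /\ d (c t) z <= C0.

Lemma passes_gam x y i j l : near x i -> near y j ->
  (i <= l <= j) || (j <= l <= i) -> 2 * K <= d (gam i) (gam j) -> passes x y (gam l).
Proof.
move=> ni nj /orP[/andP[h1 h2]|/andP[h1 h2]] Kij L c [L0 cg] c0 cL.
  by apply: (@pass_le L c i j) => //; rewrite ?c0 ?cL.
have [] := @pass_le L (fun t => c (0 + L - t)) j i l L0 (geo_rev cg) _ _ h1 h2.
- by rewrite subr0 add0r cL.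
- by rewrite add0r subrr c0.
- by rewrite dist_sym.
by move=> t [tL h]; exists (0 + L - t); split=> //; lra.
Qed.

Lemma C0_gt0 : 0 < C0.
Proof.
have K0 := K_gt0; rewrite /C0.
have : 0 < K * (K * (3 * K + 3)) by rewrite !mulr_gt0//; lra.
lra.
Qed.

Lemma G_iso f x y : G f -> d (f x) (f y) = d x y.
Proof. by move=> /Giso[]. Qed.

Lemma G_zp i : G (zpow g gi i).
Proof.
by case: i => k; rewrite /=; [elim: k|elim: k.+1] => //= n IH; [exact: (GM Gg IH)|exact: (GM Ggi IH)].
Qed.

Lemma G_inj f : G f -> injective f.
Proof. by move=> /Giso[/bij_inj]. Qed.

Lemma G_surj f y : G f -> exists x, f x = y.
Proof. by move=> /GV[f' [_ [_ e]]]; exists (f' y); exact: (congr1 (fun h => h y) e). Qed.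

Lemma passes_iso f x y p : G f -> passes x y p -> passes (f x) (f y) (f p).
Proof.
move=> Gf; have [f' [Gf' [e1 e2]]] := GV Gf.
have f'K z : f' (f z) = z by exact: (congr1 (fun h => h z) e1).
have fK z : f (f' z) = z by exact: (congr1 (fun h => h z) e2).
move=> h L c [L0 cg] c0 cL.
have [] := h L (f' \o c).
- by split=> // s t hs ht; rewrite /= G_iso// cg.
- by rewrite /= c0 f'K.
- by rewrite /= cL f'K.
by move=> t [tL ht]; exists t; split=> //; rewrite -(G_iso _ _ Gf') f'K.
Qed.

(** Composing with the inverse of one element of [S] puts the others into the finite set of WPD. The
    bound depends neither on [S] nor on where it sends the two markers. *)
Lemma clique_few (K' : R) : 0 <= K' -> exists N Q : nat,
  forall S : set (X -> X), S `<=` G ->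
    (forall z z', S z -> S z' -> d (z o) (z' o) <= K' /\
       d (z (gam N)) (z' (gam N)) <= K') -> few Q S.
Proof.
move=> K'0; have [N [_ /finite_seqP[s es]]] := wpd K'0.
exists N, (size s) => S SG cl.
have [[z0 Sz0]|S0] := pselect (exists z0, S z0); last first.
  by exists [::]; split=> // z Sz; case: S0; exists z.
have [f' [Gf' [e1 e2]]] := GV (SG _ Sz0).
exists [seq z0 \o h | h <- s]; split; first by rewrite size_map.
move=> z Sz; apply/mapP; exists (f' \o z); last first.
  by rewrite compA e2.
suff : [set` s] (f' \o z) by [].
rewrite -es; split; first exact: GM (SG _ Sz).
have [h1 h2] := cl _ _ Sz0 Sz.
have z0K x : z0 (f' x) = x by exact: (congr1 (fun h => h x) e2).
by split; rewrite -(G_iso _ _ (SG _ Sz0)) /= z0K.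
Qed.

(** * Isometries that do not disperse *)

Definition del := d o (gam 1).
(** In [fellow_travel] the image point and the axis point are joined through two points of one
    geodesic, at most [C0 + del] apart, each [C0] close to its partner. *)
Definition C1 := 3 * C0 + del.
Definition along f := forall i, exists j, d (f (gam i)) (gam j) <= C1.
Definition disperses f (c : nat) := forall z i i', near z i -> c%:Z < `|i| ->
  near (f z) i' -> `|i'| <= c%:Z.

Lemma gam_big i B : K * (B + K) < `|i|%:~R -> B < d (gam i) o.
Proof.
move=> h; have K0 := K_gt0; have := gam_ge i 0; rewrite subr0 => h1.
have := lt_le_trans h h1; rewrite ltr_pM2l//; rewrite -[gam 0]/o; lra.
Qed.

(** Failure of dispersion for a large constant gives [z] such that both [z] and [f z] project far
    out. The geodesic from [z] to the preimage of [o] follows the axis, and so does its image, which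
    ends at [o]. The two stretches overlap, so a window of the translated axis lies near the
    axis. *)
Lemma fellow_travel f (M : nat) : G f -> (forall c, ~ disperses f c) ->
  exists (a : nat) (e : int), (e = 1 \/ e = -1) /\
    forall n, (n <= M)%N -> exists l, d (f (gam (e * (a + n)%N%:Z))) (gam l) <= C1.
Proof.
move=> Gf nd; have C00 := C0_gt0; have K0 := K_gt0.
have [f' [Gf' [e1 e2]]] := GV Gf.
have f'K z : f' (f z) = z by exact: (congr1 (fun h => h z) e1).
have fK z : f (f' z) = z by exact: (congr1 (fun h => h z) e2).
have [i0 ni0] := near_ex (f' o).
pose a := `|i0|%N.
(* [Ds] bounds the distance from [o] of the image geodesic while it passes the image of the window.
   An index beyond [Bd] puts [gam i'] farther out than [Ds], and [gam i] more than [2 * K] away from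
   [gam i0]. *)
pose Ds := C0 + K * (a + M)%N%:R + K + d (f o) o.
pose Bd := K * (2 * K + d (gam i0) o + K) + K * (Ds + K).
pose c := ((a + M) + (Num.truncn Bd).+1)%N.
have cB : Bd < c%:R.
  by apply: lt_le_trans (truncnS_gt _) _; rewrite ler_nat leq_addl.
have Ds0 : 0 <= Ds by rewrite /Ds; have := dist_ge0 (f o) o; have := mulr_ge0 (ltW K0) (ler0n R (a + M)); lra.
have : ~ disperses f c := nd c.
move=> /existsNP[z] /existsNP[i] /existsNP[i'] /not_implyP[nz] /not_implyP[ci].
move=> /not_implyP[nfz] /negP; rewrite -ltNge => ci'.
have big (k : int) : c%:Z < `|k| -> Bd < `|k|%:~R.
  by move=> ck; apply: lt_trans cB _; rewrite -[X in X < _]/(c%:Z%:~R) ltr_int.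
have i0d := dist_ge0 (gam i0) o.
have hK1 : 0 <= K * (2 * K + d (gam i0) o + K) by rewrite mulr_ge0 //; lra.
have hK2 : 0 <= K * (Ds + K) by rewrite mulr_ge0//; lra.
have far_i : 2 * K + d (gam i0) o < d (gam i) o.
  by apply: gam_big; have := big _ ci; rewrite /Bd; lra.
have far_i' : Ds < d (gam i') o.
  by apply: gam_big; have := big _ ci'; rewrite /Bd; lra.
have far_i'K : 2 * K < d (gam i') o.
  apply: gam_big; have := big _ ci'.
  have : K * (2 * K + K) <= K * (2 * K + d (gam i0) o + K) by rewrite ler_pM2l//; lra.
  rewrite /Bd; lra.
have [cc [cseg [c0 cL]]] := geoX.2 z (f' o).
set L := d z (f' o) in cseg cL.
have [L0 cg] := cseg.
have P1 l : (i0 <= l <= i) || (i <= l <= i0) -> exists t, 0 <= t <= L /\ d (cc t) (gam l) <= C0.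
  move=> hl; apply: (passes_gam nz ni0 _ _ cseg c0 cL); first by rewrite orbC.
  have := dist_tri (gam i0) (gam i) o; lra.
have near_o : near o 0 by exact: (near_gam 0).
have P2 l : (i' <= l <= 0) || (0 <= l <= i') -> exists t, 0 <= t <= L /\ d (f (cc t)) (gam l) <= C0.
  move=> hl; apply: (passes_gam nfz near_o hl _ (L := L) (c := f \o cc)) => //.
  - by rewrite -[gam 0]/o; lra.
  - by split=> // s t hs ht; rewrite /= G_iso// cg.
  - by rewrite /= c0.
  - by rewrite /= cL fK.
have dL t : 0 <= t <= L -> d (f (cc t)) o = L - t.
  move=> tL; rewrite -{1}(fK o) -cL G_iso// cg ?L0 ?lexx//.
  by rewrite distrC ger0_norm// subr_ge0; case/andP: tL.
pose e := sgi i.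
exists a, e; split; first exact: sgiP.
move=> n nM.
have [|t [tL ht]] := P1 (e * (a + n)%N%:Z).
  by apply: (sgi_between_far nM (c := c)) => //; rewrite /c -[X in (X < _)%N]addn0 ltn_add2l.
pose y := d (f (cc t)) o.
have yDs : y <= Ds.
  have := dist_tri (f (gam (e * (a + n)%N%:Z))) (f (cc t)) o.
  rewrite G_iso// => h1.
  have := dist_tri (f o) (f (gam (e * (a + n)%N%:Z))) o; rewrite G_iso// => h2.
  have := gam_le (e * (a + n)%N%:Z) 0; rewrite subr0 -[gam 0]/o => h3.
  have h4 : `|e * (a + n)%N%:Z|%:~R <= (a + M)%N%:R :> R.
    by rewrite norm_sgiM -[X in X <= _]/((a + n)%N%:R) ler_nat leq_add2l.
  have : K * `|e * (a + n)%N%:Z|%:~R <= K * (a + M)%N%:R by rewrite ler_pM2l.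
  rewrite /y /Ds; lra.
pose e' := sgi i'.
have ei' : gam (e' * `|i'|%N%:Z) = gam i' by rewrite sgi_abs.
(* Axis points are matched with times by their distance from [o]: the least [m] that reaches [y]
   overshoots by at most one step length [del]. *)
have ex : exists m : nat, y <= d (gam (e' * m%:Z)) o.
  by exists `|i'|%N; rewrite ei'; lra.
case: (ex_minnP ex) => m hm min.
have mi' : (m <= `|i'|%N)%N by apply: min; rewrite ei'; lra.
have hm' : d (gam (e' * m%:Z)) o <= y + del.
  case: m hm min mi' => [|m] hm min mi'.
    rewrite mulr0 -[gam 0]/o dist_xx; have := dist_ge0 o (gam 1); have := dist_ge0 (f (cc t)) o.
    by rewrite /y /del; lra.
  have h1 : d (gam (e' * m%:Z)) o < y.
    by rewrite ltNge; apply/negP => /min; rewrite ltnn.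
  have := dist_tri (gam (e' * m%:Z)) (gam (e' * m.+1%:Z)) o.
  suff : d (gam (e' * m.+1%:Z)) (gam (e' * m%:Z)) = del by lra.
  have [->|->] := sgiP i' : e' = 1 \/ e' = -1; rewrite ?mul1r ?mulN1r.
    by rewrite -{1}addn1 PoszD -zpow_gam -[m%:Z in X in d _ X]addr0 -zpow_gam zpow_iso dist_sym.
  rewrite -[X in d (gam X) _]addr0 (_ : - m%:Z = - m.+1%:Z + 1); last by rewrite -addn1 PoszD opprD subrK.
  by rewrite -!zpow_gam zpow_iso.
have [|t' [t'L ht']] := P2 (e' * m%:Z).
  exact: sgi_between.
exists (e' * m%:Z).
have tt' : d (f (cc t)) (f (cc t')) <= del + C0.
  rewrite G_iso// cg//.
  have h1 := dL _ tL; have h2 := dL _ t'L.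
  have := dist_tri (gam (e' * m%:Z)) (f (cc t')) o.
  have := dist_tri (f (cc t')) (gam (e' * m%:Z)) o; rewrite (dist_sym (gam _) (f (cc t'))).
  rewrite ler_norml; move: hm hm'; rewrite /y => *; lra.
have := dist_tri (f (cc t)) (f (gam (e * (a + n)%N%:Z))) (gam (e' * m%:Z)).
have := dist_tri (f (cc t')) (f (cc t)) (gam (e' * m%:Z)).
have e3 : d (f (gam (e * (a + n)%N%:Z))) (f (cc t)) = d (cc t) (gam (e * (a + n)%N%:Z)).
  by rewrite G_iso// dist_sym.
rewrite e3 /C1; lra.
Qed.

Lemma C1_gt0 : 0 < C1.
Proof. by rewrite /C1 /del; have := C0_gt0; have := dist_ge0 o (gam 1); lra. Qed.

(** Shifting the axis before and after [f] so that [o] returns near [o] gives elements [phi n],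
    which by WPD take at most [M] values on the window. When two agree, [f] intertwines a nonzero
    shift [q] with a shift [p], and closeness to the axis spreads periodically from the window to
    all indices. *)
Lemma along_of_not_disperses f : G f -> (forall c, ~ disperses f c) -> along f.
Proof.
move=> Gf nd; have K0 := K_gt0; have C10 := C1_gt0.
have [N [Q cl]] : exists N Q : nat, forall S : set (X -> X), S `<=` G ->
    (forall z z', S z -> S z' -> d (z o) (z' o) <= 2 * C1 /\
       d (z (gam N)) (z' (gam N)) <= 2 * C1) -> few Q S.
  by apply: clique_few; lra.
pose B := K * (2 * C1 + d (gam N) o + K).
pose nb := (Num.truncn B).+1.
have Bnb : B < nb%:R by exact: truncnS_gt.
pose Vs := [seq k%:Z - nb%:Z | k <- iota 0 (2 * nb).+1].
have memV (v : int) : `|v|%:~R <= B -> v \in Vs.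
  move=> hv; have : `|v| < nb%:Z.
    by rewrite -(ltr_int R); apply: le_lt_trans hv Bnb.
  move=> {}hv; apply/mapP; exists `|(v + nb%:Z)%R|%N; last by lia.
  by rewrite mem_iota; lia.
pose S v : set (X -> X) := [set z | G z /\ d (z o) o <= C1 /\ d (z (gam N)) (gam v) <= C1].
have fewS v : few Q (S v).
  apply: cl => [z []//|z z' [_ [h1 h2]] [_ [h1' h2']]]; split.
    by have := dist_tri o (z o) (z' o); rewrite (dist_sym o (z' o)); lra.
  by have := dist_tri (gam v) (z (gam N)) (z' (gam N)); rewrite (dist_sym (gam v) (z' _)); lra.
have fewA := few_bigor (fun v (_ : v \in Vs) => fewS v).
set M := (size Vs * Q)%N in fewA.
(* The two margins of length [N] make room for the second marker, whose index lies farther out or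
   farther in according to the sign [e]. *)
have [a [e [he H]]] := fellow_travel (M + N + N) Gf nd.
have lex n : exists k, (n <= M + N + N)%N -> d (f (gam (e * (a + n)%N%:Z))) (gam k) <= C1.
  have [nM|nM] := boolP (n <= M + N + N)%N; last by exists 0.
  by have [k h] := H n nM; exists k.
have [l hl] := choice lex.
pose phi n := zpow g gi (- l (N + n)%N) \o (f \o zpow g gi (e * (a + (N + n))%N%:Z)).
have phi_gam n k : phi n (gam k) = zpow g gi (- l (N + n)%N) (f (gam (e * (a + (N + n))%N%:Z + k))).
  by rewrite /phi /= zpow_gam.
have hphi n : (n <= M)%N -> exists2 v, v \in Vs & S v (phi n).
  move=> nM.
  have nM1 : (N + n <= M + N + N)%N by lia.
  have [n' [n'M en']] : exists n', (n' <= M + N + N)%N /\ e * (a + (N + n))%N%:Z + N%:Z = e * (a + n')%N%:Z.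
    by case: he => ->; [exists (N + n + N)%N|exists n]; split; lia.
  have h1 : d (phi n (gam 0)) (gam 0) <= C1.
    rewrite phi_gam addr0.
    have -> : gam 0 = zpow g gi (- l (N + n)%N) (gam (l (N + n)%N)).
      by rewrite zpow_gam addNr.
    by rewrite zpow_iso; exact: hl.
  rewrite -[gam 0]/o in h1.
  have h2 : d (phi n (gam N)) (gam (l n' - l (N + n)%N)) <= C1.
    by rewrite phi_gam en' addrC -zpow_gam zpow_iso; exact: hl.
  have Gphi : G (phi n) by apply: GM; [exact: G_zp|apply: GM => //; exact: G_zp].
  exists (l n' - l (N + n)%N); last by split.
  apply: memV; have := gam_ge (l n' - l (N + n)%N) 0; rewrite subr0 => h3.
  apply: le_trans h3 _; rewrite /B ler_pM2l// lerD2r -[gam 0]/o.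
  have := dist_tri (phi n (gam N)) (gam (l n' - l (N + n)%N)) o.
  have := dist_tri (phi n o) (phi n (gam N)) o.
  rewrite (G_iso (gam N) o Gphi) (dist_sym (gam (_ - _)) (phi n (gam N))); lra.
have [n1 [n2 [n12 n2M ephi]]] := few_pigeonhole fewA hphi.
pose p := l (N + n1)%N - l (N + n2)%N.
pose q := e * (n1%:Z - n2%:Z).
have per j : f (gam (j + q)) = zpow g gi p (f (gam j)).
  have := congr1 (fun h => zpow g gi (l (N + n1)%N) (h (gam (j - e * (a + (N + n2))%N%:Z)))) ephi.
  rewrite !phi_gam -![zpow g gi _ (zpow g gi _ _)]/((_ \o _) _) -!zpowD addrN.
  have -> : e * (a + (N + n1))%N%:Z + (j - e * (a + (N + n2))%N%:Z) = j + q.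
    by rewrite /q !PoszD; ring.
  by rewrite [e * _ + _]addrC subrK.
pose P j := exists k, d (f (gam j)) (gam k) <= C1.
have PS j : P j -> P (j + q).
  by move=> [k hk]; exists (p + k); rewrite per -zpow_gam zpow_iso.
have PP j : P j -> P (j - q).
  move=> [k hk]; exists (- p + k).
  rewrite -(zpow_iso p) -per subrK zpow_gam addrA addrN add0r.
  exact: hk.
have Pq j k : P j -> P (j + k * q).
  move=> Pj; elim/int_ind: k => [|n IH|n IH]; first by rewrite mul0r addr0.
    by rewrite -addn1 PoszD mulrDl mul1r addrA; exact: PS.
  by rewrite -addn1 PoszD opprD mulrDl mulN1r addrA; exact: PP.
move=> i.
have [r [k [rD ->]]] := @int_decomp e i (a + (N + n1)) (n2 - n1) he (ltac:(by rewrite subn_gt0)).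
have -> : k * (e * (n2 - n1)%N%:Z) = (- k) * q.
  by rewrite /q -subzn ?(ltnW n12)//; ring.
apply: Pq; rewrite -addnA; have [|h hh] := H (N + n1 + r)%N; first by lia.
by exists h.
Qed.

(** * Locating group elements on a line *)

Definition C2 := 2 * C0 + 6 * K ^+ 3 + 2 * K.

(** If [gam i] and [gam j] are [2 * K] apart, a geodesic between them passes [gam l], a detour of
    [2 * C0]. Otherwise the index differences are at most [3 * K ^+ 2], and the two short legs
    account for the rest of [C2]. *)
Lemma gam_between i l j : (i <= l <= j) || (j <= l <= i) ->
  d (gam i) (gam l) + d (gam l) (gam j) <= d (gam i) (gam j) + C2.
Proof.
move=> hl; have K0 := K_gt0; have C00 := C0_gt0.
have K30 : 0 <= K ^+ 3 by rewrite exprn_ge0// ltW.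
have [h|h] := leP (2 * K) (d (gam i) (gam j)).
  have [c [cseg [c0 cL]]] := geoX.2 (gam i) (gam j).
  have [t [tL ht]] := passes_gam (near_gam i) (near_gam j) hl h cseg c0 cL.
  have [L0 cg] := cseg.
  have h1 : d (gam i) (c t) = t.
    by rewrite -{1}c0 cg ?lexx// sub0r normrN ger0_norm//; case/andP: tL.
  have h2 : d (c t) (gam j) = d (gam i) (gam j) - t.
    rewrite -{1}cL cg ?lexx ?L0// distrC ger0_norm// subr_ge0; by case/andP: tL.
  have := dist_tri (c t) (gam i) (gam l); have := dist_tri (c t) (gam l) (gam j).
  rewrite (dist_sym (gam l) (c t)) /C2; lra.
have h3 : `|i - j|%:~R <= K * (3 * K).
  by apply: le_trans (gam_ge i j) _; rewrite ler_pM2l//; lra.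
have h4 : `|i - l|%:~R <= K * (3 * K).
  by apply: le_trans h3; rewrite ler_int; lia.
have h5 : `|l - j|%:~R <= K * (3 * K).
  by apply: le_trans h3; rewrite ler_int; lia.
have := gam_le i l; have := gam_le l j; have := dist_ge0 (gam i) (gam j).
have : K * `|i - l|%:~R <= K * (K * (3 * K)) by rewrite ler_pM2l.
have : K * `|l - j|%:~R <= K * (K * (3 * K)) by rewrite ler_pM2l.
have -> : K * (K * (3 * K)) = 3 * K ^+ 3 by ring.
rewrite /C2; lra.
Qed.

(** Signed distance from [o]: unlike the index, a coordinate on the axis with additive error only,
    as [locator] requires. *)
Definition rr (i : int) : R := if 0 <= i then d o (gam i) else - d o (gam i).

Lemma rr_rough i j : `| `|rr i - rr j| - d (gam i) (gam j) | <= C2.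
Proof.
have K0 := K_gt0; have C00 := C0_gt0.
have K30 : 0 <= K ^+ 3 by rewrite exprn_ge0// ltW.
have C20 : 0 <= C2 by rewrite /C2; lra.
have b1 := @gam_between 0 i j; have b2 := @gam_between 0 j i; have b3 := @gam_between i 0 j.
move: b1 b2 b3; rewrite -[gam 0]/o (dist_sym (gam j) (gam i)) (dist_sym (gam i) o) => b1 b2 b3.
have := dist_tri (gam i) o (gam j); have := dist_tri (gam j) o (gam i).
have := dist_tri o (gam i) (gam j); rewrite (dist_sym (gam j) (gam i)) (dist_sym (gam i) o) => t3 t2 t1.
have d1 := dist_ge0 o (gam i); have d2 := dist_ge0 o (gam j).
rewrite /rr; case: (leP 0 i) => hi; case: (leP 0 j) => hj.
- have [ij|ij] := leP i j.
    have {}b1 := b1 (ltac:(by rewrite hi ij)).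
    by case: (ler0P (d o (gam i) - d o (gam j))) => ?; rewrite ler_norml; lra.
  have {}b2 := b2 (ltac:(by rewrite hj (ltW ij))).
  by case: (ler0P (d o (gam i) - d o (gam j))) => ?; rewrite ler_norml; lra.
- have {}b3 := b3 (ltac:(by rewrite hi (ltW hj) orbT)).
  by case: (ler0P (d o (gam i) - - d o (gam j))) => ?; rewrite ler_norml; lra.
- have {}b3 := b3 (ltac:(by rewrite hj (ltW hi))).
  by case: (ler0P (- d o (gam i) - d o (gam j))) => ?; rewrite ler_norml; lra.
- have [ij|ij] := leP i j.
    have {}b2 := b2 (ltac:(by rewrite ij (ltW hj) orbT)).
    by case: (ler0P (- d o (gam i) - - d o (gam j))) => ?; rewrite ler_norml; lra.
  have {}b1 := b1 (ltac:(by rewrite (ltW ij) (ltW hi) orbT)).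
  by case: (ler0P (- d o (gam i) - - d o (gam j))) => ?; rewrite ler_norml; lra.
Qed.

(* [Loc z s s'] places [z o] and a second marker of [z] at the coordinates [s]
   and [s'] of a line (the axis, or a geodesic); two markers are needed for WPD
   to leave finitely many [z]. *)
Definition locator (Loc : (X -> X) -> R -> R -> Prop) (C : R) (Q : nat) :=
  [/\ exists s', Loc id 0 s',
      forall z1 s1 s1' z2 s2 s2', Loc z1 s1 s1' -> Loc z2 s2 s2' ->
        `| `|s1 - s2| - d (z1 o) (z2 o) | <= C,
      forall z s s', Loc z s s' -> `|s' - s| <= C &
      forall x x', few Q (fun z => G z /\ exists s s',
        [/\ Loc z s s', x <= s <= x + 1 & x' <= s' <= x' + 1])].

(** [2 * b + 1] unit cells cover the range of [s]; as [s'] is within [C] of [s], [2 * c + 2] cells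
    remain for it. Growth linear in [b] makes the cost of the location logarithmic. *)
Lemma locator_few Loc C Q (c : nat) : locator Loc C Q -> C <= c%:R ->
  forall (x : R) (b : nat), few ((2 * b).+1 * ((2 * c + 1).+1 * Q))
    (fun z => G z /\ exists s s', Loc z s s' /\ `|s - x| <= b%:R).
Proof.
move=> [_ _ near' cell] Cc x b.
have := @few_bigor (X -> X) _ (iota 0 (2 * b).+1) ((2 * c + 1).+1 * Q)
  (fun k z => exists2 k', k' \in iota 0 (2 * c + 1).+1 & G z /\ exists s s',
    [/\ Loc z s s', x - b%:R + k%:R <= s <= x - b%:R + k%:R + 1 &
     x - b%:R + k%:R - c%:R + k'%:R <= s' <= x - b%:R + k%:R - c%:R + k'%:R + 1]).
rewrite size_iota => /(_ _)/wrap[].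
  move=> k _.
  have := @few_bigor (X -> X) _ (iota 0 (2 * c + 1).+1) Q
   (fun k' z => G z /\ exists s s',
    [/\ Loc z s s', x - b%:R + k%:R <= s <= x - b%:R + k%:R + 1 &
     x - b%:R + k%:R - c%:R + k'%:R <= s' <= x - b%:R + k%:R - c%:R + k'%:R + 1]).
  by rewrite size_iota; apply => k' _; exact: cell.
apply: few_sub => z [Gz [s [s' [Ls hs]]]].
have [|k kb hk] := @unit_cell R (x - b%:R) s (2 * b).
  by move: hs; rewrite ler_norml natrM; lra.
exists k => //.
have [|k' kc hk'] := @unit_cell R (x - b%:R + k%:R - c%:R) s' (2 * c + 1).
  by have := near' _ _ _ Ls; rewrite ler_norml natrD natrM; lra.
by exists k' => //; split=> //; exists s, s'.
Qed.

Lemma locator_along : exists Loc C Q, locator Loc C Q /\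
  forall z, G z -> along z -> exists s s', Loc z s s'.
Proof.
have K0 := K_gt0; have C00 := C0_gt0; have C10 := C1_gt0.
have K30 : 0 <= K ^+ 3 by rewrite exprn_ge0// ltW.
have C20 : 0 <= C2 by rewrite /C2; lra.
have [N [Q cl]] : exists N Q : nat, forall S : set (X -> X), S `<=` G ->
    (forall z z', S z -> S z' -> d (z o) (z' o) <= 1 + C2 + 2 * C1 /\
       d (z (gam N)) (z' (gam N)) <= 1 + C2 + 2 * C1) -> few Q S.
  by apply: clique_few; lra.
exists (fun z s s' => G z /\ exists i i',
  [/\ d (z o) (gam i) <= C1, d (z (gam N)) (gam i') <= C1, s = rr i & s' = rr i']).
exists (C2 + 2 * C1 + d o (gam N)), Q.
have dN := dist_ge0 o (gam N).
have rough p q i j : d p (gam i) <= C1 -> d q (gam j) <= C1 ->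
    `| `|rr i - rr j| - d p q | <= C2 + 2 * C1.
  move=> hi hj; have := rr_rough i j; rewrite !ler_norml.
  have := dist_tri p (gam i) (gam j); have := dist_tri q p (gam j).
  have := dist_tri (gam i) p q; have := dist_tri (gam j) (gam i) q.
  rewrite (dist_sym (gam i) p) (dist_sym (gam j) q); lra.
split; first split.
- exists (rr N); split=> //; exists 0, N%:Z; split=> //; rewrite ?dist_xx ?(ltW C10)//.
  by rewrite /rr lexx dist_xx.
- move=> z1 s1 s1' z2 s2 s2' [_ [i1 [i1' [h1 h1' -> _]]]] [_ [i2 [i2' [h2 h2' -> _]]]].
  by apply: le_trans (rough _ _ _ _ h1 h2) _; lra.
- move=> z s s' [Gz [i [i' [h h' -> ->]]]].
  have := rough _ _ _ _ h' h; rewrite (G_iso _ _ Gz) (dist_sym (gam N) o) ler_norml; lra.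
- move=> x x'; apply: cl => [z []//|z z' [Gz [s [s' [[_ [i [i' [h h' -> ->]]]] hs hs']]]]].
  move=> [Gz' [t [t' [[_ [j [j' [k k' -> ->]]]] ht ht']]]].
  have := rough _ _ _ _ h k; have := rough _ _ _ _ h' k'.
  have : `|rr i - rr j| <= 1 by rewrite ler_norml; lra.
  have : `|rr i' - rr j'| <= 1 by rewrite ler_norml; lra.
  move=> k1 k2; rewrite ler_norml => k3; rewrite ler_norml => k4; split; lra.
move=> z Gz az; have [i hi] := az 0; have [i' hi'] := az N%:Z.
by exists (rr i), (rr i'); split=> //; exists i, i'.
Qed.

(** Not [z] itself but a detour [z \o v], with [v] from a finite list, lies near the geodesic; the
    second marker is there for WPD. *)
Definition good (N : nat) (V : seq (X -> X)) (z w : X -> X) := exists2 v, v \in V &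
  passes o (w o) (z (v o)) /\ passes o (w o) (z (v (gam N))).

(** For fixed [v] and fixed cells the elements [z \o v] agree on both markers up to a bounded
    distance, so [clique_few] applies, and [z] is recovered with the inverse of [v]. The [+ 1]
    counts [id], which has location [0] even if time [0] is not good. [C] precedes [w] because the
    block length [k] is fixed before the endpoint. *)
Lemma locator_good : exists N Q : nat, forall V : seq (X -> X),
  (forall v, v \in V -> G v) -> exists C, forall w, exists Loc,
    locator Loc C (size V * Q + 1) /\
    forall z, G z -> good N V z w -> exists s s', Loc z s s'.
Proof.
have C00 := C0_gt0.
have [N [Q cl]] : exists N Q : nat, forall S : set (X -> X), S `<=` G ->
    (forall z z', S z -> S z' -> d (z o) (z' o) <= 2 * C0 + 1 /\
       d (z (gam N)) (z' (gam N)) <= 2 * C0 + 1) -> few Q S.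
  by apply: clique_few; lra.
exists N, Q => V VG.
have [DV hDV] : exists DV : R, 0 <= DV /\ forall v, v \in V -> d (v o) o <= DV.
  elim: V {VG} => [|v V [DV [DV0 IH]]]; first by exists 0.
  exists (DV + d (v o) o); split; first by rewrite addr_ge0// dist_ge0.
  move=> u; rewrite inE => /predU1P[->|/IH]; first by lra.
  by have := dist_ge0 (v o) o; lra.
have [DV0 hV] := hDV; have dN := dist_ge0 o (gam N).
exists (2 * (C0 + DV) + d o (gam N)) => w.
have [c [cseg [c0 cL]]] := geoX.2 o (w o); have [L0 cg] := cseg.
set L := d o (w o) in cseg cL L0 cg.
pose Lg (v z : X -> X) (s s' : R) := [/\ G z, 0 <= s <= L, 0 <= s' <= L,
   d (c s) (z (v o)) <= C0 & d (c s') (z (v (gam N))) <= C0].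
pose Loc (z : X -> X) (s s' : R) := (exists2 v, v \in V & Lg v z s s') \/
  [/\ z = id, s = 0 & s' = 0].
have Loc_near z s s' : Loc z s s' -> 0 <= s <= L /\ d (c s) (z o) <= C0 + DV.
  case=> [[v vV [Gz sL s'L h h']]|[-> -> _]]; last first.
    by rewrite lexx L0 c0 dist_xx; split=> //; lra.
  split=> //; have := dist_tri (z (v o)) (c s) (z o); rewrite (G_iso (v o) o Gz).
  by have := hV _ vV; lra.
exists Loc; split; last first.
  move=> z Gz [v vV [h1 h2]].
  have [s [sL hs]] := h1 _ _ cseg c0 cL; have [s' [s'L hs']] := h2 _ _ cseg c0 cL.
  by exists s, s'; left; exists v.
split.
- by exists 0; right.
- move=> z1 s1 s1' z2 s2 s2' /Loc_near[sL1 h1] /Loc_near[sL2 h2].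
  rewrite -(cg _ _ sL1 sL2) ler_norml.
  have := dist_tri (c s1) (z1 o) (z2 o); have := dist_tri (c s2) (c s1) (z2 o).
  have := dist_tri (z1 o) (c s1) (c s2); have := dist_tri (z2 o) (z1 o) (c s2).
  rewrite (dist_sym (z1 o) (c s1)) (dist_sym (z2 o) (c s2)); lra.
- move=> z s s' [[v vV [Gz sL s'L h h']]|[_ -> ->]]; last first.
    by rewrite subrr normr0; lra.
  rewrite -(cg _ _ s'L sL).
  have := dist_tri (z (v (gam N))) (c s') (c s); have := dist_tri (z (v o)) (z (v (gam N))) (c s).
  have e1 : d (z (v (gam N))) (z (v o)) = d o (gam N).
    by rewrite (G_iso _ _ Gz) (G_iso _ _ (VG _ vV)) dist_sym.
  rewrite e1 (dist_sym (z (v o)) (c s)); lra.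
- move=> x x'.
  apply: (@few_sub _ _ _ (fun z => (exists2 v, v \in V & exists s s',
     [/\ Lg v z s s', x <= s <= x + 1 & x' <= s' <= x' + 1]) \/ z = id)).
    move=> z [Gz [s [s' [[[v vV h]|[-> _ _]] hs hs']]]]; last by right.
    by left; exists v => //; exists s, s'.
  apply: few_or; last by exists [:: id]; split=> // z ->; rewrite mem_head.
  apply: few_bigor => v vV.
  have [v' [Gv' [e1 e2]]] := GV (VG _ vV).
  pose B (y : X -> X) := exists z s s',
    [/\ y = z \o v, Lg v z s s', x <= s <= x + 1 & x' <= s' <= x' + 1].
  have fB : few Q B.
    apply: cl => [y [z [s [s' [-> [Gz _ _ _ _] _ _]]]]|y y'].
      exact: GM (VG _ vV).
    move=> [z [s [s' [-> [Gz sL s'L h h'] hs hs']]]].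
    move=> [z2 [t [t' [-> [Gz2 tL t'L k k'] ht ht']]]] /=.
    have close p q a b : 0 <= a <= L -> 0 <= b <= L -> d (c a) p <= C0 -> d (c b) q <= C0 ->
        `|a - b| <= 1 -> d p q <= 2 * C0 + 1.
      move=> aL bL ha hb; rewrite -(cg _ _ aL bL) => ab.
      have := dist_tri (c a) p q; have := dist_tri (c b) (c a) q.
      rewrite (dist_sym p (c a)); lra.
    split; first by apply: (close _ _ s t) => //; rewrite ler_norml; lra.
    by apply: (close _ _ s' t') => //; rewrite ler_norml; lra.
  apply: (few_image (F := fun y : X -> X => y \o v') fB) => z [s [s' [h hs hs']]].
  exists (z \o v); first by exists z, s, s'.
  by rewrite -compA e2.
Qed.

(** * Ping-pong words *)

Section Schottky.
Variables (f : X -> X) (c m N : nat).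
Hypothesis Gf : G f.
Hypothesis disp : disperses f c.
Hypothesis m0 : (0 < m)%N.

(** As [m * b > 2 * c], the shift [U] carries every index that is at least [- c] beyond [c]. *)
Let b := (2 * c + 1)%N.
Let U := zpow g gi (m * b)%N%:Z.
(** Between an index at most [c] and one at least [m * n0 - c] there is room for the indices from
    [c] to [c + N], and the corresponding axis points are [2 * K] apart. *)
Let n0 := (2 * c + N + (Num.truncn (K * (2 * K + K))).+1)%N.
Let UL := zpow g gi (m * n0)%N%:Z.

Let fU i := prodc (nseq i (f \o U)).
Let Uf i := prodc (nseq i (U \o f)).

Lemma prodc_nseqD i j (h : X -> X) :
  prodc (nseq (i + j) h) = prodc (nseq i h) \o prodc (nseq j h).
Proof. by rewrite nseqD prodc_cat. Qed.

Lemma G_nseq i h : G h -> G (prodc (nseq i h)).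
Proof. by move=> Gh; elim: i => [//|i IH] /=; exact: GM. Qed.

Let mb : 2 * c%:Z < (m * b)%N%:Z. Proof. by rewrite /b; nia. Qed.

(** Ping-pong: the shift carries the index beyond [c], and [f] brings it back to absolute value at
    most [c], which restores the hypothesis. *)
Lemma fU_near e y : (exists2 k, near y k & - c%:Z <= k) ->
  forall k, near (fU e.+1 y) k -> `|k| <= c%:Z.
Proof.
elim: e y => [|e IH] y [k0 nk0 ck0].
  move=> k; apply: disp; first exact: (near_shift (m * b)%N%:Z nk0).
  by move: mb; lia.
rewrite -[e.+2]addn1 /fU prodc_nseqD => k; apply: IH.
have [k1 nk1] := near_ex (prodc (nseq 1 (f \o U)) y).
exists k1 => //; suff : `|k1| <= c%:Z by lia.
apply: (disp (near_shift (m * b)%N%:Z nk0)) nk1; move: mb; lia.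
Qed.

Lemma near_unshift k x i : near (zpow g gi k x) i -> near x (i - k).
Proof.
move=> h; have := near_shift (- k) h.
by rewrite -[zpow g gi (- k) _]/((_ \o _) _) -zpowD addNr addrC.
Qed.

Lemma Uf_near e y : (exists2 k, near y k & c%:Z < `|k|) ->
  forall k, near (Uf e.+1 y) k -> c%:Z < k.
Proof.
elim: e y => [|e IH] y [k0 nk0 ck0].
  move=> k /near_unshift/(disp nk0 ck0); move: mb; lia.
rewrite -[e.+2]addn1 /Uf prodc_nseqD => k; apply: IH.
have [k1 nk1] := near_ex (prodc (nseq 1 (U \o f)) y).
exists k1 => //; move: (nk1) => /near_unshift/(disp nk0 ck0); move: mb; lia.
Qed.

(* [(f U)^i g^(m n0) (U f)^(n-i)]: the number of letters does not depend on [i]. *)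
Definition sword n i := fU i \o (UL \o Uf (n - i)).
Definition spivot i := fU i \o zpow g gi c%:Z.
(** Here [x] is the preimage of [o] under the past. Seen from the middle power, the past must not
    project beyond the pivot index [c], nor the future before [- c]. *)
Definition bad_past i x := exists y, x = fU i y /\ exists2 k, near y k & c%:Z < k.
Definition bad_future n i x := exists2 k, near (Uf (n - i) x) k & k < - c%:Z.

Lemma G_fU i : G (fU i).
Proof. by apply: G_nseq; apply: GM => //; exact: G_zp. Qed.

Lemma G_Uf i : G (Uf i).
Proof. by apply: G_nseq; apply: GM => //; exact: G_zp. Qed.

Lemma G_sword n i : G (sword n i).
Proof. by apply: GM; [exact: G_fU|apply: GM; [exact: G_zp|exact: G_Uf]]. Qed.

Lemma G_spivot i : G (spivot i).
Proof. by apply: GM; [exact: G_fU|exact: G_zp]. Qed.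

(** For [i < j] the point [y] of [i] is the image of that of [j] under at least one factor [f \o U];
    by ping-pong it projects within [c]. *)
Lemma bad_past_uniq i j x : (i < j)%N -> bad_past i x -> ~ bad_past j x.
Proof.
move=> ij [y [-> [k nk ck]]] [y' [+ [k' nk' ck']]].
have -> : j = (i + (j - i.+1).+1)%N by lia.
rewrite /fU prodc_nseqD => /(G_inj (G_fU i)) ey.
have := @fU_near (j - i.+1) y' (ltac:(by exists k' => //; lia)) k.
rewrite /fU -ey => /(_ nk); lia.
Qed.

Lemma bad_future_uniq n i j x : (i < j)%N -> (j <= n)%N ->
  bad_future n i x -> ~ bad_future n j x.
Proof.
move=> ij jn [k + ck] [k' nk' ck'].
have -> : (n - i = (j - i.+1).+1 + (n - j))%N by lia.
rewrite /Uf prodc_nseqD => nk.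
have := @Uf_near (j - i.+1) (Uf (n - j) x) (ltac:(by exists k' => //; lia)) k nk.
lia.
Qed.

(** Pulled back by [fU i], the ends project to indices at most [c] and at least [m * n0 - c], on
    either side of the pivots [c] and [c + N]. *)
Lemma schottky_passes n i x y : ~ bad_past i x -> ~ bad_future n i y ->
  passes x (sword n i y) (spivot i o) /\
  passes x (sword n i y) (spivot i (gam N)).
Proof.
move=> nx ny; have K0 := K_gt0.
have [z ez] := G_surj x (G_fU i).
have [k nk] := near_ex z; have [l nl] := near_ex (Uf (n - i) y).
have kc : k <= c%:Z.
  by rewrite leNgt; apply/negP => h; apply: nx; exists z; split=> //; exists k.
have lc : - c%:Z <= l by rewrite leNgt; apply/negP => h; apply: ny; exists l.
have nl' := near_shift (m * n0)%N%:Z nl.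
have hn0 : (n0 <= m * n0)%N by rewrite leq_pmull.
have far : 2 * K <= d (gam k) (gam ((m * n0)%N%:Z + l)).
  have h := gam_ge k ((m * n0)%N%:Z + l).
  have : K * (2 * K + K) < `|k - ((m * n0)%N%:Z + l)|%:~R.
    apply: lt_le_trans (truncnS_gt _) _.
    rewrite -[X in X <= _]/((Num.truncn (K * (2 * K + K))).+1%:Z%:~R) ler_int.
    by move: hn0; rewrite {1}/n0; move: (Num.truncn _) (m * n0)%N kc lc => ? ?; lia.
  by move=> /lt_le_trans/(_ h); rewrite ltr_pM2l//; lra.
have btw (q : nat) : (q <= N)%N -> passes x (sword n i y) (fU i (gam (c%:Z + q%:Z))).
  move=> qN; rewrite -ez -[sword n i y]/(fU i (UL (Uf (n - i) y))).
  apply: passes_iso; first exact: G_fU.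
  apply: passes_gam nk nl' _ far; apply/orP; left.
  move: hn0; rewrite {1}/n0; move: (Num.truncn _) (m * n0)%N kc lc => ? ?; lia.
split; first by have := btw 0%N isT; rewrite addr0.
by rewrite -[spivot i (gam N)]/(fU i (zpow g gi c%:Z (gam N))) zpow_gam; exact: btw.
Qed.

End Schottky.

Lemma good_shift (N : nat) (V V' : seq (X -> X)) (z w' w : X -> X) : (forall v, v \in V' -> w' \o v \in V) ->
  good N V' (z \o w') w -> good N V z w.
Proof. by move=> VV' [v /VV' vV h]; exists (w' \o v). Qed.

Lemma conv_pow_nseq (p : (X -> X) -> R) n h i : prob_on G p ->
  0 < conv_pow G p n h -> 0 < conv_pow G p (i * n) (prodc (nseq i h)).
Proof.
move=> pp ph; elim: i => [|i IH].
  by rewrite mul0n /= /dirac_id; case: pselect.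
by rewrite mulSn /=; apply: (conv_pow_gt0 G1 GM).
Qed.

Lemma zpow_nseq m b : zpow g gi (m * b)%N%:Z = prodc (nseq b (iter m g)).
Proof.
rewrite /= mulnC; elim: b => [//|b IH].
by apply/funext => x; rewrite mulSn iterD /= -IH.
Qed.

Lemma schottky_words (p : (X -> X) -> R) (f : X -> X) (c m N n1 n2 : nat) :
  prob_on G p -> G f -> disperses f c -> (0 < m)%N ->
  0 < conv_pow G p n1 f -> 0 < conv_pow G p n2 (iter m g) ->
  forall n, exists l (sw pv : nat -> X -> X) (Bp Bf : nat -> (X -> X) -> Prop),
  [/\ forall i, G (pv i) /\ G (sw i),
      forall i, (i < n)%N -> 0 < conv_pow G p l (sw i),
      forall i j z, (i < j)%N -> (j < n)%N -> Bp i z -> ~ Bp j z,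
      forall i j z, (i < j)%N -> (j < n)%N -> Bf i z -> ~ Bf j z &
      forall i z y, G z -> ~ Bp i z -> ~ Bf i y ->
        good N [:: pv i] z (z \o (sw i \o y))].
Proof.
move=> pp Gf df m0 pf pg n.
exists (n * (n1 + (2 * c + 1) * n2) + (2 * c + N + (Num.truncn (K * (2 * K + K))).+1) * n2)%N.
exists (sword f c m N n), (spivot f c m).
exists (fun i z => G z /\ exists x, z x = o /\ bad_past f c m i x).
exists (fun i y => bad_future f c m n i (y o)); split.
- by move=> i; split; [exact: G_spivot|exact: G_sword].
- move=> i hin; rewrite /sword.
  have -> : (n * (n1 + (2 * c + 1) * n2) + (2 * c + N + (Num.truncn (K * (2 * K + K))).+1) * n2 =
     i * (n1 + (2 * c + 1) * n2) + ((2 * c + N + (Num.truncn (K * (2 * K + K))).+1) * n2 +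
       (n - i) * ((2 * c + 1) * n2 + n1)))%N.
    rewrite [RHS]addnCA [RHS]addnC; congr (_ + _)%N.
    by rewrite (addnC ((2 * c + 1) * n2) n1) -mulnDl subnKC// ltnW.
  have pU b : 0 < conv_pow G p (b * n2) (zpow g gi (m * b)%N%:Z).
    by rewrite zpow_nseq; exact: conv_pow_nseq.
  apply: (conv_pow_gt0 G1 GM) => //.
    by apply: conv_pow_nseq => //; apply: (conv_pow_gt0 G1 GM).
  apply: (conv_pow_gt0 G1 GM) => //.
  by apply: conv_pow_nseq => //; apply: (conv_pow_gt0 G1 GM).
- move=> i j z ij jn [Gz [x [zx bx]]] [_ [x' [zx' bx']]].
  have exx' : x = x' by apply: (G_inj Gz); rewrite zx zx'.
  rewrite -exx' in bx'; exact: (bad_past_uniq N Gf df m0 ij bx bx').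
- by move=> i j y ij jn; apply: (bad_future_uniq N df m0 ij); exact: ltnW.
- move=> i z y Gz nBp nBf.
  have [x zx] := G_surj o Gz.
  have nx : ~ bad_past f c m i x by move=> bx; apply: nBp; split=> //; exists x.
  have [h1 h2] := schottky_passes N Gf m0 nx nBf.
  exists (spivot f c m i); first exact: mem_head.
  split.
    by have := passes_iso Gz h1; rewrite zx.
  by have := passes_iso Gz h2; rewrite zx.
Qed.

End ContractingAxis.

(** * Frequency of good times *)

Section FiniteParts.
Context {R : realType} {I : choiceType}.
Local Open Scope ereal_scope.

Lemma esum_split_seq (F : seq I) (a : I -> R) : uniq F -> (forall x, 0 <= a x)%R ->
  \esum_(x in setT) (a x)%:E =
  (\sum_(x <- F) a x)%:E + E a (fun x => ind (x \notin F)).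
Proof.
move=> uF a0; rewrite (esumID [set` F]); last by move=> x _; rewrite lee_fin.
rewrite !setTI; congr (_ + _).
  rewrite esum_fset//=; last by move=> x _; rewrite lee_fin.
  by rewrite -fsbig_seq// sumEFin.
rewrite esum_mkcond; apply: eq_esum => x _.
rewrite in_setC; case: ifPn => h.
  by rewrite ind1 ?mule1//; apply: contra h; rewrite inE.
by rewrite ind0 ?mule0// => xF; move: h; rewrite negbK inE /= => h; rewrite h in xF.
Qed.

Lemma finite_part (a : I -> R) (A e : R) : (forall x, 0 <= a x)%R -> (0 < e)%R ->
  \esum_(x in setT) (a x)%:E = A%:E ->
  exists F, [/\ uniq F, forall x, x \in F -> (0 < a x)%R &
    (A - e < \sum_(x <- F) a x)%R].
Proof.
move=> a0 e0 hA.
have : (A - e)%:E < \esum_(x in setT) (a x)%:E by rewrite hA lte_fin ltrBlDr ltrDl.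
move=> /ereal_sup_gt[_ [F [finF _]] <-].
rewrite fsbig_finite//= sumEFin lte_fin => h.
set s := finmap.enum_fset (fset_set F) in h.
exists [seq x <- s | (0 < a x)%R]; split.
- by apply: filter_uniq; exact: finmap.fset_uniq.
- by move=> x; rewrite mem_filter => /andP[].
- rewrite big_filter big_mkcond/=; apply: lt_le_trans h _.
  apply: ler_sum => x _; case: ifPn => //; rewrite -leNgt => h.
  exact: h.
Qed.

End FiniteParts.

(** * Failure probability of detours *)

Section GoodProbability.
Context {R : realType} {X : choiceType} {G : set (X -> X)}.
Hypothesis G1 : G id.
Hypothesis GM : forall f g, G f -> G g -> G (f \o g).
Variables (mu : (X -> X) -> R) (mu_ : nat -> (X -> X) -> R).
Hypothesis pmu : prob_on G mu.
Hypothesis pmu_ : forall i, prob_on G (mu_ i).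
Hypothesis cmu : forall f, (fun i => mu_ i f) @ \oo --> mu f.
Variable good : seq (X -> X) -> (X -> X) -> (X -> X) -> Prop.
Hypothesis good_shift : forall (V V' : seq (X -> X)) (z w' w : X -> X),
  (forall v, v \in V' -> w' \o v \in V) -> good V' (z \o w') w -> good V z w.
Local Open Scope ereal_scope.

(** Uniform tightness: a finite set that carries almost all of the limit law keeps its mass, and all
    total masses are one. *)
Lemma tail_seq l (e : R) : (0 < e)%R -> exists F : seq (X -> X),
  (forall w, w \in F -> G w) /\ \forall i \near \oo,
    E (conv_pow G (mu_ i) l) (fun w => ind (w \notin F)) <= e%:E.
Proof.
move=> e0; have pl := conv_pow_prob G1 GM l pmu.
have pl_ i := conv_pow_prob G1 GM l (pmu_ i).
have e2 : (0 < e / 2)%R by rewrite divr_gt0.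
have tot (p : (X -> X) -> R) : prob_on G p -> \esum_(x in setT) (p x)%:E = 1%R%:E.
  move=> pp; rewrite -(prob_pmf pp).2; apply: eq_esum => x _; by rewrite mule1.
have [F [uF Fp hF]] := finite_part (prob_ge0 pl) e2 (tot _ pl).
exists F; split; first by move=> w /Fp h; apply: (prob_supp pl); rewrite gt_eqF.
have cF : (fun i => \sum_(x <- F) conv_pow G (mu_ i) l x)%R @ \oo -->
    (\sum_(x <- F) conv_pow G mu l x)%R.
  by apply: cvg_big => [|x _]; [exact: add_continuous|exact: (conv_pow_cvg G1 GM)].
have := cvgr_low cF e2; apply: filterS => i hi.
have := @esum_split_seq R _ F (conv_pow G (mu_ i) l) uF (prob_ge0 (pl_ i)).
rewrite tot// => h.
have : 0 <= E (conv_pow G (mu_ i) l) (fun w => ind (w \notin F)).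
  by apply: E_ge0 => [|x]; [exact: (prob_ge0 (pl_ i))|exact: ind_ge0].
move: h; case: (E _ _) => [r| |] //= [h] _; rewrite lee_fin; lra.
Qed.

(** Uniformity in the past [z] lets the first letters of the future be moved into the past; the list
    [V] may depend on [B]. *)
Definition admissible (B : R) := (0 <= B)%R /\ exists V : seq (X -> X),
  (forall v, v \in V -> G v) /\ exists n0 : nat, \forall i \near \oo,
   forall n z, (n0 <= n)%N -> G z ->
   E (conv_pow G (mu_ i) n) (fun y => ind (~ good V z (z \o y))) <= B%:E.

Lemma admissible1 : admissible 1.
Proof.
split=> //; exists [::]; split=> //; exists 0%N; near=> i => n z _ _.
apply: E_le => //; first exact: (prob_pmf (conv_pow_prob G1 GM n (pmu_ i))).
by move=> x _; exact: ind_le1.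
Unshelve. all: by end_near. Qed.

Lemma sum_ind_le1 n (P : nat -> Prop) :
  (forall i j, (i < j)%N -> (j < n)%N -> P i -> ~ P j) ->
  \sum_(i < n) @ind R (P i) <= 1.
Proof.
elim: n => [|n IH] h; first by rewrite big_ord0.
rewrite big_ord_recr/=.
have [Pn|Pn] := pselect (P n).
  rewrite big1 ?add0e ?ind_le1// => i _.
  by rewrite ind0// => Pi; exact: (h i n (ltn_ord i) (ltnSn n) Pi Pn).
by rewrite (ind0 Pn) adde0; apply: IH => i j ij jn; apply: h => //; exact: ltnW.
Qed.

Hypothesis words : forall n, exists l (sw pv : nat -> X -> X) (Bp Bf : nat -> (X -> X) -> Prop),
  [/\ forall i, G (pv i) /\ G (sw i),
      forall i, (i < n)%N -> (0 < conv_pow G mu l (sw i))%R,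
      forall i j z, (i < j)%N -> (j < n)%N -> Bp i z -> ~ Bp j z,
      forall i j z, (i < j)%N -> (j < n)%N -> Bf i z -> ~ Bf j z &
      forall i z y, G z -> ~ Bp i z -> ~ Bf i y ->
        good [:: pv i] z (z \o (sw i \o y))].

(* Split off mass [alpha] at each of [n] Schottky words.  Altogether these fail
   with probability at most [B + 1] instead of [n * B], since the past spoils at
   most one of them and so does the future. *)
Lemma admissible_step n : exists alpha : R, (0 < alpha)%R /\ (alpha * n%:R <= 1)%R /\
  forall B e : R, (0 < e)%R -> admissible B ->
    admissible ((1 - alpha * n%:R) * B + alpha * (B + 1) + e)%R.
Proof.
have [l [sw [pv [Bp [Bf [Gs psw uBp uBf pass]]]]]] := words n.
have [a [a0 ha]] : exists a : R, (0 < a)%R /\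
    \forall i \near \oo, forall j, (j < n)%N -> (a <= conv_pow G (mu_ i) l (sw j))%R.
  elim: n psw {uBp uBf pass} => [|m IH] psw.
    by exists 1%R; split=> //; near=> i.
  have [a [a0 ha]] := IH (fun i im => psw i (ltnW im)).
  have pm := psw m (ltnSn m); have pm2 : (0 < conv_pow G mu l (sw m) / 2)%R by rewrite divr_gt0.
  exists (Num.min a (conv_pow G mu l (sw m) / 2))%R; split; first by rewrite lt_min a0.
  have := cvgr_low (conv_pow_cvg G1 GM (n := l) (f := sw m) pmu_ pmu cmu) pm2.
  apply: filterS2 ha => i hi hm j; rewrite ltnS leq_eqVlt => /predU1P[->|jm].
    by rewrite ge_min; apply/orP; right; lra.
  by rewrite ge_min hi.
have n1 : (0 < n.+1%:R :> R)%R by rewrite ltr0n.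
(* The words need not be distinct, so even [alpha * n] must stay below their least mass [a]; [n.+1]
   avoids a division by zero. *)
have [alpha [alpha0 an1 ana]] : exists alpha : R,
    [/\ 0 < alpha, alpha * n.+1%:R <= 1 & alpha * n.+1%:R <= a]%R.
  exists (Num.min a 1 / n.+1%:R)%R; split.
  - by rewrite divr_gt0// lt_min a0/=.
  - by rewrite divfK ?gt_eqF// ge_min lexx orbT.
  - by rewrite divfK ?gt_eqF// ge_min lexx.
have nn1 : (alpha * n%:R <= alpha * n.+1%:R)%R by rewrite ler_pM2l// ler_nat.
exists alpha; split=> //; split; first exact: le_trans an1.
move=> B e e0 [B0 [V0 [V0G [n0 hV0]]]].
have an0 : (0 <= 1 - alpha * n%:R)%R by rewrite subr_ge0 (le_trans nn1).
split.
  have := mulr_ge0 an0 B0; have := mulr_ge0 (ltW alpha0) B0; lra.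
have [F [FG hF]] := tail_seq l e0.
pose F' := F ++ [seq sw i | i <- iota 0 n].
(* When an initial part [w] of the future joins the past, a detour [v] becomes [w \o v]; the pivots
   serve the detours made by the words themselves. *)
pose V := [seq w \o v | w <- F', v <- V0] ++ [seq pv i | i <- iota 0 n].
exists V; split.
  move=> v; rewrite mem_cat => /orP[/allpairsP[[w u]/= [wF uV ->]]|/mapP[i _ ->]]; last exact: (Gs i).1.
  apply: GM; last exact: V0G.
  by move: wF; rewrite mem_cat => /orP[/FG//|/mapP[i _ ->]]; exact: (Gs i).2.
exists (l + n0)%N.
apply: filterS3 ha hF hV0 => i hi hFi hV0i m z ln Gz.
have -> : m = (l + (m - l))%N by rewrite subnKC// (leq_trans _ ln)// leq_addr.
have mn0 : (n0 <= m - l)%N by rewrite leq_subRL// (leq_trans _ ln)// leq_addr.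
move: (m - l)%N mn0 => {ln}m mn0.
have pl := conv_pow_prob G1 GM l (pmu_ i); have pm := conv_pow_prob G1 GM m (pmu_ i).
have pl0 := prob_ge0 pl; have pm0 := prob_ge0 pm.
rewrite (conv_powD G1 GM)//; last by move=> x; exact: ind_ge0.
pose Phi (w : X -> X) :=
  E (conv_pow G (mu_ i) m) (fun y => @ind R (~ good V z (z \o (w \o y)))).
rewrite -[leLHS]/(E (conv_pow G (mu_ i) l) Phi).
have Phi0 w : 0 <= Phi w by apply: E_ge0 => // y; exact: ind_ge0.
have Phi1 w : Phi w <= 1.
  by apply: E_le => //; [exact: prob_pmf pm|move=> y _; exact: ind_le1].
have PhiF w : G w -> w \in F' -> Phi w <= B%:E.
  move=> Gw wF; apply: le_trans (hV0i m (z \o w) mn0 (GM Gz Gw)).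
  apply: le_E => // y _; apply: le_ind; apply: contra_not; apply: good_shift.
  by move=> v vV0; rewrite mem_cat; apply/orP; left; apply/allpairsP; exists (w, v).
pose b j := E (conv_pow G (mu_ i) m) (fun y => ind (Bf j y)).
have b0 j : 0 <= b j by apply: E_ge0 => // y; exact: ind_ge0.
(* If the past spoils word [j], the general bound [B] remains; otherwise only the future can spoil
   it. *)
have Phisw j : (j < n)%N -> Phi (sw j) <= B%:E * ind (Bp j z) + b j.
  move=> jn; have jF : sw j \in F'.
    by rewrite mem_cat; apply/orP; right; apply: map_f; rewrite mem_iota.
  have [Bpj|Bpj] := pselect (Bp j z).
    by rewrite (ind1 Bpj) mule1 (le_trans (PhiF _ (Gs j).2 jF))// leeDl.
  rewrite (ind0 Bpj) mule0 add0e; apply: le_E => // y _; apply: le_ind.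
  apply: contra_notP => nB; apply: (good_shift (V' := [:: pv j]) (w' := id)).
    move=> v; rewrite inE => /eqP ->; rewrite mem_cat; apply/orP; right.
    by apply: map_f; rewrite mem_iota.
  exact: pass.
have sumPhi : \sum_(j < n) Phi (sw j) <= (B + 1)%:E.
  apply: (@le_trans _ _ (\sum_(j < n) (B%:E * ind (Bp j z) + b j))).
    by apply: lee_sum => j _; exact: Phisw.
  rewrite big_split/= EFinD leeD//.
    rewrite -ge0_sume_distrr; last by move=> j _; exact: ind_ge0.
    rewrite -[leRHS]mule1 lee_wpmul2l ?lee_fin//.
    by apply: (@sum_ind_le1 n (fun j => Bp j z)) => j k jk kn; exact: uBp.
  have -> : \sum_(j < n) b j = E (conv_pow G (mu_ i) m) (fun y => \sum_(j < n) ind (Bf j y)).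
    rewrite /E -esum_sum.
      by apply: eq_esum => y _; rewrite ge0_sume_distrr// => j _; exact: ind_ge0.
    by move=> y j _ _; rewrite mule_ge0 ?lee_fin ?ind_ge0.
  apply: E_le => //; first exact: prob_pmf pm.
  by move=> y _; apply: (@sum_ind_le1 n (fun j => Bf j y)) => j k jk kn; exact: uBf.
pose r w := (conv_pow G (mu_ i) l w - \sum_(j < n) (if `[< w = sw j >] then alpha else 0))%R.
have r0 w : (0 <= r w)%R.
  rewrite /r subr_ge0.
  have [[j [jn ej]]|nj] := pselect (exists j, (j < n)%N /\ w = sw j).
    rewrite ej; apply: le_trans (hi j jn); apply: le_trans ana; apply: le_trans nn1.
    rewrite -[leRHS](_ : \sum_(j < n) alpha = _)%R; last by rewrite sumr_const card_ord mulr_natr.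
    by apply: ler_sum => k _; case: ifP => // _; exact: ltW.
  rewrite big1 ?pl0// => j _; rewrite ifF//; apply/asboolP => ej; apply: nj.
  by exists j.
have decomp (f : (X -> X) -> \bar R) : (forall w, 0 <= f w) ->
    E (conv_pow G (mu_ i) l) f = E r f + \sum_(j < n) alpha%:E * f (sw j).
  move=> f0.
  have -> : \sum_(j < n) alpha%:E * f (sw j) =
      E (fun w => \sum_(j < n) (if `[< w = sw j >] then alpha else 0))%R f.
    rewrite /E (eq_bigr (fun j : 'I_n => \esum_(w in setT)
       ((if `[< w = sw j >] then alpha else 0)%:E * f w))).
      rewrite -esum_sum.
        apply: eq_esum => w _; rewrite -sumEFin ge0_sume_distrl// => j _.
        by case: ifP => // _; rewrite lee_fin ltW.
      by move=> w j _ _; rewrite mule_ge0//; case: ifP => // _; rewrite lee_fin ltW.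
    move=> j _; rewrite (@esum_eq1 _ _ (sw j)).
    - by rewrite ifT//; exact/asboolP.
    - by rewrite mule_ge0//; case: ifP => // _; rewrite lee_fin ltW.
    - by move=> w ws; rewrite ifF ?mul0e//; exact/asboolP.
  rewrite /E -esumD; last 2 first.
  - by move=> w _; rewrite mule_ge0 ?lee_fin.
  - move=> w _; rewrite mule_ge0// lee_fin sumr_ge0// => j _; case: ifP => // _.
    exact: ltW.
  apply: eq_esum => w _; rewrite -ge0_muleDl.
  - by rewrite -EFinD /r subrK.
  - by rewrite lee_fin.
  - rewrite lee_fin sumr_ge0// => j _; case: ifP => // _; exact: ltW.
rewrite decomp//.
have Er1 : E r (fun=> 1) = (1 - alpha * n%:R)%:E.
  have := decomp (fun=> 1) (fun=> lee01); rewrite (prob_pmf pl).2.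
  rewrite (eq_bigr (fun=> alpha%:E)) => [|j _]; last by rewrite mule1.
  rewrite sumEFin sumr_const card_ord -mulr_natr.
  have : 0 <= E r (fun=> 1) by apply: E_ge0.
  by case: (E r _) => [x| |] //= _ [h]; congr EFin; lra.
rewrite -ge0_sume_distrr; last by move=> j _; exact: Phi0.
apply: (@le_trans _ _ (((1 - alpha * n%:R) * B + e)%:E + (alpha * (B + 1))%:E)); last first.
  by rewrite -EFinD lee_fin; lra.
apply: leeD; last by rewrite EFinM lee_wpmul2l// lee_fin ltW.
(* Outside [F] failure is simply assumed; this has probability at most [e]. *)
apply: (@le_trans _ _ (E r (fun w => B%:E + ind (w \notin F)))).
  apply: le_E => // w rw; have plw : conv_pow G (mu_ i) l w != 0%R.
    rewrite gt_eqF// (lt_le_trans rw)// /r gerBl sumr_ge0// => j _.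
    by case: ifP => // _; exact: ltW.
  have [wF|wF] := boolP (w \in F).
    rewrite (@le_trans _ _ B%:E)//; last by rewrite leeDl// ind_ge0.
    by apply: PhiF; [exact: prob_supp plw|rewrite mem_cat wF].
  by rewrite ind1// (le_trans (Phi1 w))// leeDr// lee_fin.
rewrite ED//; last by move=> x; exact: ind_ge0.
rewrite E_cst// Er1 -EFinM EFinD mulrC leeD//.
apply: le_trans hFi; apply: le_esum => w _; rewrite lee_wpmul2r ?ind_ge0//.
rewrite lee_fin /r gerBl; apply: sumr_ge0 => j _; case: ifP => // _; exact: ltW.
Unshelve. all: by end_near. Qed.

Lemma good_probability (e : R) : (0 < e)%R -> exists V : seq (X -> X),
  (forall v, v \in V -> G v) /\ exists n0 : nat, \forall i \near \oo,
   forall n z, (n0 <= n)%N -> G z ->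
   E (conv_pow G (mu_ i) n) (fun y => ind (~ good V z (z \o y))) <= e%:E.
Proof.
move=> e0; pose S := [set B | admissible B].
have hS : has_inf S by split; [exists 1%R; exact: admissible1|exists 0%R => B []].
suff : (inf S <= 0)%R.
  move=> /le_lt_trans/(_ e0) /(inf_lt hS.1)[B [B0 [V [VG [n0 h]]]] Be].
  exists V; split=> //; exists n0; apply: filterS h => i h n z nn Gz.
  by apply: le_trans (h n z nn Gz) _; rewrite lee_fin ltW.
rewrite leNgt; apply/negP => Q0.
set Q := inf S in Q0.
pose n := (Num.truncn (1 / Q)%R).+2.
have nQ : (1 + Q < n%:R * Q)%R.
  have : (1 / Q < (Num.truncn (1 / Q)%R).+1%:R)%R by exact: truncnS_gt.
  by rewrite ltr_pdivrMr// /n -[in X in _ -> X]natr1 mulrDl mul1r; lra.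
have [alpha [a0 [an step]]] := admissible_step n.
(* With this [eta], a step from some [B < Q + eta] yields an admissible bound of at most
   [Q - 2 * eta]. *)
pose eta := (alpha * (n%:R * Q - Q - 1) / 4)%R.
have eta0 : (0 < eta)%R by rewrite divr_gt0// mulr_gt0//; lra.
have [B SB BQ] := inf_adherent eta0 hS.
have := step B eta eta0 SB => SB'.
have : (Q <= (1 - alpha * n%:R) * B + alpha * (B + 1) + eta)%R.
  by apply: ge_inf; [exists 0%R => ? []|].
have n1 : (1 <= n%:R :> R)%R by rewrite ler1n.
have h1 : ((1 - alpha * n%:R + alpha) * B <= (1 - alpha * n%:R + alpha) * (Q + eta))%R.
  by rewrite ler_wpM2l ?(ltW BQ)//; lra.
have h2 : ((1 - alpha * n%:R + alpha) * eta <= eta)%R.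
  rewrite ler_piMl ?(ltW eta0)//; have : (alpha <= alpha * n%:R)%R by rewrite ler_peMr// ltW.
  lra.
have h3 : (4 * eta = alpha * (n%:R * Q - Q - 1))%R by rewrite /eta; field.
move=> h4; have : (0 < alpha * (n%:R * Q - Q - 1))%R by rewrite mulr_gt0//; lra.
lra.
Qed.

End GoodProbability.

(** * Coding the walk *)

Section Encoding.
Context {R : realType} {X : choiceType}.
Variables (d : X -> X -> R) (o : X) (G : set (X -> X)).
Hypothesis dxx : d o o = 0.
Hypothesis Giso : forall z x y, G z -> d (z x) (z y) = d x y.
Hypothesis G1 : G id.
Hypothesis GM : forall f h, G f -> G h -> G (f \o h).

Definition sg (b : bool) : R := if b then 1 else -1.

(* [(x, v, b)]: estimated location of the last reliable position, product of the
   steps recorded since then, and direction in which these steps moved. *)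
Definition dstep (st : R * (X -> X) * bool) (a : option ((X -> X) * bool)) :=
  let: (x, v, b) := st in
  if a is Some (y, b') then (x, v \o y, b') else (x + sg b * d o (v o), id, b).

Definition decode := foldl dstep (0, id, true).

Lemma decode_rcons c a : decode (rcons c a) = dstep (decode c) a.
Proof. by rewrite /decode foldl_rcons. Qed.

Definition recorded (F : pred (X -> X)) (gd : nat -> Prop) (s : seq (X -> X)) t :=
  ~ [/\ gd t, gd t.+1 & F (nth id s t)].

(** The estimated location may drift by [L + 2 * C] per step. An unrecorded step joins two good
    times and moves by at most [L], so the location predicted for the earlier time serves for the
    later one. Recorded steps accumulate in [v] and act on the location through a distance and a
    sign. The element [z] is not computed from the code; it is to be found near the estimate. *)
Lemma encode Loc C Q (F : pred (X -> X)) (L : R) (gd : nat -> Prop) s :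
  locator d o G Loc C Q -> 0 <= L -> 0 <= C ->
  (forall x, F x -> d o (x o) <= L) -> (forall x, x \in s -> G x) ->
  (forall t, (t <= size s)%N -> gd t ->
     exists x x', Loc (prodc (take t s)) x x') ->
  exists c, [/\ size c = size s,
    forall t, (t < size s)%N -> nth None c t = None \/
      (recorded F gd s t /\ exists b, nth None c t = Some (nth id s t, b)) &
    exists z, [/\ G z, prodc s = z \o (decode c).1.2 &
      exists x x', Loc z x x' /\
        `|x - (decode c).1.1| <= (L + 2 * C) * (size s)%:R]].
Proof.
move=> loc L0 C0 FL sG gdL; have [[s0' id0] rough _ _] := loc.
have lex t : exists x, (t <= size s)%N -> gd t -> exists x', Loc (prodc (take t s)) x x'.
  have [[ts gt]|h] := pselect ((t <= size s)%N /\ gd t).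
    by have [x [x' h]] := gdL t ts gt; exists x => _ _; exists x'.
  by exists 0 => ts gt; case: h.
have [loct hloc] := choice lex.
have GZ t : G (prodc (take t s)).
  have : forall x, x \in take t s -> G x by move=> x /mem_take /sG.
  by elim: (take t s) => [//|x r IH] h /=; apply: GM; [apply: h; exact: mem_head|apply: IH => y yr; apply: h; rewrite inE yr orbT].
suff inv t : (t <= size s)%N -> exists c, [/\ size c = t,
    forall u, (u < t)%N -> nth None c u = None \/
      (recorded F gd s u /\ exists b, nth None c u = Some (nth id s u, b)),
    exists z, [/\ G z, prodc (take t s) = z \o (decode c).1.2 &
      exists x x', Loc z x x' /\ `|x - (decode c).1.1| <= (L + 2 * C) * t%:R] &
    gd t -> `|(decode c).1.1 + sg (decode c).2 * d o ((decode c).1.2 o) - loct t|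
              <= (L + 2 * C) * t%:R + C].
  have [c [sc hc hz _]] := inv (size s) (leqnn _).
  by exists c; split=> //; rewrite take_size in hz.
elim: t => [_|t IH ts].
  exists [::]; split=> //=.
    exists id; split=> //; first by rewrite take0.
    by exists 0, s0'; rewrite subrr normr0 mulr0.
  move=> g0; have [x' hx'] := hloc 0%N (leq0n _) g0.
  rewrite take0 in hx'; have := rough _ _ _ _ _ _ id0 hx'.
  by rewrite /= dxx !mulr0 !add0r subr0 !normrN normr_id.
have [c [sc hc [z [Gz ez [x [x' [Lz hx]]]]] hb]] := IH (ltnW ts).
have ets : prodc (take t.+1 s) = prodc (take t s) \o nth id s t.
  by rewrite (take_nth id ts) prodc_rcons.
have step : (L + 2 * C) * t.+1%:R = (L + 2 * C) * t%:R + (L + 2 * C) by rewrite -natr1; ring.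
case: (decode c) (decode_rcons c) ez hx hb => -[xh v] b /= dr ez hx hb.
have nth_rc a u : (u < t.+1)%N -> nth None (rcons c a) u = if u == t then a else nth None c u.
  by rewrite ltnS leq_eqVlt nth_rcons sc => /predU1P[->|ut]; [rewrite ltnn eqxx|rewrite ut ltn_eqF].
have [[gt gt1 Fx]|rec] := pselect [/\ gd t, gd t.+1 & F (nth id s t)].
  exists (rcons c None); rewrite dr /=.
  have [y' hy'] := hloc t (ltnW ts) gt; have [w' hw'] := hloc t.+1 ts gt1.
  have close : `|loct t.+1 - (xh + sg b * d o (v o))| <= (L + 2 * C) * t.+1%:R.
    have := rough _ _ _ _ _ _ hy' hw'; rewrite ets /= Giso// => h.
    have {}h : `|loct t - loct t.+1| <= L + C.
      by have := FL _ Fx; move: h; rewrite ler_norml; lra.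
    by move: h (hb gt); rewrite step !ler_norml; lra.
  split.
  - by rewrite size_rcons sc.
  - move=> u ut; rewrite nth_rc//; case: eqVneq => [_|un]; first by left.
    by apply: hc; rewrite ltn_neqAle un -ltnS.
  - exists (prodc (take t.+1 s)); split=> //.
    by exists (loct t.+1), w'.
  - move=> _; rewrite dxx mulr0 addr0 distrC; lra.
(* The bit tells on which side of the last reliable location the new position lies; each recorded
   step overwrites it. *)
pose b' := x <= loct t.+1.
exists (rcons c (Some (nth id s t, b'))); rewrite dr /=.
split.
- by rewrite size_rcons sc.
- move=> u ut; rewrite nth_rc//; case: eqVneq => [->|un].
    by right; split=> //; exists b'.
  by apply: hc; rewrite ltn_neqAle un -ltnS.
- exists z; split=> //; first by rewrite ets ez.
  by exists x, x'; split=> //; rewrite step; lra.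
- move=> gt1; have [w' hw'] := hloc t.+1 ts gt1.
  have := rough _ _ _ _ _ _ Lz hw'; rewrite ets ez /= (Giso _ _ Gz) step.
  rewrite /sg /b' => h; move: hx h; rewrite !ler_norml.
  case: (leP x (loct t.+1)) => h1.
    rewrite ler0_norm; lra.
  rewrite gtr0_norm; lra.
Qed.

End Encoding.

(** * Random codes *)

Section Weights.
Context {R : realType} {T : choiceType}.
Variables (nu : T -> R) (th : R).
Hypothesis pnu : pmf nu.
Hypothesis th01 : 0 < th < 1.
Local Open Scope ereal_scope.
Let code := option (T * bool).

(** Law of one random symbol: nothing is recorded with probability [1 - th]; otherwise the step is
    drawn from [nu] and the bit by a fair coin. For small [th] an unrecorded step is almost free. *)
Definition cw (a : code) : R := if a is Some (x, _) then (th / 2 * nu x)%R else (1 - th)%R.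

(** Expectation over [k] independent symbols of law [cw]. *)
Fixpoint EC (k : nat) (f : seq code -> \bar R) : \bar R :=
  if k is k'.+1 then
    (1 - th)%:E * EC k' (fun s => f (None :: s)) +
    E nu (fun x => (th / 2)%:E * (EC k' (fun s => f (Some (x, true) :: s)) +
                                  EC k' (fun s => f (Some (x, false) :: s))))
  else f [::].

Let th0 : (0 <= th / 2)%R. Proof. by move: th01; lra. Qed.
Let th1 : (0 <= 1 - th)%R. Proof. by move: th01; lra. Qed.

Lemma EC_ge0 k f : (forall s, 0 <= f s) -> 0 <= EC k f.
Proof.
elim: k f => [|k IH] f f0 /=; first exact: f0.
rewrite adde_ge0// ?mule_ge0 ?lee_fin ?IH//.
apply: E_ge0 => [|x]; first exact: pmf_ge0.
by rewrite mule_ge0 ?lee_fin// adde_ge0// IH.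
Qed.

Lemma EC_le1 k f : (forall s, 0 <= f s) -> (forall s, f s <= 1) -> EC k f <= 1.
Proof.
elim: k f => [|k IH] f f0 f1 /=; first exact: f1.
rewrite [leRHS](_ : _ = (1 - th)%:E * 1 + th%:E); last by rewrite mule1 -EFinD subrK.
rewrite leeD//; first by rewrite lee_wpmul2l ?lee_fin// IH.
apply: E_le => //; first by move: th01; lra.
move=> x _; rewrite [leRHS](_ : _ = (th / 2)%:E * (1 + 1)).
  by rewrite lee_wpmul2l ?lee_fin// leeD// IH.
by rewrite -EFinD -EFinM; congr EFin; lra.
Qed.

Lemma EC_esum (J : choiceType) k (a : seq code -> J -> \bar R) :
  (forall s j, 0 <= a s j) ->
  \esum_(j in setT) EC k (a^~ j) = EC k (fun s => \esum_(j in setT) a s j).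
Proof.
elim: k a => [//|k IH] a a0 /=.
rewrite esumD; last 2 first.
- by move=> j _; rewrite mule_ge0 ?lee_fin// EC_ge0.
- move=> j _; apply: E_ge0 => [|x]; first exact: pmf_ge0.
  by rewrite mule_ge0 ?lee_fin// adde_ge0// EC_ge0.
rewrite esumZl//; last by move=> j; exact: EC_ge0.
rewrite IH//; congr (_ + _); rewrite -E_esum; last 2 first.
- exact: pmf_ge0.
- by move=> x j; rewrite mule_ge0 ?lee_fin// adde_ge0// EC_ge0.
apply: eq_E => x _; rewrite esumZl//; last by move=> j; rewrite adde_ge0// EC_ge0.
by rewrite esumD ?IH// => j _; exact: EC_ge0.
Qed.

Lemma EC_ge k f c : (forall s, 0 <= f s) -> size c = k ->
  (\prod_(a <- c) cw a)%:E * f c <= EC k f.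
Proof.
elim: k f c => [|k IH] f [|a c]//= f0 => [_|[ck]]; first by rewrite big_nil mul1e.
rewrite big_cons EFinM -muleA.
have rest0 : 0 <= E nu (fun x => (th / 2)%:E * (EC k (fun s => f (Some (x, true) :: s)) +
                                  EC k (fun s => f (Some (x, false) :: s)))).
  apply: E_ge0 => [|x]; first exact: pmf_ge0.
  by rewrite mule_ge0 ?lee_fin// adde_ge0// EC_ge0.
case: a => [[x b]|] /=; last first.
  rewrite (le_trans _ (leeDl _ rest0))// lee_wpmul2l ?lee_fin//.
  exact: (IH (fun s => f (None :: s))).
rewrite (le_trans _ (leeDr _ _))//; last by rewrite mule_ge0 ?lee_fin// EC_ge0.
apply: le_trans (E_ge1 x _ _) => /=; last 2 first.
- exact: pmf_ge0.
- by move=> y; rewrite mule_ge0 ?lee_fin// adde_ge0// EC_ge0.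
rewrite mulrC EFinM -muleA lee_wpmul2l ?lee_fin ?(pmf_ge0 pnu)// lee_wpmul2l ?lee_fin//.
have h b' := IH (fun s => f (Some (x, b') :: s)) c (fun=> f0 _) ck.
case: b; first by rewrite (le_trans (h true))// leeDl// EC_ge0.
by rewrite (le_trans (h false))// leeDr// EC_ge0.
Qed.

Lemma cw01 a : (0 <= cw a <= 1)%R.
Proof.
case: a => [[x b]|] /=; last by move: th01; lra.
have x0 := pmf_ge0 pnu x; have x1 := pmf_le1 x pnu.
by rewrite mulr_ge0//= mulr_ile1//; move: th01; lra.
Qed.

Lemma nlog_prod (c : seq code) :
  (0 <= \prod_(a <- c) cw a <= 1)%R /\
  nlog (\prod_(a <- c) cw a) = \sum_(a <- c) nlog (cw a).
Proof.
elim: c => [|a c [IH1 IH2]]; first by rewrite !big_nil ler01 lexx /nlog oner_eq0 ln1 oppr0.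
rewrite !big_cons nlogM ?cw01//; split; last by rewrite IH2.
have /andP[a0 a1] := cw01 a; have /andP[b0 b1] := IH1.
by rewrite mulr_ge0//= mulr_ile1.
Qed.

End Weights.

Section SumLemmas.
Context {R : realType}.
Local Open Scope ereal_scope.

Lemma esum_inj_le (I J : choiceType) (h : I -> J) (a : J -> \bar R) :
  injective h -> (forall w, 0 <= a w) ->
  \esum_(y in setT) a (h y) <= \esum_(w in setT) a w.
Proof.
move=> hi a0; rewrite -(@reindex_esum _ _ _ setT (range h) h a).
  rewrite esum_mkcond; apply: le_esum => w _; by case: ifP.
split; [by move=> y _; exists y|by move=> y y' _ _ /hi|by move=> w [y _ <-]; exists y].
Qed.

Lemma few_esum (I : choiceType) (P : nat) (A : I -> Prop) : (0 < P)%N -> few P A ->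
  \esum_(z in setT) ((P%:R^-1)%:E * @ind R (A z)) <= 1.
Proof.
move=> P0 [s [sP sA]]; have P0' : (0 < P%:R :> R)%R by rewrite ltr0n.
rewrite esumZl ?invr_ge0//; last by move=> z; exact: ind_ge0.
rewrite -(@lee_pmul2l _ P%:R%:E) ?lte_fin// muleA -EFinM divff ?gt_eqF// mul1e mule1.
apply: (@le_trans _ _ (\esum_(z in [set` undup s]) 1)).
  rewrite [leRHS]esum_mkcond; apply: le_esum => z _.
  have [Az|Az] := pselect (A z); last by rewrite ind0//; case: ifP.
  by rewrite ind1// ifT// inE /= mem_undup sA.
rewrite esum_fset//=.
rewrite -fsbig_seq ?undup_uniq// sumEFin lee_fin big_const_seq count_predT iter_addr addr0.
by rewrite ler_nat (leq_trans (size_undup _)).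
Qed.

End SumLemmas.

(** * Expected code length *)

Section CodingBound.
Context {R : realType} {X : choiceType} {G : set (X -> X)}.
Hypothesis G1 : G id.
Hypothesis GM : forall f g, G f -> G g -> G (f \o g).
Variables (nu : (X -> X) -> R) (th : R) (k m : nat).
Hypothesis pnu : prob_on G nu.
Hypothesis th01 : 0 < th < 1.
Local Open Scope ereal_scope.
Let code := option ((X -> X) * bool).
Let pk := conv_pow G nu k.
Let pm := conv_pow G nu m.

(** The first [k] steps are kept one by one, since they are to be encoded; of the other [m] only the
    product matters. *)
Definition EE (f : seq (X -> X) -> (X -> X) -> \bar R) := EP nu k (fun s => E pm (f s)).

Let Mnu : pmf nu := prob_pmf pnu.
Let Ppk : prob_on G pk := conv_pow_prob G1 GM k pnu.
Let Ppm : prob_on G pm := conv_pow_prob G1 GM m pnu.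
Let Mpk : pmf pk := prob_pmf Ppk.
Let Mpm : pmf pm := prob_pmf Ppm.
Let pm0 : forall x, (0 <= pm x)%R := prob_ge0 Ppm.
Let pk0 : forall x, (0 <= pk x)%R := prob_ge0 Ppk.

Lemma le_EE f h : (forall s y, size s = k -> all (fun x => (0 < nu x)%R) s ->
  (0 < pm y)%R -> f s y <= h s y) -> EE f <= EE h.
Proof. by move=> fh; apply: le_EP => // s sk ps; apply: le_E => // y py; exact: fh. Qed.

Lemma EED f h : (forall s y, 0 <= f s y) -> (forall s y, 0 <= h s y) ->
  EE (fun s y => f s y + h s y) = EE f + EE h.
Proof.
move=> f0 h0; rewrite /EE -EPD//; [|by move=> s; exact: E_ge0..].
by apply: eq_EP => s _; exact: ED.
Qed.

Lemma EEZl (c : R) f : (0 <= c)%R -> (forall s y, 0 <= f s y) ->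
  EE (fun s y => c%:E * f s y) = c%:E * EE f.
Proof.
move=> c0 f0; rewrite /EE -EPZl//; last by move=> s; exact: E_ge0.
by apply: eq_EP => s _; exact: EZl.
Qed.

Lemma EE_cst (c : \bar R) : 0 <= c -> EE (fun _ _ => c) = c.
Proof. by move=> c0; rewrite /EE (pmf_cste Mpm c0) EP_cst. Qed.

Lemma EE_sum n (a : nat -> seq (X -> X) -> (X -> X) -> \bar R) :
  (forall t s y, 0 <= a t s y) ->
  EE (fun s y => \sum_(t < n) a t s y) = \sum_(t < n) EE (a t).
Proof.
move=> a0; elim: n => [|n IH].
  rewrite big_ord0 -[RHS](EE_cst (lexx 0)); apply: eq_EP => s _; apply: eq_E => y _.
  by rewrite big_ord0.
rewrite big_ord_recr/= -IH -EED//; last by move=> s y; exact: sume_ge0.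
by apply: eq_EP => s _; apply: eq_E => y _; rewrite big_ord_recr.
Qed.

Lemma EE_nth t (f : (X -> X) -> \bar R) : (forall x, 0 <= f x) -> (t < k)%N ->
  EE (fun s _ => f (nth id s t)) = E nu f.
Proof.
move=> f0 tk; rewrite -[RHS](@EP_nth _ _ nu k t id f Mnu f0 tk).
by apply: eq_EP => s _; rewrite pmf_cste.
Qed.

(** Once the first [t] steps are fixed, the other [k - t + m] are independent of them, and a bound
    uniform in the past applies. *)
Lemma EE_suffix t (h : (X -> X) -> (X -> X) -> \bar R) (e : R) : (0 <= e)%R ->
  (t <= k)%N -> (forall z y, 0 <= h z y) ->
  (forall z, G z -> E (conv_pow G nu (k - t + m)) (h z) <= e%:E) ->
  EE (fun s y => h (prodc (take t s)) (prodc (drop t s) \o y)) <= e%:E.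
Proof.
move=> e0 tk h0 he; rewrite /EE -(subnKC tk) EP_cat.
rewrite -[leRHS](@EP_cst _ _ nu t e%:E Mnu)//.
apply: le_EP => // s st ps.
rewrite (@eq_EP _ _ _ _ _ (fun s' => E pm (fun y => h (prodc s) (prodc s' \o y)))) => [|s' _]; last first.
  by rewrite take_size_cat// drop_size_cat.
rewrite (@EP_prodc _ _ _ G1 GM _ _ (fun z => E pm (fun y => h (prodc s) (z \o y))))//; last first.
  by move=> z; exact: E_ge0.
rewrite -(conv_powD G1 GM)//; apply: he.
elim: s {st} ps => [//|x s IH] /= /andP[px ps].
by apply: GM; [apply: (prob_supp pnu); rewrite gt_eqF|exact: IH].
Qed.

(** [W z y] is what the decoder is told, and [rho] its law: the endpoint [z \o y] in
    [almost_additive], and only the trivial [y] of [m = 0] steps in [asymp_entropy_along]. *)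
Variables (W : (X -> X) -> (X -> X) -> X -> X) (rho : (X -> X) -> R).
Hypothesis Mrho : pmf rho.
Hypothesis Winj : forall z, G z -> injective (W z).
Variables (D : (X -> X) -> seq code -> (X -> X) -> Prop) (P : nat).
Hypothesis P0 : (0 < P)%N.
Hypothesis fewD : forall w c, few P (D w c).
Variable rec : nat -> seq (X -> X) -> (X -> X) -> Prop.
Hypothesis enc : forall s y, size s = k -> all (fun x => (0 < nu x)%R) s ->
  (0 < pm y)%R -> exists c : seq code, [/\ size c = k,
    D (W (prodc s) y) c (prodc s) &
    forall t, (t < k)%N -> nth None c t = None \/
      (rec t s y /\ exists b, nth None c t = Some (nth id s t, b))].

Let PV0 : (0 <= P%:R^-1 :> R)%R. Proof. by rewrite invr_ge0. Qed.

Definition qh w z : R :=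
  fine (EC nu th k (fun c => (P%:R^-1)%:E * ind (D w c z))).

Lemma qhE w z : (qh w z)%:E = EC nu th k (fun c => (P%:R^-1)%:E * ind (D w c z)) /\
  (0 <= qh w z <= 1)%R.
Proof.
have P1 : (P%:R^-1 <= 1 :> R)%R by rewrite invf_le1 ?ltr0n// ler1n.
have e0 s : 0 <= (P%:R^-1)%:E * @ind R (D w s z) by rewrite mule_ge0 ?ind_ge0 ?lee_fin.
have h0 : 0 <= EC nu th k (fun c => (P%:R^-1)%:E * ind (D w c z)) by exact: EC_ge0.
have h1 : EC nu th k (fun c => (P%:R^-1)%:E * ind (D w c z)) <= 1.
  apply: EC_le1 => // s; rewrite -[leRHS]mule1 lee_pmul ?ind_ge0 ?ind_le1 ?lee_fin//.
have e : (qh w z)%:E = EC nu th k (fun c => (P%:R^-1)%:E * ind (D w c z)).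
  by rewrite fineK// ge0_fin_numE// (le_lt_trans h1)// ltry.
by split=> //; rewrite -!lee_fin e h0.
Qed.

Lemma qh_sum w : \esum_(z in setT) (qh w z)%:E <= 1.
Proof.
under eq_esum do rewrite (qhE _ _).1.
rewrite EC_esum//; last by move=> s j; rewrite mule_ge0 ?ind_ge0 ?lee_fin.
apply: EC_le1 => // s; last exact: few_esum.
by apply: esum_ge0 => z _; rewrite mule_ge0 ?ind_ge0 ?lee_fin.
Qed.

Let rho01 w : (0 <= rho w <= 1)%R.
Proof. by rewrite (pmf_ge0 Mrho) pmf_le1. Qed.

(* The subprobability compared with [pk x pm] in Gibbs' inequality: draw
   [w = W z y] from [rho], then [z] by decoding a random code given [w]. *)
Let Qf z y : R := if `[< G z >] then (rho (W z y) * qh (W z y) z)%R else 0%R.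

Lemma Qf01 z y : (0 <= Qf z y <= 1)%R.
Proof.
rewrite /Qf; case: ifP => _; last by rewrite lexx ler01.
have [_ /andP[q0 q1]] := qhE (W z y) z.
have /andP[r0 r1] := rho01 (W z y).
by rewrite mulr_ge0//= mulr_ile1.
Qed.

Lemma Qf_sum : \esum_(z in setT) \esum_(y in setT) (Qf z y)%:E <= 1.
Proof.
have a0 z w : 0 <= (rho w)%:E * (qh w z)%:E.
  by rewrite mule_ge0 ?lee_fin; [|case/andP: (rho01 w)|case: (qhE w z) => _ /andP[]].
apply: (@le_trans _ _ (\esum_(z in setT) \esum_(w in setT) ((rho w)%:E * (qh w z)%:E))).
  apply: le_esum => z _; have [Gz|Gz] := pselect (G z); last first.
    rewrite esum1; first by apply: esum_ge0.
    by move=> y _; rewrite /Qf ifF//; exact/asboolP.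
  rewrite (_ : \esum_(y in setT) _ = \esum_(y in setT)
      ((fun w => (rho w)%:E * (qh w z)%:E) (W z y))).
    by apply: esum_inj_le => //; exact: Winj.
  by apply: eq_esum => y _; rewrite /Qf ifT//; exact/asboolP.
rewrite exchange_esum// -Mrho.2; apply: le_esum => w _.
rewrite esumZl; [|by case/andP: (rho01 w)|by move=> z; rewrite lee_fin; case: (qhE w z) => _ /andP[]].
by rewrite lee_wpmul2l ?lee_fin ?qh_sum//; case/andP: (rho01 w).
Qed.

Lemma nlog_Qf s y : size s = k -> all (fun x => (0 < nu x)%R) s -> (0 < pm y)%R ->
  nlog (qh (W (prodc s) y) (prodc s)) <=
  (ln P%:R)%:E + \sum_(t < k) ((- ln (1 - th))%:E +
    ind (rec t s y) * ((- ln (th / 2))%:E + nlog (nu (nth id s t)))).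
Proof.
move=> sk ps py; have [c [ck Dc hc]] := enc sk ps py.
set w := W _ _; set z := prodc s.
have [qe /andP[q0 q1]] := qhE w z.
have [c01 clog] := nlog_prod Mnu th01 c.
have P0' : (0 < P%:R :> R)%R by rewrite ltr0n.
have P1 : (P%:R^-1 <= 1 :> R)%R by rewrite invf_le1 ?ltr0n// ler1n.
have ge : (P%:R^-1 * \prod_(a <- c) cw nu th a <= qh w z)%R.
  rewrite -lee_fin qe.
  have := @EC_ge _ _ nu th Mnu th01 k (fun c => (P%:R^-1)%:E * ind (D w c z)) c _ ck.
  rewrite (ind1 Dc) mule1 mulrC => -> // s'; by rewrite mule_ge0 ?ind_ge0 ?lee_fin.
apply: le_trans (le_nlog _ ge) _; first by rewrite mulr_ge0//; case/andP: c01.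
rewrite nlogM ?PV0//.
rewrite leeD//; first by rewrite /nlog invr_eq0 gt_eqF// lee_fin lnV// opprK.
rewrite clog (big_nth None) ck big_mkord; apply: lee_sum => t _.
have A0 : 0 <= (- ln (1 - th))%:E by rewrite lee_fin oppr_ge0 ln_le0//; move: th01; lra.
have B0 : 0 <= (- ln (th / 2))%:E by rewrite lee_fin oppr_ge0 ln_le0//; move: th01; lra.
have n0 x : 0 <= nlog (nu x) by rewrite nlog_ge0// pmf_le1.
case: (hc t (ltn_ord t)) => [->|[rt [b ->]]] /=.
  rewrite {1}/nlog gt_eqF; last by move: th01; lra.
  by rewrite leeDl// mule_ge0 ?ind_ge0// adde_ge0.
rewrite (ind1 rt) mul1e nlogM; [|move: th01; lra|by rewrite (pmf_ge0 Mnu) pmf_le1].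
rewrite [nlog (th / 2)]/nlog gt_eqF; last by move: th01; lra.
by rewrite leeDr.
Qed.

Lemma coding_bound :
  entropy G pk + entropy G pm <=
  E pk (fun z => E pm (fun y => nlog (rho (W z y)))) + (ln P%:R)%:E +
  \sum_(t < k) EE (fun s y => (- ln (1 - th))%:E +
    ind (rec t s y) * ((- ln (th / 2))%:E + nlog (nu (nth id s t)))).
Proof.
have nq0 w z : 0 <= nlog (qh w z) by rewrite nlog_ge0//; case: (qhE w z) => _ /andP[].
have nr0 w : 0 <= nlog (rho w) by rewrite nlog_ge0//; case/andP: (rho01 w).
have A0 : 0 <= (- ln (1 - th))%:E by rewrite lee_fin oppr_ge0 ln_le0//; move: th01; lra.
have B0 : 0 <= (- ln (th / 2))%:E by rewrite lee_fin oppr_ge0 ln_le0//; move: th01; lra.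
have n0 x : 0 <= nlog (nu x) by rewrite nlog_ge0// pmf_le1.
rewrite !entropyE//; apply: le_trans (gibbs2 Mpk Mpm Qf01 Qf_sum) _.
have -> : E pk (fun x => E pm (fun y => nlog (Qf x y))) =
    E pk (fun z => E pm (fun y => nlog (rho (W z y)))) +
    E pk (fun z => E pm (fun y => nlog (qh (W z y) z))).
  rewrite -ED//; [|by move=> z; exact: E_ge0..].
  apply: eq_E => z pz; rewrite -ED//; apply: eq_E => y _.
  rewrite /Qf ifT ?nlogM ?rho01//; first by case: (qhE (W z y) z).
  by apply/asboolP; exact: (prob_supp Ppk pz).
rewrite -addeA leeD// -(@EP_prodc _ _ _ G1 GM _ _ (fun z => E pm (fun y => nlog (qh (W z y) z))))//; last first.
  by move=> z; exact: E_ge0.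
rewrite -/(EE (fun s y => nlog (qh (W (prodc s) y) (prodc s)))).
apply: (le_trans (le_EE nlog_Qf)).
have t0 t s y : 0 <= (- ln (1 - th))%:E + ind (rec t s y) * ((- ln (th / 2))%:E + nlog (nu (nth id s t))).
  by rewrite adde_ge0// mule_ge0 ?ind_ge0// adde_ge0.
rewrite EED; [|by move=> _ _; rewrite lee_fin ln_ge0// ler1n|by move=> s y; exact: sume_ge0].
rewrite EE_cst ?lee_fin ?ln_ge0 ?ler1n//.
rewrite (@EE_sum k (fun t s y => (- ln (1 - th))%:E +
    ind (rec t s y) * ((- ln (th / 2))%:E + nlog (nu (nth id s t)))))//.
Qed.

Variables (F : pred (X -> X)) (bad : nat -> seq (X -> X) -> (X -> X) -> Prop).
Variables (e1 e2 e3 BF : R).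
Hypothesis BF0 : (0 <= BF)%R.
Hypothesis recP : forall t s y, rec t s y ->
  ~~ F (nth id s t) \/ bad t s y \/ bad t.+1 s y.
Hypothesis h1 : E nu (fun x => ind (~~ F x)) <= e1%:E.
Hypothesis h2 : E nu (fun x => ind (~~ F x) * nlog (nu x)) <= e2%:E.
Hypothesis h3 : forall x, F x -> nlog (nu x) <= BF%:E.
Hypothesis h4 : forall t, (t <= k)%N -> EE (fun s y => ind (bad t s y)) <= e3%:E.

(** A step outside [F] pays its own [nlog], in total the tail [e2]. A step of [F] is recorded only
    next to a bad time and pays at most [BF]; so the probability of a bad time, which is not
    independent of the step, only meets a bounded cost. The factor [2] stands for the times [t] and
    [t.+1]. *)
Lemma coding_cost :
  entropy G pk + entropy G pm <=
  E pk (fun z => E pm (fun y => nlog (rho (W z y)))) +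
  (ln P%:R + k%:R * (- ln (1 - th) + (- ln (th / 2)) * e1 + e2 +
     2 * (- ln (th / 2) + BF) * e3))%:E.
Proof.
apply: (le_trans coding_bound); rewrite EFinD addeA leeD2l//.
set B0 := (- ln (th / 2))%R; set A := (- ln (1 - th))%R.
have A0 : (0 <= A)%R by rewrite oppr_ge0 ln_le0//; move: th01; lra.
have B00 : (0 <= B0)%R by rewrite oppr_ge0 ln_le0//; move: th01; lra.
have n0 x : 0 <= nlog (nu x) by rewrite nlog_ge0// pmf_le1.
apply: (@le_trans _ _ (\sum_(t < k) (A + B0 * e1 + e2 + 2 * (B0 + BF) * e3)%:E)); last first.
  by rewrite sumEFin sumr_const card_ord -[X in X%:E <= _]mulr_natl.
apply: lee_sum => -[t tk] _ /=.
apply: (@le_trans _ _ (EE (fun s y => A%:E + (B0%:E * ind (~~ F (nth id s t)) +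
   ind (~~ F (nth id s t)) * nlog (nu (nth id s t))) +
   ((B0 + BF)%:E * ind (bad t s y) + (B0 + BF)%:E * ind (bad t.+1 s y))))).
  apply: le_EE => s y _ _ _.
  have BB0 : 0 <= (B0 + BF)%:E by rewrite lee_fin addr_ge0.
  have m0 Q : 0 <= (B0 + BF)%:E * @ind R Q by rewrite mule_ge0 ?ind_ge0.
  have m1 Q : 0 <= B0%:E * @ind R Q by rewrite mule_ge0 ?ind_ge0.
  have m2 Q x : 0 <= @ind R Q * nlog (nu x) by rewrite mule_ge0 ?ind_ge0.
  have [r|r] := pselect (rec t s y); last first.
    by rewrite (ind0 r) mul0e adde0 -addeA leeDl// adde_ge0// adde_ge0.
  rewrite (ind1 r) mul1e -addeA leeD2l//.
  have [Fx|Fx] := boolP (F (nth id s t)); last first.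
    by rewrite [ind (~~ false)]ind1// mule1 mul1e leeDl// adde_ge0.
  rewrite ind0// mule0 mul0e !add0e.
  apply: (@le_trans _ _ (B0 + BF)%:E); first by rewrite EFinD leeD2l// h3.
  case: (recP r) => [|[b|b]]; first by rewrite Fx.
    by rewrite (ind1 b) mule1 leeDl.
  by rewrite (ind1 b) mule1 leeDr.
have i0 (Q : seq (X -> X) -> (X -> X) -> Prop) s y : 0 <= @ind R (Q s y) by exact: ind_ge0.
rewrite !EED; try by move=> *; rewrite ?adde_ge0 ?mule_ge0 ?ind_ge0 ?lee_fin ?addr_ge0.
rewrite EE_cst ?lee_fin// !EEZl ?addr_ge0//; [|by move=> *; exact: ind_ge0..].
rewrite (@EE_nth t (fun x => ind (~~ F x)))//; last by move=> x; exact: ind_ge0.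
rewrite (@EE_nth t (fun x => ind (~~ F x) * nlog (nu x)))//; last first.
  by move=> x; rewrite mule_ge0 ?ind_ge0.
have -> : (A + B0 * e1 + e2 + 2 * (B0 + BF) * e3)%:E =
   A%:E + (B0%:E * e1%:E + e2%:E) + ((B0 + BF)%:E * e3%:E + (B0 + BF)%:E * e3%:E).
  by rewrite -!EFinM -!EFinD; congr EFin; lra.
rewrite leeD//; first by rewrite leeD2l// leeD// lee_wpmul2l.
by rewrite leeD// lee_wpmul2l ?lee_fin ?addr_ge0// h4// ltnW.
Qed.

End CodingBound.

(** * Almost additivity of entropy *)

Lemma seq_bound {R : realType} (T : eqType) (f : T -> R) (F : seq T) :
  exists B : R, 0 <= B /\ forall x, x \in F -> f x <= B.
Proof.
elim: F => [|y F [B [B0 IH]]]; first by exists 0.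
exists (B + `|f y|); split; first by rewrite addr_ge0.
move=> x; rewrite inE => /predU1P[->|/IH xB].
  by rewrite (le_trans (ler_norm _))// lerDr.
by rewrite (le_trans xB)// lerDl.
Qed.

(** [expR (e * k%:R)] is at least [(e * k%:R / 2) ^+ 2], which exceeds [B * k%:R] once [k] is above
    [4 * B / e ^+ 2]. *)
Lemma ln_affine_le {R : realType} (a M : nat) (e : R) : 0 < e ->
  exists2 k, (0 < k)%N & ln (((2 * (a * k)).+1 * M.+1)%N%:R : R) <= e * k%:R.
Proof.
move=> e0; pose B : R := ((2 * a).+1 * M.+1)%N%:R.
have [k k0 kB] : exists2 k, (0 < k)%N & 4 * B / e ^+ 2 < k%:R.
  by exists (Num.truncn (4 * B / e ^+ 2)).+1 => //; exact: truncnS_gt.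
exists k => //; have k1 : 1 <= k%:R :> R by rewrite ler1n.
have ek0 : 0 <= e * k%:R by rewrite mulr_ge0// ltW.
have P0 : 0 < ((2 * (a * k)).+1 * M.+1)%N%:R :> R by rewrite ltr0n.
have PB : ((2 * (a * k)).+1 * M.+1)%N%:R <= B * k%:R :> R.
  rewrite /B -natrM ler_nat mulnAC leq_mul2r; apply/orP; right.
  by rewrite [((2 * a).+1 * k)%N]mulSn mulnA -[X in (X < _)%N]add0n ltn_add2r.
rewrite -[leRHS]expRK ler_ln ?posrE ?expR_gt0//; apply: (le_trans PB).
have -> : expR (e * k%:R) = expR (e * k%:R / 2) ^+ 2.
  by rewrite expr2 -expRD; congr expR; lra.
have h : e * k%:R / 2 <= expR (e * k%:R / 2) by have := expR_ge1Dx (e * k%:R / 2); lra.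
apply: (@le_trans _ _ ((e * k%:R / 2) ^+ 2)); last first.
  by rewrite lerXn2r// nnegrE ?expR_ge0// divr_ge0.
have -> : (e * k%:R / 2) ^+ 2 = (e ^+ 2 * k%:R / 4) * k%:R by field.
rewrite ler_wpM2r//; move: kB; rewrite ltr_pdivrMr ?exprn_gt0//; lra.
Qed.

(** * Uniform entropy tails *)

Section Tails.
Context {R : realType} {X : choiceType} {G : set (X -> X)}.
Variables (mu : (X -> X) -> R) (mu_ : nat -> (X -> X) -> R).
Hypothesis pmu : prob_on G mu.
Hypothesis pmu_ : forall i, prob_on G (mu_ i).
Hypothesis cmu : forall f, (fun i => mu_ i f) @ \oo --> mu f.
Hypothesis fmu : (entropy G mu < +oo)%E.
Hypothesis cH : (fun i => entropy G (mu_ i)) @ \oo --> entropy G mu.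
Local Open Scope ereal_scope.

(** The density [p * (1 + nlog p)] controls mass and entropy with one finite set. Eventually its
    total for [mu_ i] exceeds that for [mu] by at most [e / 3], while its sum over [F] falls short
    of the latter by at most [2 * e / 3]. *)
Lemma entropy_tail (e : R) : (0 < e)%R -> exists (F : seq (X -> X)) (BF : R),
  (0 <= BF)%R /\ \forall i \near \oo,
  [/\ E (mu_ i) (fun x => ind (x \notin F)) <= e%:E,
      E (mu_ i) (fun x => ind (x \notin F) * nlog (mu_ i x)) <= e%:E &
      forall x, x \in F -> nlog (mu_ i x) <= BF%:E].
Proof.
move=> e0; have e3 : (0 < e / 3)%R by rewrite divr_gt0.
pose a (p : (X -> X) -> R) x := (p x - p x * ln (p x))%R.
have nlogE (p : (X -> X) -> R) x : prob_on G p -> (a p x)%:E = (p x)%:E * (1 + nlog (p x)).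
  move=> pp; rewrite /a /nlog; have [->|px] := eqVneq (p x) 0%R.
    by rewrite mul0r subr0 mul0e.
  by rewrite -EFinD -EFinM; congr EFin; lra.
have n0 (p : (X -> X) -> R) x : prob_on G p -> 0 <= nlog (p x).
  by move=> pp; rewrite nlog_ge0// pmf_le1//; exact: (prob_pmf pp).
have a0 (p : (X -> X) -> R) x : prob_on G p -> (0 <= a p x)%R.
  by move=> pp; rewrite -lee_fin nlogE// mule_ge0 ?lee_fin ?(prob_ge0 pp)// adde_ge0// n0.
have sa (p : (X -> X) -> R) : prob_on G p -> \esum_(x in setT) (a p x)%:E = 1 + entropy G p.
  move=> pp; rewrite entropyE// -[X in X + _](prob_pmf pp).2 -ED; last 3 first.
  - exact: (prob_ge0 pp).
  - by [].
  - by move=> x; exact: n0.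
  by apply: eq_esum => x _; rewrite nlogE.
have ep : entropy G mu = (fine (entropy G mu))%:E by rewrite fineK// ge0_fin_numE// entropy_ge0.
set H := fine (entropy G mu) in ep.
have sH : \esum_(x in setT) (a mu x)%:E = (1 + H)%:E by rewrite sa// ep.
have [F [uF Fp hF]] := finite_part (fun x => a0 mu x pmu) e3 sH.
have Fmu x : x \in F -> (0 < mu x)%R.
  move=> /Fp; have := prob_ge0 pmu x; rewrite le_eqVlt => /predU1P[h|//].
  by rewrite /a -h mul0r subrr ltxx.
exists F.
have [BF [BF0 hBF]] : exists BF : R, (0 <= BF)%R /\ \forall i \near \oo,
    forall x, x \in F -> nlog (mu_ i x) <= BF%:E.
  elim: F Fmu {uF Fp hF} => [|y F IH] Fmu.
    by exists 0%R; split=> //; near=> i.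
  have [BF [BF0 hBF]] := IH (fun x xF => Fmu x (mem_behead (s := y :: F) xF)).
  have y0 := Fmu y (mem_head _ _); have y2 : (0 < mu y / 2)%R by rewrite divr_gt0.
  exists (BF + `|ln (mu y / 2)|)%R; split; first by rewrite addr_ge0.
  have := cvgr_low (@cmu y) y2; apply: filterS2 hBF => i hi hy x.
  rewrite inE => /predU1P[->|/hi xB]; last by rewrite (le_trans xB)// lee_fin lerDl.
  have hy' : (mu y / 2 < mu_ i y)%R by lra.
  rewrite /nlog gt_eqF ?(lt_trans y2)// lee_fin.
  have : (ln (mu y / 2) <= ln (mu_ i y))%R.
    by rewrite ler_ln ?posrE ?(ltW hy')// (lt_trans y2).
  have : (- ln (mu y / 2) <= `|ln (mu y / 2)|)%R by rewrite -normrN ler_norm.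
  lra.
exists BF; split=> //.
have cF : (fun i => \sum_(x <- F) a (mu_ i) x)%R @ \oo --> (\sum_(x <- F) a mu x)%R.
  have : forall x, x \in F -> (fun i => a (mu_ i) x) @ \oo --> a mu x.
    move=> x /Fmu x0; apply: cvgB => //; apply: cvgM => //.
    by apply: continuous_cvg => //; exact: continuous_ln.
  elim: (F) => [|y r IH] h; first by under eq_fun do rewrite big_nil; rewrite big_nil; exact: cvg_cst.
  under eq_fun do rewrite big_cons; rewrite big_cons; apply: cvgD.
    by apply: h; exact: mem_head.
  by apply: IH => x xr; apply: h; rewrite inE xr orbT.
have Hup : \forall i \near \oo, entropy G (mu_ i) < (H + e / 3)%:E.
  move: cH; rewrite ep => /fine_cvgP[fin /cvgrPdist_lt/(_ _ e3)].
  apply: filterS2 fin => i fi; rewrite /= ltr_distlC => /andP[_ h].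
  by rewrite -(fineK fi) lte_fin.
have := cvgr_low cF e3; apply: filterS3 hBF Hup => i hBi hHi hFi.
have pi := pmu_ i; have p0 := prob_ge0 pi.
have split := @esum_split_seq R _ F (a (mu_ i)) uF (fun x => a0 _ x pi).
have tail : E (a (mu_ i)) (fun x => ind (x \notin F)) =
    E (mu_ i) (fun x => ind (x \notin F)) + E (mu_ i) (fun x => ind (x \notin F) * nlog (mu_ i x)).
  rewrite -ED//; last 2 first.
  - by move=> x; exact: ind_ge0.
  - by move=> x; rewrite mule_ge0 ?ind_ge0// n0.
  apply: eq_esum => x _; rewrite nlogE// -muleA; congr (_ * _).
  by rewrite muleC ge0_muleDr ?mule1// n0.
have t1 : 0 <= E (mu_ i) (fun x => ind (x \notin F)).
  by apply: E_ge0 => // x; exact: ind_ge0.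
have t2 : 0 <= E (mu_ i) (fun x => ind (x \notin F) * nlog (mu_ i x)).
  by apply: E_ge0 => // x; rewrite mule_ge0 ?ind_ge0// n0.
have te : E (a (mu_ i)) (fun x => ind (x \notin F)) <= e%:E.
  have t0 : 0 <= E (a (mu_ i)) (fun x => ind (x \notin F)) by rewrite tail adde_ge0.
  have := entropy_ge0 pi; move: split hHi; rewrite sa//.
  case: (entropy G (mu_ i)) => [h| |]//; case: (E (a _) _) t0 => [r| |] //=.
  rewrite -!EFinD !lee_fin lte_fin => ? -[] ? ? ?; lra.
split=> //.
  by apply: le_trans te; rewrite tail leeDl.
by apply: le_trans te; rewrite tail leeDr.
Unshelve. all: by end_near. Qed.

End Tails.

(** * Decoding and choice of constants *)

Section Assembly.
Context {R : realType} {X : choiceType}.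
Variables (d : X -> X -> R) (o : X) (G : set (X -> X)) (g gi : X -> X) (K : R).
Hypothesis geoX : geodesic_space d.
Hypothesis Giso : forall f, G f -> Defs.isometry d f.
Hypothesis G1 : G id.
Hypothesis GM : forall f h, G f -> G h -> G (f \o h).
Hypothesis GV : forall f, G f -> exists f', G f' /\ f' \o f = id /\ f \o f' = id.
Hypothesis Gg : G g.
Hypothesis Ggi : G gi.
Hypothesis gK : gi \o g = id.
Hypothesis gK' : g \o gi = id.
Hypothesis axis : contracting_axis d K (fun i => zpow g gi i o).
Hypothesis wpd : forall K : R, 0 <= K -> exists N : nat, (0 < N)%N /\
    finite_set [set h | G h /\ d o (h o) <= K /\
                        d (iter N g o) (h (iter N g o)) <= K].
Variables (mu : (X -> X) -> R) (mu_ : nat -> (X -> X) -> R).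
Hypothesis pmu : prob_on G mu.
Hypothesis pmu_ : forall i, prob_on G (mu_ i).
Hypothesis cmu : forall f, (fun i => mu_ i f) @ \oo --> mu f.
Hypothesis fmu : (entropy G mu < +oo)%E.
Hypothesis cH : (fun i => entropy G (mu_ i)) @ \oo --> entropy G mu.

Lemma supp_prodc (nu : (X -> X) -> R) s : prob_on G nu ->
  all (fun x => 0 < nu x) s -> 0 < conv_pow G nu (size s) (prodc s).
Proof.
move=> pn; elim: s => [_|x s IH]; first by rewrite /= /dirac_id; case: pselect.
rewrite [all _ _]/= -[prodc (x :: s)]/(x \o prodc s) => /andP[px ps].
rewrite -[size (x :: s)]/(1 + size s)%N.
apply: (conv_pow_gt0 G1 GM) => //; last exact: IH.
rewrite -lte_fin massE; last exact: (prob_ge0 (conv_pow_prob G1 GM 1 pn)).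
rewrite (conv_pow1 G1)//; last by move=> y; exact: ind_ge0.
by rewrite -massE ?lte_fin//; exact: (prob_ge0 pn).
Qed.

Lemma supp_G (nu : (X -> X) -> R) s : prob_on G nu ->
  all (fun x => 0 < nu x) s -> forall x, x \in s -> G x.
Proof.
by move=> pn /allP ps x /ps h; apply: (prob_supp pn); rewrite gt_eqF.
Qed.

(** The positions compatible with a code: an element located within [b] of the estimate, followed by
    the steps recorded since. *)
Definition candidates (Loc : (X -> X) -> R -> R -> Prop) (b : R) c z' :=
  exists z, [/\ G z, z' = z \o (decode d o c).1.2 &
    exists x x', Loc z x x' /\ `|x - (decode d o c).1.1| <= b].

(** The successor keeps the count positive even if [Q = 0], so that its inverse can serve as a
    weight. *)
Lemma few_candidates Loc C Q (q : nat) b c : locator d o G Loc C Q -> C <= q%:R ->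
  few ((2 * b).+1 * ((2 * q + 1).+1 * Q).+1) (candidates Loc b%:R c).
Proof.
move=> loc Cq; apply: (@few_le _ ((2 * b).+1 * ((2 * q + 1).+1 * Q))).
  by rewrite leq_mul2l leqnSn orbT.
have := locator_few loc Cq (decode d o c).1.1 b.
move=> /few_image h; apply: (h _ _ (fun z => z \o (decode d o c).1.2)).
by move=> z' [z [Gz -> hz]]; exists z => //; split=> //; case: hz => x [x' hx]; exists x, x'.
Qed.

Lemma good_times_code Loc C Q (F : seq (X -> X)) (L : R) (q : nat) (gd : nat -> Prop) s :
  locator d o G Loc C Q -> 0 <= L -> 0 <= C -> L + 2 * C <= q%:R ->
  (forall x, x \in F -> d o (x o) <= L) -> (forall x, x \in s -> G x) ->
  (forall t, (t <= size s)%N -> gd t ->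
     exists x x', Loc (prodc (take t s)) x x') ->
  exists c, [/\ size c = size s, candidates Loc (q * size s)%N%:R c (prodc s) &
    forall t, (t < size s)%N -> nth None c t = None \/
      (recorded (fun x => x \in F) gd s t /\
       exists b, nth None c t = Some (nth id s t, b))].
Proof.
move=> loc L0 C0 Lq FL sG gdL.
have dxx := dist_xx geoX o.
have iso z x y : G z -> d (z x) (z y) = d x y by move=> /Giso[].
have [c [sc hc [z [Gz ez [x [x' [Lz hx]]]]]]] :=
  encode dxx iso G1 GM loc L0 C0 FL sG gdL.
exists c; split=> //; exists z; split=> //; exists x, x'; split=> //.
by rewrite (le_trans hx)// natrM ler_wpM2r.
Qed.

(** [th] makes an unrecorded step cost exactly [eta]; then [e] makes the rare steps cost another
    [eta]. *)
Lemma threshold_ex (eta : R) : 0 < eta -> exists th e : R,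
  [/\ 0 < th < 1, 0 < e & - ln (1 - th) + (- ln (th / 2)) * e + e <= 2 * eta].
Proof.
move=> eta0; pose th := 1 - expR (- eta).
have th0 : 0 < th by rewrite subr_gt0 -expR0 ltr_expR oppr_lt0.
have th1 : th < 1 by rewrite ltrBlDr ltrDl expR_gt0.
have B0 : 0 <= - ln (th / 2) by rewrite oppr_ge0 ln_le0//; lra.
exists th, (eta / (- ln (th / 2) + 1)); split; first by rewrite th0.
  by rewrite divr_gt0//; lra.
have -> : - ln (1 - th) = eta by rewrite /th opprB addrC subrK expRK opprK.
rewrite -addrA -[X in _ + (_ + X)]mul1r -mulrDl mulrC divfK; lra.
Qed.

Lemma asymp_entropy_along :
  (forall n z, 0 < conv_pow G mu n z -> forall c, ~ disperses d o g gi z c) ->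
  asymp_entropy G mu = 0%E.
Proof.
move=> nd.
have [h [eh h0 hle _]] := asymp_entropyP G1 GM pmu fmu.
suff : h <= 0 by rewrite eh => h0'; congr EFin; apply/eqP; rewrite eq_le h0 h0'.
apply/ler_addgt0Pl => eps eps0; rewrite addr0.
pose eta := eps / 4; have eta0 : 0 < eta by rewrite divr_gt0.
have [th [e [th01 e0 cost]]] := threshold_ex eta0.
have [F [BF [BF0 tails]]] := entropy_tail (mu_ := fun=> mu) pmu (fun=> pmu)
  (fun f => cvg_cst _) fmu (cvg_cst _) e0.
have [_ [t1 t2 t3]] := filter_ex tails.
have [Loc [C [Q [loc hloc]]]] := locator_along geoX Giso G1 GM GV axis wpd.
have C0 : 0 <= C.
  have [[s' l0] r _ _] := loc; exact: le_trans (normr_ge0 _) (r _ _ _ _ _ _ l0 l0).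
have [L [L0 FL]] := seq_bound (fun x : X -> X => d o (x o)) F.
have [q Lq] : exists q : nat, L + 2 * C <= q%:R.
  by exists (Num.truncn (L + 2 * C)).+1; exact/ltW/truncnS_gt.
have [k k0 hk] := ln_affine_le q ((2 * q + 1).+1 * Q) eta0.
have Cq : C <= q%:R by lra.
have alongS s : all (fun x => 0 < mu x) s -> exists x x', Loc (prodc s) x x'.
  move=> ps; have pp := supp_prodc pmu ps.
  have Gs : G (prodc s).
    by apply: (prob_supp (conv_pow_prob G1 GM (size s) pmu)); rewrite gt_eqF.
  by apply: hloc => //; apply: (along_of_not_disperses geoX Giso G1 GM GV Gg Ggi gK gK' axis wpd) => //; exact: nd pp.
have P0 : (0 < (2 * (q * k)).+1 * ((2 * q + 1).+1 * Q).+1)%N by [].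
have enc s y : size s = k -> all (fun x => 0 < mu x) s -> 0 < conv_pow G mu 0 y ->
    exists c, [/\ size c = k, candidates Loc (q * k)%N%:R c (prodc s) &
      forall t, (t < k)%N -> nth None c t = None \/
        (recorded (fun x => x \in F) (fun=> True) s t /\
         exists b, nth None c t = Some (nth id s t, b))].
  move=> sk ps _; rewrite -sk.
  apply: (good_times_code loc L0 C0 Lq FL (supp_G pmu ps)) => t _ _.
  by apply: alongS; move: ps; rewrite -{1}(cat_take_drop t s) all_cat => /andP[].
have recP t (s : seq (X -> X)) (y : X -> X) : recorded (fun x => x \in F) (fun=> True) s t ->
    nth id s t \notin F \/ False \/ False.
  by move=> r; left; apply/negP => xF; apply: r.
have h4 t : (t <= k)%N -> (EE (G := G) mu k 0 (fun s y => ind False) <= 0%:E)%E.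
  by move=> _; rewrite (ind0 (fun x => x)) EE_cst.
(* There is no future and no bad time, and the decoder is told only [id], of law [dirac_id]; so the
   code alone bounds the entropy, by [3 * eta] per step. *)
have := @coding_cost R X G G1 GM mu th k 0 pmu th01 (fun _ y => y) (@dirac_id R X)
  (prob_pmf (dirac_prob G1)) (fun _ _ _ _ => id) (fun _ c => candidates Loc (q * k)%N%:R c)
  _ P0 (fun _ c => few_candidates (q * k)%N c loc Cq)
  (fun t s y => recorded (fun x => x \in F) (fun=> True) s t) enc
  (fun x => x \in F) (fun _ _ _ => False) e e 0 BF BF0 recP t1 t2 t3 h4.
rewrite [entropy G (conv_pow G mu 0)]entropy_dirac// adde0 (HNE G1 GM)//.
rewrite (_ : E _ _ = 0%E); last first.
  rewrite -[RHS](pmf_cste (prob_pmf (conv_pow_prob G1 GM k pmu)) (lexx 0%E)).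
  apply: eq_E => z _; rewrite diracE.
    have -> : @dirac_id R X id = 1 by rewrite /dirac_id; case: pselect.
    by rewrite /nlog oner_eq0 ln1 oppr0.
  by rewrite nlog_ge0// pmf_le1//; exact: (prob_pmf (dirac_prob G1)).
rewrite add0e lee_fin mulr0 addr0 => hH.
have k0' : 0 < k%:R :> R by rewrite ltr0n.
apply: (le_trans (hle k k0)); rewrite ler_pdivrMr//; apply: (le_trans hH).
have : k%:R * (- ln (1 - th) + - ln (th / 2) * e + e) <= k%:R * (2 * eta) by rewrite ler_wpM2l// ltW.
have : 0 < eta * k%:R by rewrite mulr_gt0.
have -> : eps = 4 * eta by rewrite /eta; field.
lra.
Qed.

Lemma almost_additive (z0 : X -> X) (c0 m0 n1 n2 : nat) :
  disperses d o g gi z0 c0 -> (0 < m0)%N -> 0 < conv_pow G mu n1 z0 ->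
  0 < conv_pow G mu n2 (iter m0 g) ->
  forall eps : R, 0 < eps -> exists k, [/\ (0 < k)%N &
     \forall i \near \oo, exists N, forall n, (N <= n)%N ->
       (HN (G := G) (mu_ i) n + HN (G := G) (mu_ i) k <=
        HN (G := G) (mu_ i) (n + k) + eps * k%:R)%R].
Proof.
move=> disp m00 pz0 pg eps eps0.
have Gz0 : G z0 by apply: (prob_supp (conv_pow_prob G1 GM n1 pmu)); rewrite gt_eqF.
(* One [eta] pays for the number of candidates, two for [threshold_ex], one for the bad times. *)
pose eta := eps / 4; have eta0 : 0 < eta by rewrite divr_gt0.
have [th [e [th01 e0 cost]]] := threshold_ex eta0.
have [F [BF [BF0 tails]]] := entropy_tail pmu pmu_ cmu fmu cH e0.
have B0 : 0 <= - ln (th / 2) by rewrite oppr_ge0 ln_le0//; lra.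
pose e3 := eta / (2 * (- ln (th / 2) + BF) + 1).
have e30 : 0 < e3 by rewrite divr_gt0//; lra.
have e3eta : 2 * (- ln (th / 2) + BF) * e3 <= eta.
  rewrite /e3 mulrCA ler_piMr ?(ltW eta0)// ler_pdivrMr; lra.
have [N [Q hloc]] := locator_good geoX Giso GM GV axis wpd.
have [V [VG [n0 hV]]] := good_probability G1 GM pmu pmu_ cmu
  (good_shift (d := d) (o := o) (g := g) (gi := gi) (K := K) (N := N))
  (schottky_words geoX Giso G1 GM GV Gg Ggi gK gK' axis N pmu Gz0 disp m00 pz0 pg) e30.
have [C /choice[Loc hLoc]] := hloc V VG.
have loc w : locator d o G (Loc w) C (size V * Q + 1) by case: (hLoc w).
have C0 : 0 <= C.
  have [[s' l0] r _ _] := loc id; exact: le_trans (normr_ge0 _) (r _ _ _ _ _ _ l0 l0).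
have [L [L0 FL]] := seq_bound (fun x : X -> X => d o (x o)) F.
have [q Lq] : exists q : nat, L + 2 * C <= q%:R.
  by exists (Num.truncn (L + 2 * C)).+1; exact/ltW/truncnS_gt.
(* [k] is chosen after [F], [V] and the locator constants, which must not depend on it. *)
have [k k0 hk] := ln_affine_le q ((2 * q + 1).+1 * (size V * Q + 1)) eta0.
have Cq : C <= q%:R by lra.
exists k; split=> //.
have [fin _] := HN_cvg G1 GM 0%N pmu_ pmu cmu fmu cH.
apply: filterS3 fin tails hV => i fi [t1 t2 t3] hVi.
exists n0 => m n0m.
have P0 : (0 < (2 * (q * k)).+1 * ((2 * q + 1).+1 * (size V * Q + 1)).+1)%N by [].
(* Being good depends on the future through the endpoint; the encoder uses it, the decoder does
   not. *)
pose gd s (y : X -> X) t := good d o g gi K N V (prodc (take t s)) (prodc s \o y).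
have Gprod s : all (fun x => 0 < mu_ i x) s -> G (prodc s).
  move=> ps; apply: (prob_supp (conv_pow_prob G1 GM (size s) (pmu_ i))).
  by rewrite gt_eqF// supp_prodc.
have enc s y : size s = k -> all (fun x => 0 < mu_ i x) s -> 0 < conv_pow G (mu_ i) m y ->
    exists c, [/\ size c = k, candidates (Loc (prodc s \o y)) (q * k)%N%:R c (prodc s) &
      forall t, (t < k)%N -> nth None c t = None \/
        (recorded (fun x => x \in F) (gd s y) s t /\
         exists b, nth None c t = Some (nth id s t, b))].
  move=> sk ps _; rewrite -sk.
  apply: (good_times_code (loc _) L0 C0 Lq FL (supp_G (pmu_ i) ps)) => t _ gdt.
  apply: (hLoc _).2 => //; apply: Gprod; move: ps.
  by rewrite -{1}(cat_take_drop t s) all_cat => /andP[].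
have recP t s (y : X -> X) : recorded (fun x => x \in F) (gd s y) s t ->
    nth id s t \notin F \/ ~ gd s y t \/ ~ gd s y t.+1.
  move=> r; have [h|h] := boolP (nth id s t \in F); last by left.
  right; have [h1|h1] := pselect (gd s y t); last by left.
  by right => h2; apply: r.
have h4 t : (t <= k)%N -> (EE (G := G) (mu_ i) k m (fun s y => ind (~ gd s y t)) <= e3%:E)%E.
  move=> tk.
  apply: le_trans (@EE_suffix R X G G1 GM (mu_ i) k m (pmu_ i) t
    (fun z y => ind (~ good d o g gi K N V z (z \o y))) e3 (ltW e30) tk
    (fun z y => ind_ge0 _) _).
    apply: le_EE => // s y _ _ _; apply: le_ind; apply: contra_not.
    by rewrite compA -prodc_cat cat_take_drop.
  move=> z Gz; apply: hVi => //; exact: leq_trans (leq_addl _ _).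
have Winj (z : X -> X) : G z -> injective (fun y : X -> X => z \o y).
  move=> Gz y y' /(congr1 (fun f => f : X -> X)) h; apply/funext => x.
  by have [zb _] := Giso Gz; apply: (bij_inj zb); exact: (congr1 (fun f => f x) h).
have pkm := conv_pow_prob G1 GM (k + m) (pmu_ i).
have := @coding_cost R X G G1 GM (mu_ i) th k m (pmu_ i) th01 (fun z y => z \o y)
  (conv_pow G (mu_ i) (k + m)) (prob_pmf pkm) Winj
  (fun w c => candidates (Loc w) (q * k)%N%:R c)
  _ P0 (fun w c => few_candidates (q * k)%N c (loc w) Cq)
  (fun t s y => recorded (fun x => x \in F) (gd s y) s t) enc
  (fun x => x \in F) (fun t s y => ~ gd s y t) e e e3 BF BF0 recP t1 t2 t3 h4.
have l0 w : (0 <= nlog (conv_pow G (mu_ i) (k + m) w))%E.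
  by rewrite nlog_ge0// pmf_le1//; exact: (prob_pmf pkm).
rewrite -(conv_powD G1 GM k m (pmu_ i) l0).
rewrite -(entropyE pkm) !(HNE G1 GM)// -!EFinD lee_fin addnC => hH.
rewrite addrC; apply: (le_trans hH); rewrite lerD2l.
have k0' : 0 < k%:R :> R by rewrite ltr0n.
have : k%:R * (- ln (1 - th) + - ln (th / 2) * e + e + 2 * (- ln (th / 2) + BF) * e3)
    <= k%:R * (3 * eta).
  by rewrite ler_wpM2l ?(ltW k0')//; lra.
have -> : eps = 4 * eta by rewrite /eta; field.
lra.
Qed.

End Assembly.

Theorem theorem1p7 (R : realType) (X : choiceType) (d : X -> X -> R) (o : X)
    (G : set (X -> X)) (g : X -> X) (mu : (X -> X) -> R)
    (mu_ : nat -> (X -> X) -> R) :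
  geodesic_space d ->
  countable_isometry_group d G ->
  G g -> WPD d G o g ->
  prob_on G mu ->
  (exists n m : nat, (0 < n)%N /\ (0 < m)%N /\ 0 < conv_pow G mu n (iter m g)) ->
  (forall i, prob_on G (mu_ i)) ->
  (forall f, (fun i => mu_ i f) @ \oo --> mu f) ->
  (entropy G mu < +oo)%E ->
  (fun i => entropy G (mu_ i)) @ \oo --> entropy G mu ->
  (fun i => asymp_entropy G (mu_ i)) @ \oo --> asymp_entropy G mu.
Proof.
move=> geoX [_ [Giso [G1 [GM GV]]]] Gg [[gi [K [gK [gK' axis]]]] wpd] pmu
  [n2 [m [_ [m0 pg]]]] pmu_ cmu fmu cH.
(* [contracting] provides [gi] only as a map; it is the inverse of [g], hence in [G]. *)
have Ggi : G gi.
  have [g' [Gg' [g'g _]]] := GV g Gg.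
  suff -> : gi = g' by [].
  apply/funext => x; rewrite -[in LHS](congr1 (fun f => f (gi x)) g'g) /=.
  by congr g'; exact: (congr1 (fun f => f x) gK').
apply: (asymp_entropy_cvg G1 GM) => //.
have [[n1 [z [c [pz dz]]]]|nd] := pselect (exists n z c, 0 < conv_pow G mu n z /\
    disperses d o g gi z c).
  right; exact: (almost_additive geoX Giso G1 GM GV Gg Ggi gK gK' axis wpd
    pmu pmu_ cmu fmu cH dz m0 pz pg).
left; apply: (asymp_entropy_along geoX Giso G1 GM GV Gg Ggi gK gK' axis wpd) => //.
by move=> n z pz c dz; apply: nd; exists n, z, c.
Qed.
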